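(* Let $(\mathfrak{B},\mathcal{L}_H)$ be the loop-space Floer space, $\mathfrak{P}\subset\mathfrak{B}$ the unit ball in the $L^2_2$-norm and $\rho$ the cutoff function of the context. Given a chain $\sigma:P\to\mathfrak{B}$ for $(\mathfrak{B},\mathcal{L}_H)$, the map $$F:P\times\mathfrak{P}\to\mathfrak{B},\qquad F(x,v)=\sigma(x)+\rho\big(\|\sigma(x)\|^2_{L^2_{1/2}}\big)\,v$$ satisfies: 1. $F(x,0)=\sigma(x)$. 2. $DF_{(x,v)}$ has dense image for all $(x,v)$. 3. $\Pi^-\circ D_xF$ is Fredholm, and $\Pi^+\circ D_xF$ and $D_vF$ are compact. 4. Given a compact lc-manifold $K\subset\mathfrak{P}$, $F|_{P\times K}$ is again a chain for $(\mathfrak{B},\mathcal{L}_H)$.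
   Context: All Hilbert manifolds are separable. lc-manifolds. A second countable Hausdorff space $P$ is stratified by Hilbert manifolds of depth $k$ if there are closed subsets $P^k\subset\dots\subset P^0=P$ (put $P^{k+1}=\emptyset$) with each open stratum $P^i\setminus P^{i+1}$ a Hilbert manifold. $[0,1)^i$ is stratified by the number of vanishing coordinates. An lc-chart about an open $V\subset P^i\setminus P^{i+1}$ is an open embedding $f:V\times U_0\to P$ of stratified spaces ($U_0$ a neighbourhood of $0$ in $[0,1)^i$), a diffeomorphism onto its image on each stratum, with $f(v,0)=v$. $P$ is an lc-manifold if it is covered by lc-charts, with no further compatibility. A map $\sigma:P\to X$ to a Hilbert manifold is lc-smooth if it is continuous, smooth on each open stratum, and each point has an lc-chart $V\times U_0$ in which $\sigma$ and its first derivative in the $V$-direction are continuous. $D\sigma_p$ is the differential restricted to the open stratum containing $p$; $D_xF$, $D_vF$ are the partial differentials of $F$. Chains. Let $\mathfrak{B}$ be a Hilbert space with splitting $T\mathfrak{B}=T^+\mathfrak{B}\oplus T^-\mathfrak{B}$ (projections $\Pi^\pm$), its weak topology, and a continuous $\mathcal{L}:\mathfrak{B}\to\mathbb{R}$. A chain is an lc-smooth map $\sigma:P\to\mathfrak{B}$ from an lc-manifold such that: (1) on $\mathrm{im}(\sigma)$, $\mathcal{L}$ is bounded below and lower semicontinuous for the weak topology; (2) if $\sigma(x_i)$ converges weakly to $y$ and $\lim\mathcal{L}(\sigma(x_i))=\mathcal{L}(y)$, then some subsequence of $x_i$ converges in $P$; (3) any subset of $\mathrm{im}(\sigma)$ on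 which $\mathcal{L}$ is bounded is weakly precompact; (4) for each $p\in P$, $\Pi^-\circ D\sigma_p$ is Fredholm and $\Pi^+\circ D\sigma_p$ is compact. Loop space. $S^1=\mathbb{R}/2\pi\mathbb{Z}$, $\mathfrak{B}=L^2_{1/2}(S^1,\mathbb{C}^n)$ with $\|\sum_m c_me^{im\theta}\|^2_{L^2_{1/2}}=\sum_m|c_m|^2|m|+|c_0|^2$; $J$ is the standard complex structure; $H:\mathbb{C}^n\to\mathbb{R}$ is smooth, zero near $0$, and equal to $(1+\epsilon)|x|^2$ for $|x|$ large ($\epsilon>0$); $\mathcal{L}_H(\gamma)=\int_{S^1}\frac12\langle-J\dot\gamma,\gamma\rangle-H(\gamma)\,d\theta$. Polarization: $T^-\mathfrak{B}$ is the closed span of eigenvectors of $-J\partial_\theta$ with positive eigenvalue, $T^+\mathfrak{B}$ that of eigenvectors with nonpositive eigenvalue. $\rho:\mathbb{R}\to\mathbb{R}$ is a fixed smooth positive function with $\rho=1$ on $[-1,1]$ and $\rho(x)=1/x^2$ outside $[-2,2]$. $\mathfrak{P}$ carries the $L^2_2$ topology.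
   Formalization: In condition (1) of a chain, lower semicontinuity of L for the weak topology is required along im(σ) at every weak limit in 𝔅, not only at limits lying in im(σ); with the latter reading item 4 is false. *)

(* Defs.v *)
From HB Require Import structures.
From mathcomp Require Import all_boot all_order all_algebra.
From mathcomp Require Import all_classical all_reals all_analysis.
From mathcomp Require Import ring lra.
Set Implicit Arguments.
Unset Strict Implicit.
Unset Printing Implicit Defensive.
Import Order.TTheory GRing.Theory Num.Theory.
Import numFieldNormedType.Exports.
Local Open Scope classical_set_scope.
Local Open Scope ring_scope.

(* (x, y) stands for x + iy in C^n. *)
Definition Cn (R : realType) (n : nat) : normedModType R :=
  ('rV[R]_n * 'rV[R]_n)%type.

Definition Jst (R : realType) (n : nat) (z : Cn R n) : Cn R n := (- z.2, z.1).

Definition cdot (R : realType) (n : nat) (z w : Cn R n) : R :=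
  \sum_(k < n) (z.1 ord0 k * w.1 ord0 k + z.2 ord0 k * w.2 ord0 k).

Definition csq (R : realType) (n : nat) (z : Cn R n) : R := cdot z z.

(* e^{i phi} z *)
Definition crot (R : realType) (n : nat) (phi : R) (z : Cn R n) : Cn R n :=
  cos phi *: z + sin phi *: Jst z.

(* The sum of f m over - N <= m <= N; Negz k is - (k + 1). *)
Definition symsum (V : nmodType) (f : int -> V) (N : nat) : V :=
  \sum_(k < N.+1) f k%:Z + \sum_(k < N) f (Negz k).

(* Squared norm of L^2_{p/2}: |c_0|^2 + sum_{m <> 0} |m|^p |c_m|^2, so that
   p = 1 is L^2_{1/2} and p = 4 is L^2_2. *)
Definition sobw (R : realType) (p : nat) (m : int) : R :=
  if m == 0 then 1 else (`|m|%N ^ p)%:R.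

Definition sob_part (R : realType) (p n : nat) (c d : int -> Cn R n) (N : nat)
    : R :=
  symsum (fun m => sobw R p m * cdot (c m) (d m)) N.

Definition in_sob (R : realType) (p n : nat) : {pred int -> Cn R n} :=
  fun c => `[< exists M : R, forall N : nat, sob_part p c c N <= M >].
Arguments in_sob : clear implicits.

Lemma in_sobP (R : realType) (p n : nat) (c : int -> Cn R n) :
  reflect (exists M : R, forall N : nat, sob_part p c c N <= M)
    (c \in in_sob R p n).
Proof. exact: asboolP. Qed.

Section SemiInnerProduct.
Context {R : realType} {V : lmodType R} (B : V -> V -> R).
Hypotheses (BD : forall x y z, B (x + y) z = B x z + B y z)
  (BZ : forall t x z, B (t *: x) z = t * B x z)
  (BC : forall x y, B x y = B y x) (B0 : forall x, 0 <= B x x).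

Lemma sip_sqrD x y t : B (x + t *: y) (x + t *: y) =
  B x x + 2 * t * B x y + t ^+ 2 * B y y.
Proof.
rewrite BD (BC x) (BC (t *: y)) !BD !BZ (BC x (t *: y)) !BZ (BC y x) (BC y).
rewrite BZ; ring.
Qed.

Lemma sip_CS x y : B x y ^+ 2 <= B x x * B y y.
Proof.
have [By0|] := eqVneq (B y y) 0.
  rewrite By0 mulr0; have [->|Bxy] := eqVneq (B x y) 0; first by rewrite expr0n.
  have := B0 (x + (- (B x x + 1) / (2 * B x y)) *: y).
  rewrite sip_sqrD By0 mulr0 addr0.
  have -> : 2 * (- (B x x + 1) / (2 * B x y)) * B x y = - (B x x + 1) by field.
  lra.
move=> By0; have Byp : 0 < B y y by rewrite lt_neqAle eq_sym By0 B0.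
have := B0 (x + (- B x y / B y y) *: y).
rewrite sip_sqrD.
have -> : B x x + 2 * (- B x y / B y y) * B x y +
  (- B x y / B y y) ^+ 2 * B y y = (B x x * B y y - B x y ^+ 2) / B y y.
  by field.
by rewrite pmulr_lge0 ?invr_gt0// subr_ge0.
Qed.

Lemma sip_triangle x y (a b : R) : 0 <= a -> 0 <= b ->
  B x x <= a ^+ 2 -> B y y <= b ^+ 2 -> B (x + y) (x + y) <= (a + b) ^+ 2.
Proof.
move=> a0 b0 xa yb.
rewrite -[y in x + y]scale1r sip_sqrD.
have h : B x y <= a * b.
  apply: le_trans (ler_norm _) _.
  rewrite -(@ler_pXn2r _ 2)// ?nnegrE ?mulr_ge0// real_normK ?num_real//.
  by rewrite exprMn (le_trans (sip_CS x y))// ler_pM.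
rewrite (_ : _ ^+ 2 = a ^+ 2 + 2 * (a * b) + b ^+ 2); last by ring.
lra.
Qed.

End SemiInnerProduct.

Section SobolevNorm.
Context {R : realType} {p n : nat}.
Implicit Types (a b : int -> Cn R n) (z w : Cn R n).

Lemma cdotD z z' w : cdot (z + z') w = cdot z w + cdot z' w.
Proof. by rewrite /cdot -big_split/=; apply: eq_bigr => k _; rewrite !mxE; ring. Qed.

Lemma cdotZ t z w : cdot (t *: z) w = t * cdot z w.
Proof. by rewrite /cdot mulr_sumr; apply: eq_bigr => k _; rewrite !mxE; ring. Qed.

Lemma cdotC z w : cdot z w = cdot w z.
Proof. by apply: eq_bigr => k _; rewrite mulrC [X in _ + X]mulrC. Qed.

Lemma csq_ge0 z : 0 <= cdot z z.
Proof. by apply: sumr_ge0 => k _; rewrite addr_ge0// -expr2 sqr_ge0. Qed.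

Lemma csq_eq0 z : cdot z z = 0 -> z = 0.
Proof.
move=> /psumr_eq0P h; have {}h k : z.1 ord0 k = 0 /\ z.2 ord0 k = 0.
  have /(_ k isT)/eqP := h (fun k _ => addr_ge0 (sqr_ge0 (z.1 ord0 k)) (sqr_ge0 _)).
  by rewrite -!expr2 paddr_eq0 ?sqr_ge0// !sqrf_eq0 => /andP[/eqP-> /eqP->].
case: z h => x y /= h; congr pair; apply/rowP => k; rewrite mxE;
  by have [] := h k.
Qed.

Lemma sobw_ge0 m : 0 <= sobw R p m.
Proof. by rewrite /sobw; case: ifP => // _; rewrite ler0n. Qed.

Lemma sobw_gt0 m : 0 < sobw R p m.
Proof.
rewrite /sobw; case: ifP => // /negbT m0.
by rewrite ltr0n expn_gt0 absz_gt0 m0.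
Qed.

Lemma sob_partD a b c N :
  sob_part p (a + b) c N = sob_part p a c N + sob_part p b c N.
Proof.
rewrite /sob_part /symsum addrACA -!big_split/=.
by congr (_ + _); apply: eq_bigr => k _; rewrite cdotD mulrDr.
Qed.

Lemma sob_partZ t a c N : sob_part p (t *: a) c N = t * sob_part p a c N.
Proof.
rewrite /sob_part /symsum mulrDr !mulr_sumr.
by congr (_ + _); apply: eq_bigr => k _; rewrite cdotZ mulrCA.
Qed.

Lemma sob_partC a b N : sob_part p a b N = sob_part p b a N.
Proof.
by rewrite /sob_part /symsum; congr (_ + _); apply: eq_bigr => k _; rewrite cdotC.
Qed.

Lemma sob_part_ge0 a N : 0 <= sob_part p a a N.
Proof.
by rewrite addr_ge0// sumr_ge0// => k _; rewrite mulr_ge0 ?sobw_ge0 ?csq_ge0.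
Qed.

Lemma sob_part_nd a : nondecreasing_seq (sob_part p a a).
Proof.
apply/nondecreasing_seqP => N; rewrite /sob_part /symsum.
rewrite [in leRHS]big_ord_recr [X in _ <= _ + X]big_ord_recr/= lerD//.
  by rewrite lerDl mulr_ge0 ?sobw_ge0 ?csq_ge0.
by rewrite lerDl mulr_ge0 ?sobw_ge0 ?csq_ge0.
Qed.

Lemma sob_part_is_cvg a : a \in in_sob R p n -> cvgn (sob_part p a a).
Proof.
move=> /in_sobP[M aM]; apply: nondecreasing_is_cvgn.
  exact: sob_part_nd.
by exists M => _ [N _ <-].
Qed.

Definition sob_norm a : R := Num.sqrt (limn (sob_part p a a)).

Lemma sob_norm_ge0 a : 0 <= sob_norm a.
Proof. exact: sqrtr_ge0. Qed.

Lemma sob_part_le a N : a \in in_sob R p n ->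
  sob_part p a a N <= sob_norm a ^+ 2.
Proof.
move=> aS.
have h : sob_part p a a N <= limn (sob_part p a a).
  exact: nondecreasing_cvgn_le (sob_part_nd a) (sob_part_is_cvg aS) N.
by rewrite sqr_sqrtr// (le_trans (sob_part_ge0 a N)).
Qed.

Lemma sob_norm_le a M : a \in in_sob R p n -> 0 <= M ->
  (forall N, sob_part p a a N <= M ^+ 2) -> sob_norm a <= M.
Proof.
move=> aS M0 aM; rewrite /sob_norm -(ger0_norm M0) -sqrtr_sqr.
apply: ler_wsqrtr.
by apply: limr_le; [exact: sob_part_is_cvg|exact: nearW].
Qed.

Lemma in_sob_submod_closed : submod_closed (in_sob R p n).
Proof.
split=> [|t a b aS bS]; apply/in_sobP.
  exists 0 => N; rewrite -(scale0r (0 : int -> Cn R n)) sob_partZ mul0r.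
  exact: lexx.
exists ((`|t| * sob_norm a + sob_norm b) ^+ 2) => N.
apply: (@sip_triangle _ _ (fun c d => sob_part p c d N)) .
- by move=> *; exact: sob_partD.
- by move=> *; exact: sob_partZ.
- by move=> *; exact: sob_partC.
- by move=> *; exact: sob_part_ge0.
- by rewrite mulr_ge0// sob_norm_ge0.
- exact: sob_norm_ge0.
- rewrite sob_partZ sob_partC sob_partZ mulrA -expr2 exprMn real_normK ?num_real//.
  by rewrite ler_wpM2l ?sqr_ge0// sob_part_le.
- exact: sob_part_le.
Qed.

HB.instance Definition _ :=
  GRing.isSubmodClosed.Build R (int -> Cn R n) (in_sob R p n)
    in_sob_submod_closed.

End SobolevNorm.

(* L^2_{p/2}(S^1, C^n); the element with Fourier coefficients c is the loop
   sum_m c_m e^{i m theta}. *)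
Record Sob (R : realType) (p n : nat) := MkSob {
  fcoef :> int -> Cn R n;
  fcoef_in : fcoef \in in_sob R p n }.

Section SobolevSpace.
Context {R : realType} {p n : nat}.

HB.instance Definition _ := [isSub for @fcoef R p n].
HB.instance Definition _ := [Choice of Sob R p n by <:].
HB.instance Definition _ := [SubChoice_isSubLmodule of Sob R p n by <:].

Let nrm (x : Sob R p n) : R := sob_norm (p := p) (fcoef x).

Let nrmD x y : nrm (x + y) <= nrm x + nrm y.
Proof.
apply: sob_norm_le; first exact: fcoef_in.
  by rewrite addr_ge0 ?sob_norm_ge0.
move=> N; apply: (@sip_triangle _ _ (fun c d => sob_part p c d N)) .
- by move=> *; exact: sob_partD.
- by move=> *; exact: sob_partZ.
- by move=> *; exact: sob_partC.
- by move=> *; exact: sob_part_ge0.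
- exact: sob_norm_ge0.
- exact: sob_norm_ge0.
- by apply: sob_part_le; exact: fcoef_in.
- by apply: sob_part_le; exact: fcoef_in.
Qed.

Let nrmZ_le t x : nrm (t *: x) <= `|t| * nrm x.
Proof.
apply: sob_norm_le; first exact: fcoef_in.
  by rewrite mulr_ge0// sob_norm_ge0.
move=> N; rewrite sob_partZ sob_partC sob_partZ mulrA -expr2 exprMn.
rewrite real_normK ?num_real// ler_wpM2l ?sqr_ge0// sob_part_le//.
exact: fcoef_in.
Qed.

Let nrmZ t x : nrm (t *: x) = `|t| * nrm x.
Proof.
apply/eqP; rewrite eq_le nrmZ_le/=.
have [->|t0] := eqVneq t 0; first by rewrite normr0 mul0r sob_norm_ge0.
rewrite -ler_pdivlMl ?normr_gt0// -normfV.
by apply: le_trans (nrmZ_le _ _); rewrite scalerA mulVf// scale1r.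
Qed.

Let nrm0_eq0 x : nrm x = 0 -> x = 0.
Proof.
move=> x0; apply: val_inj; apply/funext => m /=.
have xle N : sob_part p x x N <= 0.
  apply: le_trans (sob_part_le N (fcoef_in x)) _.
  by rewrite [sob_norm _]x0 expr0n.
have {}xle N : sob_part p x x N = 0.
  by apply/eqP; rewrite eq_le xle sob_part_ge0.
have tge0 k : 0 <= sobw R p k * cdot (x k) (x k).
  by rewrite mulr_ge0 ?sobw_ge0 ?csq_ge0.
have /eqP := xle `|m|%N.+1; rewrite paddr_eq0; last 2 first.
  by apply: sumr_ge0.
  by apply: sumr_ge0.
move=> /andP[/eqP h1 /eqP h2]; apply: csq_eq0.
have : sobw R p m * cdot (x m) (x m) = 0.
  case: m h1 h2 => k.
    move=> /psumr_eq0P h1 _.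
    have kl : (k < `|k|%N.+2)%N by rewrite absz_nat ltnW// ltnS.
    exact: (h1 (fun i _ => tge0 i) (Ordinal kl)).
  move=> _ /psumr_eq0P h2.
  have kl : (k < `|Negz k|%N.+1)%N by rewrite NegzE abszN absz_nat ltnS ltnW.
  exact: (h2 (fun i _ => tge0 (Negz i)) (Ordinal kl)).
by move=> /eqP; rewrite mulf_eq0 gt_eqF ?sobw_gt0//= => /eqP.
Qed.

HB.instance Definition _ :=
  Lmodule_isNormed.Build R (Sob R p n) nrmD nrmZ nrm0_eq0.

End SobolevSpace.

Lemma Sob_normE (R : realType) (p n : nat) (x : Sob R p n) :
  `|x| ^+ 2 = limn (sob_part p x x).
Proof.
rewrite [LHS]sqr_sqrtr//; apply: limr_ge; first exact/sob_part_is_cvg/fcoef_in.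
by apply: nearW => N; exact: sob_part_ge0.
Qed.

Lemma sobw_le (R : realType) (p q : nat) (m : int) :
  (p <= q)%N -> sobw R p m <= sobw R q m.
Proof.
move=> pq; rewrite /sobw; have [//|m0] := eqVneq m 0.
by rewrite ler_nat leq_pexp2l// absz_gt0.
Qed.

Lemma in_sobS (R : realType) (p q n : nat) (c : int -> Cn R n) :
  (p <= q)%N -> c \in in_sob R q n -> c \in in_sob R p n.
Proof.
move=> pq /in_sobP[M cM]; apply/in_sobP; exists M => N.
apply: le_trans (cM N).
by apply: lerD; apply: ler_sum => k _; rewrite ler_wpM2r ?csq_ge0 ?sobw_le.
Qed.

Definition Bhalf (R : realType) (n : nat) : normedModType R := Sob R 1 n.
Definition L22 (R : realType) (n : nat) : normedModType R := Sob R 4 n.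

Definition incl22 (R : realType) (n : nat) (v : L22 R n) : Bhalf R n :=
  MkSob (in_sobS (isT : (1 <= 4)%N) (fcoef_in v)).

(* - J d/dtheta on Fourier coefficients: it multiplies c_m by - i (i m) = m. *)
Definition mJd (R : realType) (n : nat) (c : int -> Cn R n) : int -> Cn R n :=
  fun m => - Jst (m%:~R *: Jst (c m)).

Definition fourier_sum (R : realType) (n : nat) (c : int -> Cn R n) (N : nat)
    (theta : R) : Cn R n :=
  symsum (fun m => crot (m%:~R * theta) (c m)) N.

(* The function g is the L^2 sum of the Fourier series with coefficients c. *)
Definition is_loop (R : realType) (n : nat) (c : int -> Cn R n)
    (g : R -> Cn R n) : Prop :=
  (forall k : 'I_n,
     measurable_fun `[0, 2 * pi] (fun t => (g t).1 ord0 k) /\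
     measurable_fun `[0, 2 * pi] (fun t => (g t).2 ord0 k)) /\
  (fun N => \int[lebesgue_measure]_(t in `[0%R, (2 * pi)%R])
              (csq (g t - fourier_sum c N t)%R)%:E)%E @ \oo --> 0%E.

Definition loop (R : realType) (n : nat) (c : int -> Cn R n) : R -> Cn R n :=
  xget (cst 0) [set g | is_loop c g].

(* For a loop of class L^2_{1/2} the integral of <- J g', g> is the pairing of
   L^2_{-1/2} with L^2_{1/2}, that is 2 pi sum_m <(- J g')_m, g_m>. *)
Definition action (R : realType) (n : nat) (H : Cn R n -> R) (c : Bhalf R n)
    : R :=
  2^-1 * (2 * pi * limn (symsum (fun m => cdot (mJd c m) (c m))))
  - \int[lebesgue_measure]_(t in `[0, 2 * pi]) H (loop c t).

Section LinearAlgebra.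
Context {R : realType}.
Implicit Types E F : normedModType R.

Definition in_span E (s : seq E) (x : E) : Prop :=
  exists c : 'I_(size s) -> R, x = \sum_(i < size s) c i *: s`_i.

Definition closed_span E (A : set E) : set E :=
  closure [set x | exists2 s : seq E, {in s, forall y, A y} & in_span s x].

(* The projection onto V along W. *)
Definition proj_along E (V W : set E) (x : E) : E :=
  xget 0 [set y | V y /\ W (x - y)].

Definition compact_op E F (T : E -> F) : Prop :=
  linear T /\ forall A : set E, bounded_set A -> precompact (T @` A).

(* T is a Fredholm operator from E to the closed subspace V of F; the closed
   range is a consequence of the finite dimension of the cokernel. *)
Definition fredholm E F (V : set F) (T : E -> F) : Prop :=
  [/\ linear T, continuous T, forall x, V (T x),
      exists s : seq E, forall x, T x = 0 -> in_span s x &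
      exists2 s : seq F, {in s, forall y, V y} &
        forall y, V y -> exists x z, in_span s z /\ y = T x + z].

Definition dual E := {l : {linear E -> R^o} | continuous l}.

Definition weak E : topologicalType :=
  initial_topology
    (fun x : E => (fun l : dual E => sval l x) : prod_topology (fun _ => R^o)).

End LinearAlgebra.

Section Smoothness.
Context {R : realType}.

(* C^k on the open set U, by means of the tangent map (x, h) |-> Df(x) h;
   for k = infinity this is the usual Frechet smoothness. *)
Fixpoint Ck (k : nat) : forall E F : normedModType R, set E -> (E -> F) -> Prop :=
  match k with
  | 0 => fun E F U f => forall x, U x -> {for x, continuous f}
  | k'.+1 => fun E F U f => (forall x, U x -> differentiable f x) /\
      @Ck k' (E * E)%type F (U `*` setT) (fun z => 'd f (z.1) (z.2))
  end.

Definition smooth (E F : normedModType R) (U : set E) (f : E -> F) : Prop :=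
  forall k, Ck k U f.

Definition opnorm_continuous_on (T : topologicalType) (E F : normedModType R)
    (W : set T) (D : T -> E -> F) : Prop :=
  forall z, W z -> forall eps : R, 0 < eps ->
    \forall z' \near within W (nbhs z), forall h, `|D z' h - D z h| <= eps * `|h|.

(* E is a separable Hilbert space for an inner product defining its topology. *)
Definition hilbertable (E : normedModType R) : Prop :=
  [/\ exists (ip : E -> E -> R) (c d : R),
        [/\ forall x y, ip x y = ip y x,
            forall t x y z, ip (t *: x + y) z = t * ip x z + ip y z, 0 < c &
            forall x, c * `|x| ^+ 2 <= ip x x <= d * `|x| ^+ 2],
      forall G : set_system E, ProperFilter G -> cauchy G -> cvg G &
      exists2 D : set E, countable D & dense D].

End Smoothness.

Section Manifolds.
Context {R : realType}.

(* A chart is given by a parametrization of a part of P by an open subset of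
   its own model space, so that the dimension may vary with the component. *)
Record chart (P : Type) := Chart {
  cmod : normedModType R;
  cdom : set cmod;
  cpar : cmod -> P;
  ccoord : P -> cmod }.

Definition cimg (P : Type) (a : chart P) : set P := @cpar P a @` @cdom P a.

Definition rel_open (T : topologicalType) (S A : set T) : Prop :=
  exists2 O : set T, open O & A = O `&` S.

Definition is_chart (P : topologicalType) (S : set P) (a : chart P) : Prop :=
  [/\ hilbertable (cmod a), open (@cdom P a), rel_open S (cimg a),
      (forall e, cdom e -> ccoord a (cpar e) = e) &
      {within @cdom P a, continuous (@cpar P a)} /\
      {within cimg a, continuous (@ccoord P a)}].

Definition is_atlas (P : topologicalType) (S : set P) (A : chart P -> Prop)
    : Prop :=
  [/\ forall a, A a -> is_chart S a,
      forall x, S x -> exists2 a, A a & cimg a x &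
      forall a b, A a -> A b ->
        smooth [set e | cdom e /\ cimg b (@cpar P a e)]
          (fun e => ccoord b (@cpar P a e))].

(* sclosed i is P^i, and satlas i is an atlas of P^i \ P^(i+1). *)
Record stratified := Stratified {
  sspace :> topologicalType;
  sclosed : nat -> set sspace;
  satlas : nat -> chart sspace -> Prop }.

Definition ostrat (P : stratified) (i : nat) : set P :=
  @sclosed P i `\` @sclosed P i.+1.

Definition is_stratified (P : stratified) (k : nat) : Prop :=
  [/\ @second_countable P /\ hausdorff_space P,
      @sclosed P 0 = setT /\ (forall i, (k < i)%N -> @sclosed P i = set0),
      forall i, closed (@sclosed P i),
      forall i, @sclosed P i.+1 `<=` @sclosed P i &
      forall i, is_atlas (@ostrat P i) (@satlas P i)].

Definition corner (i : nat) : set 'rV[R]_i :=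
  [set u | forall k, 0 <= u ord0 k < 1].

Definition nvanish (i : nat) (u : 'rV[R]_i) : nat :=
  #|[pred k | u ord0 k == 0]|.

(* The projection of R^i onto the coordinates outside Z. A function on the face
   {u | u_k = 0 iff k \in Z} of [0,1)^i is smooth iff its composition with
   kill Z is smooth on an open subset of R^i. *)
Definition kill (i : nat) (Z : {set 'I_i}) (u : 'rV[R]_i) : 'rV[R]_i :=
  \row_k (if k \in Z then 0 else u ord0 k).

Definition lc_chart (P : stratified) (i : nat) (V : set P)
    (U0 : set 'rV[R]_i) (f : P * 'rV[R]_i -> P) : Prop :=
  [/\ rel_open (@ostrat P i) V,
      rel_open (@corner i) U0 /\ U0 0,
      forall v, V v -> f (v, 0) = v,
      forall z, (V `*` U0) z -> @ostrat P (nvanish z.2) (f z) &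
      exists g : P -> P * 'rV[R]_i,
      [/\ forall z, (V `*` U0) z -> g (f z) = z,
          open (f @` (V `*` U0)),
          {within V `*` U0, continuous f} /\
          {within f @` (V `*` U0), continuous g},
          forall (Z : {set 'I_i}) (a b : chart P),
            @satlas P i a -> @satlas P #|Z| b ->
            smooth
              [set z : cmod a * 'rV[R]_i |
                [/\ cdom z.1, V (cpar z.1), U0 (kill Z z.2),
                    forall k, k \notin Z -> 0 < z.2 ord0 k &
                    cimg b (f (cpar z.1, kill Z z.2))]]
              (fun z => ccoord b (f (cpar z.1, kill Z z.2))) &
          forall (j : nat) (a b : chart P),
            @satlas P i a -> @satlas P j b ->
            smooth
              [set y : cmod b | [/\ cdom y, (f @` (V `*` U0)) (cpar y) &
                                    cimg a (g (cpar y)).1]]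
              (fun y => (ccoord a (g (cpar y)).1, (g (cpar y)).2))]].

Definition is_lc_manifold (P : stratified) : Prop :=
  (exists k, is_stratified P k) /\
  forall x : P, exists i V U0 f, @lc_chart P i V U0 f /\ (f @` (V `*` U0)) x.

(* The differential of s : P -> X at the point of parameter e, restricted to the
   open stratum, whose tangent space is identified with cmod a. *)
Definition Dchart (P : stratified) (X : normedModType R) (s : P -> X)
    (a : chart P) (e : cmod a) : cmod a -> X :=
  'd (fun e' : cmod a => s (cpar e')) e.

Definition lc_smooth (P : stratified) (X : normedModType R) (s : P -> X)
    : Prop :=
  [/\ continuous s,
      forall i a, @satlas P i a ->
        smooth (@cdom P a) (fun e => s (cpar e)) &
      forall i x, @ostrat P i x -> exists V U0 f,
        [/\ @lc_chart P i V U0 f, V x &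
            forall a, @satlas P i a ->
            let W := [set z : cmod a * 'rV[R]_i |
                        [/\ cdom z.1, V (cpar z.1) & U0 z.2]] in
            let sV z := fun e : cmod a => s (f (cpar e, z.2)) in
            (forall z, W z -> differentiable (sV z) z.1) /\
            opnorm_continuous_on W (fun z => 'd (sV z) (z.1))]].

Definition prod_chart (P Q : Type) (a : chart P) (b : chart Q)
    : chart (P * Q) :=
  @Chart (P * Q) (cmod a * cmod b)%type (@cdom P a `*` @cdom Q b)
    (fun e => (cpar e.1, cpar e.2)) (fun x => (ccoord a x.1, ccoord b x.2)).

Definition prod_strat (P Q : stratified) : stratified :=
  @Stratified (P * Q)%type
    (fun m => [set x | exists i j : nat,
       [/\ (i + j)%N = m, @sclosed P i x.1 & @sclosed Q j x.2]])
    (fun m c => exists (i j : nat) (a : chart P) (b : chart Q),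
       [/\ (i + j)%N = m, @satlas P i a, @satlas Q j b & c = prod_chart a b]).

(* Tm and Tp are the summands T^- and T^+ of the polarization of B.
   Lower semicontinuity on the image of s is along nets in the image which
   converge weakly to an arbitrary point of B: for the subspace topology of the
   image it would not be preserved by perturbations of s. *)
Definition is_chain (B : normedModType R) (Tm Tp : set B) (L : B -> R)
    (P : stratified) (s : P -> B) : Prop :=
  [/\ is_lc_manifold P /\ lc_smooth s,
      (exists m : R, forall x, m <= L (s x)) /\
      (forall (y : B) (r : R), r < L y ->
         exists2 W, nbhs (y : weak B) W & forall x, W (s x) -> r < L (s x)),
      forall (x : nat -> P) (y : B),
        (fun k => s (x k) : weak B) @ \oo --> (y : weak B) ->
        (fun k => L (s (x k))) @ \oo --> L y ->
        exists (phi : nat -> nat) (q : P),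
          {homo phi : i j / (i < j)%N} /\ (fun k => x (phi k)) @ \oo --> q,
      forall A : set (weak B), A `<=` range s ->
        (exists M : R, forall y, A y -> `|L y| <= M) -> precompact A &
      forall i a, @satlas P i a -> forall e : cmod a, cdom e ->
        fredholm Tm (proj_along Tm Tp \o Dchart s e) /\
        compact_op (proj_along Tp Tm \o Dchart s e)].

End Manifolds.

Section LoopSpace.
Context {R : realType} {n : nat}.

Definition Tminus : set (Bhalf R n) :=
  closed_span [set c : Bhalf R n | exists2 l : R, 0 < l & mJd c = l *: fcoef c].

Definition Tplus : set (Bhalf R n) :=
  closed_span [set c : Bhalf R n | exists2 l : R, l <= 0 & mJd c = l *: fcoef c].

Definition Piminus : Bhalf R n -> Bhalf R n := proj_along Tminus Tplus.
Definition Piplus : Bhalf R n -> Bhalf R n := proj_along Tplus Tminus.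

Definition is_loop_chain (H : Cn R n -> R) (P : stratified)
    (s : P -> Bhalf R n) : Prop :=
  is_chain Tminus Tplus (action H) s.

Definition is_hamiltonian (eps : R) (H : Cn R n -> R) : Prop :=
  [/\ smooth setT (H : Cn R n -> R^o), \forall z \near 0, H z = 0 &
      exists r : R, forall z, r <= csq z -> H z = (1 + eps) * csq z].

Definition is_cutoff (rho : R -> R) : Prop :=
  [/\ smooth setT (rho : R^o -> R^o), forall x, 0 < rho x,
      forall x, `|x| <= 1 -> rho x = 1 &
      forall x, 2 < `|x| -> rho x = 1 / x ^+ 2].

(* The open ball. *)
Definition unit_ball22 : set (L22 R n) := [set v | `|v| < 1].

Definition perturb (rho : R -> R) (P : Type) (s : P -> Bhalf R n)
    (z : P * L22 R n) : Bhalf R n :=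
  s z.1 + rho (`|s z.1| ^+ 2) *: incl22 z.2.

End LoopSpace.

(* Main.v *)
(* The derivative of F differs from that of sigma by a rank one operator, the
   derivative of the cutoff factor, and by rho times the inclusion of L^2_2 into
   L^2_{1/2}, which is compact with dense image; this gives the first three claims.

   For the chain conditions, write L(s + r w) - L(s) as the pairing of s with r w,
   plus a term depending on r w only, plus the difference of the integrals of H,
   which is at most C (1 + |s| + |r w|) |r w| as H grows quadratically. Since
   r (1 + |s|) is bounded for r = rho(|s|^2), this difference is bounded. It also
   passes to the limit when s converges weakly, w strongly and r to r0: if r0 > 0
   then |s| stays bounded, so s converges strongly in L^2 by Rellich; if r0 = 0 then
   r (1 + |s|) tends to 0 by the decay of rho. As r and w range over compact sets,
   each chain condition for F reduces along a subsequence or an ultrafilter to the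
   one for sigma. Finally a compact lc-manifold is modelled on locally compact, hence
   finite dimensional, Hilbert spaces, so that its tangent directions do not affect
   the Fredholm property. *)
Require Import Defs.
From HB Require Import structures.
From mathcomp Require Import all_boot all_order all_algebra.
From mathcomp Require Import all_classical all_reals all_analysis.
From mathcomp Require Import measurable_realfun ring lra zify.
Set Implicit Arguments.
Unset Strict Implicit.
Unset Printing Implicit Defensive.
Import Order.TTheory GRing.Theory Num.Theory.
Import numFieldNormedType.Exports.
Local Open Scope classical_set_scope.
Local Open Scope ring_scope.

Lemma open_setX (T U : topologicalType) (A : set T) (B : set U) :
  open A -> open B -> open (A `*` B).
Proof.
rewrite !openE => oA oB [x y] [/= Ax By].
by exists (A, B) => //; split; [exact: oA|exact: oB].
Qed.

Lemma closed_setX (T U : topologicalType) (A : set T) (B : set U) :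
  closed A -> closed B -> closed (A `*` B).
Proof.
move=> cA cB; have -> : A `*` B = fst @^-1` A `&` snd @^-1` B by [].
apply: closedI.
  by apply: preimage_closed cA => z _; exact: cvg_fst.
by apply: preimage_closed cB => z _; exact: cvg_snd.
Qed.


(** * Differential calculus in normed spaces *)

Section Differentials.
Context {R : realType}.
Implicit Types E F G H : normedModType R.

Definition bounded_linear E F (T : E -> F) : Prop := linear T /\ continuous T.

Definition bounded_bilinear E F G (b : E -> F -> G) : Prop :=
  [/\ forall y, linear (b^~ y), forall x, linear (b x) &
      exists2 C : R, 0 <= C & forall x y, `|b x y| <= C * `|x| * `|y|].

Lemma linear_fun0 E F (T : E -> F) : linear T -> T 0 = 0.
Proof. by move=> TL; have := TL (-1) 0 0; rewrite !scaleN1r !addNr. Qed.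

Lemma linear_funD E F (T : E -> F) : linear T -> {morph T : x y / x + y}.
Proof. by move=> TL x y; have := TL 1 x y; rewrite !scale1r. Qed.

Lemma linear_funZ E F (T : E -> F) t : linear T -> {morph T : x / t *: x}.
Proof. by move=> TL x; have := TL t x 0; rewrite (linear_fun0 TL) !addr0. Qed.

Lemma linear_funN E F (T : E -> F) : linear T -> {morph T : x / - x}.
Proof. by move=> TL x; rewrite -scaleN1r (linear_funZ _ TL) scaleN1r. Qed.

Lemma linear_funB E F (T : E -> F) : linear T -> {morph T : x y / x - y}.
Proof. by move=> TL x y; rewrite (linear_funD TL) (linear_funN TL). Qed.

Lemma bounded_linear_bound E F (T : E -> F) : bounded_linear T ->
  exists2 C : R, 0 < C & forall x, `|T x| <= C * `|x|.
Proof.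
move=> [TL Tc].
pose m := GRing.isLinear.Build R E F *:%R T TL.
pose T' : {linear E -> F} := HB.pack T m.
have /linear_boundedP : bounded_near T' (nbhs 0).
  exact/linear_bounded_continuous.
move=> [M [Mr h]].
exists (Num.max 1 (M + 1)); first by rewrite lt_max ltr01.
by move=> x; apply: h; rewrite lt_max orbC ltrDl ltr01.
Qed.

Lemma bound_bounded_linear E F (T : E -> F) (C : R) : linear T ->
  (forall x, `|T x| <= C * `|x|) -> bounded_linear T.
Proof.
move=> TL TC; split=> //.
pose m := GRing.isLinear.Build R E F *:%R T TL.
pose T' : {linear E -> F} := HB.pack T m.
apply: (@linear_bounded_continuous _ _ _ T').1.
apply/linear_boundedP; exists C; split; first exact: num_real.
move=> r Cr x; apply: le_trans (TC x) _.
by rewrite ler_wpM2r// ltW.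
Qed.

Lemma bounded_linear_near0 E F (f : E -> F) (D : E -> F) x :
  bounded_linear D ->
  (forall eps : R, 0 < eps ->
     \forall h \near (0 : E), `|f (h + x) - f x - D h| <= eps * `|h|) ->
  is_diff x f D.
Proof.
move=> [DL Dc] fD.
pose m := GRing.isLinear.Build R E F *:%R D DL.
pose D' : {linear E -> F} := HB.pack D m.
have h : f \o shift x = cst (f x) + D' +o_ (0 : E) id.
  apply/eqaddoP => e e0; near=> y.
  have -> : (f \o shift x - (cst (f x) + D')) y = f (y + x) - f x - D y.
    by rewrite opprD addrA.
  by near: y; exact: fD.
have hd := diff_unique (df := D') Dc h.
by split; [apply/diff_locallyP; rewrite hd | rewrite hd].
Unshelve. all: by end_near. Qed.

Lemma diff_near0 E F (f : E -> F) x : differentiable f x ->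
  forall eps : R, 0 < eps ->
     \forall h \near (0 : E), `|f (h + x) - f x - 'd f x h| <= eps * `|h|.
Proof.
move=> /diff_locallyP[_ /eqaddoP h] e e0; have := h e e0.
apply: filterS => y /=.
by rewrite {1}/GRing.add /= {1}/GRing.opp /= opprD addrA.
Qed.

Lemma diff_bounded_linear E F (f : E -> F) x : differentiable f x ->
  bounded_linear ('d f x).
Proof.
move=> fx; split; first by move=> t a b; rewrite linearP.
exact: diff_continuous.
Qed.

Lemma is_diffE E F (f D : E -> F) x h : is_diff x f D -> 'd f x h = D h.
Proof. by case=> _ <-. Qed.

Lemma is_diff_differentiable E F (f D : E -> F) x :
  is_diff x f D -> differentiable f x.
Proof. by case. Qed.

Lemma bounded_linear_is_diff E F (T : E -> F) x : bounded_linear T ->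
  is_diff x T T.
Proof.
move=> bT; apply: bounded_linear_near0 => // e e0; apply: nearW => h.
by rewrite (linear_funD bT.1) addrK subrr normr0 mulr_ge0// ltW.
Qed.

Lemma near_eq_is_diff E F (f g D : E -> F) x : (\forall y \near x, f y = g y) ->
  is_diff x f D -> is_diff x g D.
Proof.
move=> fg [fx <-]; apply: bounded_linear_near0.
  exact: diff_bounded_linear.
move=> e e0.
have fgx : f x = g x by exact: nbhs_singleton fg.
have fg' : \forall h \near (0 : E), f (h + x) = g (h + x).
  have c : (h + x) @[h --> (0 : E)] --> x.
    rewrite -[X in _ --> X]add0r; apply: cvgD; first exact: cvg_id.
    exact: cvg_cst.
  exact: (c _ fg).
apply: filterS2 (diff_near0 fx e0) fg' => h + <-.
by rewrite -fgx.
Qed.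

Lemma bounded_bilinear_is_diff E F G (b : E -> F -> G) (p : E * F) :
  bounded_bilinear b ->
  is_diff p (fun q : E * F => b q.1 q.2) (fun q => b p.1 q.2 + b q.1 p.2).
Proof.
move=> [b1 b2 [C C0 bC]]; apply: bounded_linear_near0.
  apply: (@bound_bounded_linear _ _ _ (C * `|p.1| + C * `|p.2|)).
    by move=> t u v /=; rewrite b1 b2 scalerDr addrACA.
  move=> q; apply: le_trans (ler_normD _ _) _.
  rewrite mulrDl lerD//.
    apply: le_trans (bC _ _) _; rewrite ler_wpM2l ?mulr_ge0//.
    by rewrite prod_normE le_max lexx orbT.
  apply: le_trans (bC _ _) _; rewrite mulrAC ler_wpM2l ?mulr_ge0//.
  by rewrite prod_normE le_max lexx.
move=> e e0; near=> h.
have -> : b (h + p).1 (h + p).2 - b p.1 p.2 - (b p.1 h.2 + b h.1 p.2) = b h.1 h.2.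
  rewrite /= (linear_funD (b1 _)) !(linear_funD (b2 _)).
  by rewrite addrA addrK (addrC (b p.1 _)) opprD addrA (addrAC (b h.1 h.2)) !addrK.
apply: le_trans (bC _ _) _.
have h1 : `|h.1| <= `|h| by rewrite prod_normE le_max lexx.
have h2 : `|h.2| <= `|h| by rewrite prod_normE le_max lexx orbT.
apply: (@le_trans _ _ (C * `|h| * `|h|)).
  by rewrite ler_pM ?mulr_ge0// ler_wpM2l.
rewrite ler_wpM2r//.
apply: (@le_trans _ _ ((C + 1) * `|h|)); first by rewrite ler_wpM2r// lerDl.
rewrite -ler_pdivlMl ?ltr_wpDl//.
near: h; apply: (@nbhs0_le _ (E * F)%type); rewrite mulr_gt0// invr_gt0 ltr_wpDl//.
Unshelve. all: by end_near. Qed.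

Lemma bounded_bilinear_diff_comp E F G H (b : F -> G -> H) (f : E -> F)
    (g : E -> G) (x : E) : bounded_bilinear b ->
  differentiable f x -> differentiable g x ->
  is_diff x (fun y => b (f y) (g y))
    (fun h => b (f x) ('d g x h) + b ('d f x h) (g x)).
Proof.
move=> bb fx gx.
have fgx : is_diff x (fun y => (f y, g y)) (fun h => ('d f x h, 'd g x h)).
  have := @is_diff_pair _ _ _ _ f ('d f x) g ('d g x) x.
  by apply; apply: DiffDef.
have bd := bounded_bilinear_is_diff (f x, g x) bb.
exact: (@is_diff_comp _ _ _ _ _ _ _ _ x fgx bd).
Qed.

Lemma bounded_bilinear_scale E :
  bounded_bilinear (fun (t : R^o) (x : E) => (t : R) *: x).
Proof.
split=> [y t a b|x t a b|].
- by rewrite scalerDl scalerA.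
- by rewrite scalerDr !scalerA mulrC.
- by exists 1 => // t x; rewrite normrZ mul1r.
Qed.


Lemma Ck_sub k E F (U V : set E) (f : E -> F) :
  V `<=` U -> Ck k U f -> Ck k V f.
Proof.
elim: k E F U V f => [|k IH] E F U V f VU /=; first by move=> h x /VU /h.
move=> [df Tf]; split; first by move=> x /VU /df.
by apply: (IH _ _ _ _ _ _ Tf) => z [z1 _]; split=> //; exact: VU.
Qed.

Lemma Ck_set0 k E F (f : E -> F) : Ck k set0 f.
Proof.
elim: k E F f => [|k IH] E F f //=; split=> //.
by apply: (Ck_sub _ (IH _ _ _)) => z [].
Qed.

Lemma Ck_eq k E F (U : set E) (f g : E -> F) : open U ->
  {in U, f =1 g} -> Ck k U f -> Ck k U g.
Proof.
elim: k E F U f g => [|k IH] E F U f g oU fg /=.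
  move=> cf x Ux; rewrite /prop_for /continuous_at -fg ?inE//.
  apply: cvg_trans (cf x Ux); apply: near_eq_cvg.
  by apply: filterS (open_nbhs_nbhs (conj oU Ux)) => y Uy; rewrite fg ?inE.
have d x : U x -> differentiable f x -> is_diff x g ('d f x).
  move=> Ux df; apply: (@near_eq_is_diff _ _ f); last exact: DiffDef.
  by apply: filterS (open_nbhs_nbhs (conj oU Ux)) => y Uy; rewrite fg ?inE.
move=> [df Tf]; split; first by move=> x Ux; have [] := d x Ux (df _ Ux).
apply: IH Tf; first by apply: open_setX => //; exact: openT.
move=> z /set_mem[Uz _].
exact: esym (is_diffE _ (d z.1 Uz (df _ Uz))).
Qed.

Lemma CkW k E F (U : set E) (f : E -> F) : Ck k.+1 U f -> Ck k U f.
Proof.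
elim: k E F U f => [|k IH] E F U f.
  by move=> [df _] x Ux; exact: differentiable_continuous (df x Ux).
by move=> [df Tf]; split; [exact: df|exact: IH Tf].
Qed.

Lemma bounded_linear_snd_comp E F (T : E -> F) : bounded_linear T ->
  bounded_linear (fun z : E * E => T z.2).
Proof.
move=> [TL Tc]; split; first by move=> t x y /=; rewrite TL.
move=> z; apply: (@continuous_comp _ _ _ snd T); first exact: cvg_snd.
exact: Tc.
Qed.

Lemma bounded_linear_fst E F : bounded_linear (fst : E * F -> E).
Proof. by split=> // z; exact: cvg_fst. Qed.

Lemma bounded_linear_snd E F : bounded_linear (snd : E * F -> F).
Proof. by split=> // z; exact: cvg_snd. Qed.

Lemma Ck_linear k E F (U : set E) (T : E -> F) : bounded_linear T -> Ck k U T.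
Proof.
elim: k E F U T => [|k IH] E F U T bT /=; first by move=> x _; exact: bT.2.
have d x : is_diff x T T by exact: bounded_linear_is_diff.
split; first by move=> x _; have [] := d x.
have -> : (fun z : E * E => 'd T (z.1) z.2) = (fun z : E * E => T z.2).
  by apply/funext => z; rewrite (is_diffE _ (d z.1)).
exact/IH/bounded_linear_snd_comp.
Qed.

Lemma CkD k E F (U : set E) (f g : E -> F) : open U ->
  Ck k U f -> Ck k U g -> Ck k U (fun x => f x + g x).
Proof.
elim: k E F U f g => [|k IH] E F U f g oU /=.
  by move=> cf cg x Ux; apply: cvgD; [exact: cf|exact: cg].
move=> [df Tf] [dg Tg]; split.
  by move=> x Ux; apply: differentiableD; [exact: df|exact: dg].
have oU' : open (U `*` [set: E]) by apply: open_setX => //; exact: openT.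
apply: (Ck_eq oU' _ (IH _ _ _ _ _ oU' Tf Tg)) => z /set_mem[Uz _].
exact: esym (congr1 (@^~ z.2) (diffD (df _ Uz) (dg _ Uz))).
Qed.

Lemma Ck_pair k E F G (U : set E) (f : E -> F) (g : E -> G) : open U ->
  Ck k U f -> Ck k U g -> Ck k U (fun x => (f x, g x)).
Proof.
elim: k E F G U f g => [|k IH] E F G U f g oU /=.
  by move=> cf cg x Ux; apply: cvg_pair; [exact: cf|exact: cg].
move=> [df Tf] [dg Tg]; split.
  by move=> x Ux; apply: differentiable_pair; [exact: df|exact: dg].
have oU' : open (U `*` [set: E]) by apply: open_setX => //; exact: openT.
apply: (Ck_eq oU' _ (IH _ _ _ _ _ _ oU' Tf Tg)) => z /set_mem[Uz _].
exact: esym (congr1 (@^~ z.2) (diff_pair (df _ Uz) (dg _ Uz))).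
Qed.

Lemma Ck_comp k E F G (U : set E) (V : set F) (f : E -> F) (g : F -> G) :
  open U -> open V -> (forall x, U x -> V (f x)) ->
  Ck k U f -> Ck k V g -> Ck k U (fun x => g (f x)).
Proof.
elim: k E F G U V f g => [|k IH] E F G U V f g oU oV UV.
  move=> cf cg x Ux; apply: (@continuous_comp _ _ _ f g); first exact: cf.
  by apply: cg; exact: UV.
move=> fk gk; have [df Tf] := fk; have [dg Tg] := gk; split.
  move=> x Ux; apply: (@differentiable_comp _ _ _ _ f g); first exact: df.
  by apply: dg; exact: UV.
have oU' : open (U `*` [set: E]) by apply: open_setX => //; exact: openT.
have oV' : open (V `*` [set: F]) by apply: open_setX => //; exact: openT.
have f1 : Ck k (U `*` [set: E]) (fun z => f z.1).
  apply: (IH _ _ _ _ U fst f oU' oU) => //; first by move=> z [].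
  - exact/Ck_linear/bounded_linear_fst.
  - exact: CkW.
have TT := Ck_pair oU' f1 Tf.
have UV' z : (U `*` [set: E]) z -> (V `*` [set: F]) (f z.1, 'd f (z.1) z.2).
  by move=> [/= Uz _]; split=> //=; exact: UV.
apply: (Ck_eq oU' _ (IH _ _ _ _ _ _ _ oU' oV' UV' TT Tg)) => z /set_mem[Uz _].
exact: esym (congr1 (@^~ z.2) (@diff_comp _ _ _ _ f g _ (df _ Uz) (dg _ (UV _ Uz)))).
Qed.

Lemma Ck_bilinear k E F G H (b : F -> G -> H) (U : set E) (f : E -> F)
    (g : E -> G) : bounded_bilinear b -> open U ->
  Ck k U f -> Ck k U g -> Ck k U (fun x => b (f x) (g x)).
Proof.
move=> bb; elim: k E U f g => [|k IH] E U f g oU.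
  move=> cf cg x Ux; have := bounded_bilinear_is_diff (f x, g x) bb.
  move=> /is_diff_differentiable/differentiable_continuous bc.
  apply: (@continuous_comp _ _ _ (fun y => (f y, g y)) (fun p => b p.1 p.2)).
    by apply: cvg_pair; [exact: cf|exact: cg].
  exact: bc.
move=> fk gk; have [df Tf] := fk; have [dg Tg] := gk.
have d x : U x -> is_diff x (fun y => b (f y) (g y))
    (fun h => b (f x) ('d g x h) + b ('d f x h) (g x)).
  by move=> Ux; apply: bounded_bilinear_diff_comp => //; [exact: df|exact: dg].
split; first by move=> x Ux; have [] := d x Ux.
have oU' : open (U `*` [set: E]) by apply: open_setX => //; exact: openT.
have f1 : Ck k (U `*` [set: E]) (fun z => f z.1).
  apply: (Ck_comp oU' oU) (CkW fk); first by move=> z [].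
  exact/Ck_linear/bounded_linear_fst.
have g1 : Ck k (U `*` [set: E]) (fun z => g z.1).
  apply: (Ck_comp oU' oU) (CkW gk); first by move=> z [].
  exact/Ck_linear/bounded_linear_fst.
apply: (Ck_eq oU' _ (CkD oU' (IH _ _ _ _ oU' f1 Tg) (IH _ _ _ _ oU' Tf g1))).
by move=> z /set_mem[Uz _] /=; rewrite (is_diffE _ (d _ Uz)).
Qed.

End Differentials.

Section OperatorNorm.
Context {R : realType}.
Implicit Types (T : topologicalType) (E F G H : normedModType R).

Lemma opnorm_continuous_onD T E F (W : set T) (D D' : T -> E -> F) :
  opnorm_continuous_on W D -> opnorm_continuous_on W D' ->
  opnorm_continuous_on W (fun z h => D z h + D' z h).
Proof.
move=> cD cD' z Wz e e0; have e2 : 0 < e / 2 by rewrite divr_gt0.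
apply: filterS2 (cD z Wz _ e2) (cD' z Wz _ e2) => z' h1 h2 h.
rewrite opprD addrACA (le_trans (ler_normD _ _))// (splitr e) mulrDl.
by rewrite lerD.
Qed.

Lemma opnorm_continuous_on_eq T E F (W : set T) (D D' : T -> E -> F) :
  (forall z h, W z -> D z h = D' z h) ->
  opnorm_continuous_on W D -> opnorm_continuous_on W D'.
Proof.
move=> DD cD z Wz e e0; have := cD z Wz e e0.
apply: filterS2 (withinT W (nbhs_filter z)) => z' Wz' h1 h.
by rewrite -!DD.
Qed.

Lemma opnorm_continuous_on_comp T T' E E' F (W : set T) (W' : set T')
    (D : T -> E -> F) (p : T' -> T) (q : E' -> E) :
  bounded_linear q -> (forall z, W' z -> W (p z)) ->
  {within W', continuous p} ->
  opnorm_continuous_on W D -> opnorm_continuous_on W' (fun z h => D (p z) (q h)).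
Proof.
move=> bq W'W cp cD z W'z e e0.
have [C C0 qC] := bounded_linear_bound bq.
have eC : 0 < e / C by rewrite divr_gt0.
have Wpz := W'W z W'z.
have := cD _ Wpz _ eC; rewrite near_withinE => /= nW.
have /(_ _ nW) cn := (subspace_continuousP _ _).1 cp z W'z.
apply: filterS2 (withinT W' (nbhs_filter z)) cn => z' W'z' h1 h.
have := h1 (W'W _ W'z') (q h) => /le_trans; apply.
by rewrite -mulrA ler_wpM2l ?(ltW e0)// ler_pdivrMl.
Qed.

Lemma opnorm_continuous_on_bilinear T E F G H (W : set T) (b : F -> G -> H)
    (phi : T -> F) (D : T -> E -> G) : bounded_bilinear b ->
  {within W, continuous phi} ->
  (forall z, W z -> bounded_linear (D z)) -> opnorm_continuous_on W D ->
  opnorm_continuous_on W (fun z h => b (phi z) (D z h)).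
Proof.
move=> [b1 b2 [C C0 bC]] cphi bD cD z Wz e e0.
have [K K0 DK] := bounded_linear_bound (bD z Wz).
pose M := C * (`|phi z| + 1) + 1.
have M0 : 0 < M by rewrite ltr_wpDl// mulr_ge0// addr_ge0.
pose e1 := e / 2 / (C * K + 1).
have CK0 : 0 < C * K + 1 by rewrite ltr_wpDl// mulr_ge0// ltW.
have e10 : 0 < e1 by rewrite !divr_gt0.
have e20 : 0 < e / 2 / M by rewrite !divr_gt0.
have cz := (subspace_continuousP _ _).1 cphi z Wz.
have n1 : \forall z' \near within W (nbhs z), `|phi z' - phi z| < Num.min e1 1.
  have m0 : 0 < Num.min e1 1 by rewrite lt_min e10 ltr01.
  have /cvgrPdist_lt /(_ _ m0) := cz.
  by apply: filterS => z'; rewrite distrC.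
apply: filterS2 n1 (cD z Wz _ e20) => z' h1 h2 h.
move: h1; rewrite lt_min => /andP[h1 h1'].
have -> : b (phi z') (D z' h) - b (phi z) (D z h) =
    b (phi z') (D z' h - D z h) + b (phi z' - phi z) (D z h).
  by rewrite (linear_funB (b2 _)) (linear_funB (b1 _)) addrA subrK.
rewrite (le_trans (ler_normD _ _))// (splitr e) mulrDl lerD//.
  apply: le_trans (bC _ _) _.
  have h3 : C * `|phi z'| <= M.
    rewrite /M ler_wpDr// ler_wpM2l//.
    rewrite -(subrK (phi z) (phi z')) (le_trans (ler_normD _ _))//.
    by rewrite addrC lerD2l ltW.
  apply: (@le_trans _ _ (M * (e / 2 / M * `|h|))).
    by rewrite ler_pM ?mulr_ge0.
  by rewrite mulrA (mulrC M) divfK ?gt_eqF.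
apply: le_trans (bC _ _) _.
apply: (@le_trans _ _ (C * e1 * (K * `|h|))).
  by rewrite ler_pM ?mulr_ge0// ler_wpM2l// ltW.
rewrite (_ : _ * (K * _) = C * K * e1 * `|h|); last by ring.
rewrite ler_wpM2r//; have <- : e1 * (C * K + 1) = e / 2 by rewrite divfK ?gt_eqF.
by rewrite mulrC ler_wpM2l ?lerDl// ltW.
Qed.

End OperatorNorm.

(** * Fredholm and compact operators *)

Section Span.
Context {R : realType}.
Implicit Types E F : normedModType R.

Lemma in_span_nil E (x : E) : in_span [::] x <-> x = 0.
Proof.
split=> [[c ->]|->]; first by rewrite big_ord0.
by exists (fun=> 0); rewrite big_ord0.
Qed.

Lemma in_span_cons E (a : E) (s : seq E) x :
  in_span (a :: s) x <-> exists t y, in_span s y /\ x = t *: a + y.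
Proof.
split=> [[c ->]|[t [y [[c ->] ->]]]].
  rewrite big_ord_recl /=; exists (c ord0), (\sum_(i < size s) c (lift ord0 i) *: s`_i).
  by split=> //; exists (fun i => c (lift ord0 i)).
exists (fun i => if unlift ord0 i is Some j then c j else t).
rewrite big_ord_recl /= unlift_none; congr (_ + _).
by apply: eq_bigr => i _; rewrite liftK.
Qed.

Lemma in_span_linear E (s : seq E) t x y :
  in_span s x -> in_span s y -> in_span s (t *: x + y).
Proof.
move=> [c ->] [d ->]; exists (fun i => t * c i + d i).
rewrite scaler_sumr -big_split /=; apply: eq_bigr => i _.
by rewrite scalerDl scalerA.
Qed.

Lemma in_span0 E (s : seq E) : in_span s 0.
Proof.
by exists (fun=> 0); rewrite big1// => i _; rewrite scale0r.
Qed.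

Lemma in_spanD E (s : seq E) x y : in_span s x -> in_span s y -> in_span s (x + y).
Proof. by move=> sx sy; rewrite -[x]scale1r; exact: in_span_linear. Qed.

Lemma in_span_behead E (a : E) (s : seq E) x : in_span s x -> in_span (a :: s) x.
Proof. by move=> sx; apply/in_span_cons; exists 0, x; rewrite scale0r add0r. Qed.

Lemma in_span_mem E (s : seq E) x : x \in s -> in_span s x.
Proof.
elim: s => // a s IH; rewrite inE => /predU1P[->|/IH]; last exact: in_span_behead.
by apply/in_span_cons; exists 1, 0; split; [exact: in_span0|rewrite scale1r addr0].
Qed.

Lemma in_span_map E F (T : E -> F) (s : seq E) x : linear T ->
  in_span s x -> in_span (map T s) (T x).
Proof.
move=> TL; elim: s x => [x /in_span_nil->|a s IH x /in_span_cons[t [y [sy ->]]]].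
  by apply/in_span_nil; rewrite linear_fun0.
by rewrite TL; apply/in_span_cons; exists t, (T y); split=> //; exact: IH.
Qed.

(* Dimension count: a subspace is finite dimensional when its image under L and
   its intersection with the kernel of L are. *)
Lemma in_span_extend E F (N : set E) (L : E -> F) (s : seq E) (b : seq F) :
  linear L -> (forall t x y, N x -> N y -> N (t *: x + y)) ->
  (forall x, N x -> L x = 0 -> in_span s x) ->
  (forall x, N x -> in_span b (L x)) ->
  exists s' : seq E, forall x, N x -> in_span s' x.
Proof.
move=> LL NL Ns Nb.
have : forall b', exists s', forall x, N x -> in_span b' (L x) -> in_span s' x.
  elim=> [|a b' [s' IH]]; first by exists s => x Nx /in_span_nil; exact: Ns.
  have [h|h] := pselect (forall x, N x -> in_span (a :: b') (L x) -> in_span b' (L x)).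
    by exists s' => x Nx Lx; apply: IH => //; exact: h.
  have /existsNP[x0 /not_implyP[Nx0 /not_implyP[]]] := h.
  move=> /in_span_cons[t [y0 [sy0 e0]]] nLx0.
  have t0 : t != 0.
    by apply/eqP => t0; apply: nLx0; rewrite e0 t0 scale0r add0r.
  exists (x0 :: s') => x Nx /in_span_cons[u [y [sy e]]].
  apply/in_span_cons; exists (u / t), (- (u / t) *: x0 + x).
  split; last by rewrite scaleNr addNKr.
  apply: IH; first exact: NL.
  rewrite LL e0 e scalerDr scalerA mulNr divfK// scaleNr addrACA addNr add0r.
  by apply: in_span_linear.
move=> /(_ b)[s' h]; exists s' => x Nx; apply: h => //; exact: Nb.
Qed.

End Span.

Section Fredholm.
Context {R : realType}.
Implicit Types E F G : normedModType R.

Lemma bounded_linear_comp E F G (T : E -> F) (S : F -> G) :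
  bounded_linear T -> bounded_linear S -> bounded_linear (fun x => S (T x)).
Proof.
move=> [TL Tc] [SL Sc]; split; first by move=> t x y; rewrite TL SL.
by move=> x; apply: (@continuous_comp _ _ _ T S); [exact: Tc|exact: Sc].
Qed.

Lemma bounded_linearD E F (T S : E -> F) :
  bounded_linear T -> bounded_linear S -> bounded_linear (fun x => T x + S x).
Proof.
move=> [TL Tc] [SL Sc]; split.
  by move=> t x y; rewrite TL SL scalerDr addrACA.
by move=> x; apply: cvgD; [exact: Tc|exact: Sc].
Qed.

Lemma bounded_linear_rank1 E F (l : E -> R^o) (w : F) :
  bounded_linear l -> bounded_linear (fun x => (l x : R) *: w).
Proof.
move=> bl; have [C C0 lC] := bounded_linear_bound bl.
apply: (@bound_bounded_linear _ _ _ _ (C * `|w|)).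
  by move=> t x y; rewrite bl.1 scalerDl scalerA.
by move=> x; rewrite normrZ mulrAC ler_wpM2r//; exact: lC.
Qed.

Lemma fredholm_rank1 E F (V : set F) (T : E -> F) (l : E -> R^o) (w : F) :
  (forall t x y, V x -> V y -> V (t *: x + y)) ->
  fredholm V T -> bounded_linear l -> V w ->
  fredholm V (fun x => T x + (l x : R) *: w).
Proof.
move=> VL [TL Tc TV [s Ts] [r rV Tr]] bl Vw.
have [DL Dc] : bounded_linear (fun x => T x + (l x : R) *: w).
  by apply: bounded_linearD => //; exact: bounded_linear_rank1.
split=> //.
- by move=> x; rewrite addrC; apply: VL.
- apply: (@in_span_extend _ _ (R^o : normedModType R)
    [set x | T x + (l x : R) *: w = 0] l s [:: (1 : R^o)]) => //.
  + exact: bl.1.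
  + move=> t x y /= hx hy; rewrite DL hx hy scaler0 addr0//.
  + by move=> x /= + lx; rewrite lx scale0r addr0; exact: Ts.
  + move=> x _; apply/in_span_cons; exists (l x), 0.
    by split; [exact: in_span0|rewrite addr0 /GRing.scale /= mulr1].
- exists (w :: r) => [y|y Vy].
    by rewrite inE => /predU1P[->//|/rV].
  have [x [z [rz ->]]] := Tr y Vy.
  exists x, (- (l x : R) *: w + z); split.
    by apply/in_span_cons; exists (- (l x : R)), z.
  by rewrite addrA scaleNr addrK.
Qed.

Lemma fredholm_add_finite E E' F (V : set F) (T : E -> F) (S : E' -> F)
    (b : seq E') :
  (forall t x y, V x -> V y -> V (t *: x + y)) ->
  (forall y : E', in_span b y) -> fredholm V T -> bounded_linear S ->
  (forall y, V (S y)) ->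
  fredholm V (fun z : E * E' => T z.1 + S z.2).
Proof.
move=> VL bb [TL Tc TV [s Ts] [r rV Tr]] bS SV.
have [DL Dc] : bounded_linear (fun z : E * E' => T z.1 + S z.2).
  apply: bounded_linearD.
    by apply: bounded_linear_comp (conj TL Tc); exact: bounded_linear_fst.
  by apply: bounded_linear_comp bS; exact: bounded_linear_snd.
split=> //.
- by move=> z; rewrite -[T _]scale1r; apply: VL.
- apply: (@in_span_extend _ (E * E')%type E' [set z | T z.1 + S z.2 = 0] snd
    [seq (x, 0) | x <- s] b) => //.
  + by move=> t x y /= hx hy; rewrite (DL t x y) hx hy scaler0 addr0.
  + move=> [x y] /= + y0; rewrite y0 (linear_fun0 bS.1) addr0 => /Ts.
    by move=> /(in_span_map (F := (E * E')%type) (T := fun x => (x, 0))); apply => t u v;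
      congr pair => /=; rewrite scaler0 addr0.
- exists r => // y Vy; have [x [z [rz ->]]] := Tr y Vy.
  by exists (x, 0), z; split=> //=; rewrite (linear_fun0 bS.1) addr0.
Qed.

End Fredholm.

Section CompactOperators.
Context {R : realType}.
Implicit Types E F G : normedModType R.

Lemma bounded_setP E (A : set E) :
  bounded_set A <-> exists M : R, forall x, A x -> `|x| <= M.
Proof.
split=> [[M [_ h]]|[M h]].
  by exists (M + 1) => x Ax; apply: (h (M + 1)) => //; rewrite ltrDl.
exists M; split; first exact: num_real.
by move=> N /ltW MN x Ax; apply: le_trans MN; exact: h.
Qed.

Lemma precompact_norm E (A C : set E) : compact C -> A `<=` C -> precompact A.
Proof.
move=> cC AC; exists C => //; split=> //.
by apply: compact_closed => //; exact: norm_hausdorff.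
Qed.

Lemma compact_opD E F (T S : E -> F) : compact_op T -> compact_op S ->
  compact_op (fun x => T x + S x).
Proof.
move=> [TL Tc] [SL Sc]; split.
  by move=> t x y; rewrite TL SL scalerDr addrACA.
move=> A bA; have [U TU [cU _]] := Tc A bA; have [V SV [cV _]] := Sc A bA.
apply: (@precompact_norm _ _ ((fun p : F * F => p.1 + p.2) @` (U `*` V))).
  apply: continuous_compact; last exact: compact_setX.
  by apply: continuous_subspaceT => p; exact: add_continuous.
move=> _ [x Ax <-]; exists (T x, S x) => //.
by split; [apply: TU; exists x|apply: SV; exists x].
Qed.

Lemma compact_op_postcomp E F G (T : E -> F) (S : F -> G) :
  compact_op T -> bounded_linear S -> compact_op (fun x => S (T x)).
Proof.
move=> [TL Tc] [SL Sc]; split; first by move=> t x y; rewrite TL SL.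
move=> A bA; have [U TU [cU _]] := Tc A bA.
apply: (@precompact_norm _ _ (S @` U)).
  by apply: continuous_compact => //; exact: continuous_subspaceT.
by move=> _ [x Ax <-]; exists (T x) => //; apply: TU; exists x.
Qed.

Lemma compact_op_precomp E F G (T : E -> F) (S : F -> G) :
  bounded_linear T -> compact_op S -> compact_op (fun x => S (T x)).
Proof.
move=> bT [SL Sc]; split; first by move=> t x y; rewrite bT.1 SL.
have [C C0 TC] := bounded_linear_bound bT.
move=> A /bounded_setP[M AM]; apply: (precompact_subset _ (Sc (T @` A) _)).
  by move=> _ [x Ax <-]; exists (T x) => //; exists x.
apply/bounded_setP; exists (C * M) => _ [x Ax <-].
by apply: le_trans (TC x) _; rewrite ler_wpM2l ?(ltW C0)// AM.
Qed.

Lemma compact_op_rank1 E F (l : E -> R^o) (w : F) :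
  bounded_linear l -> compact_op (fun x => (l x : R) *: w).
Proof.
move=> bl; split; first exact: (bounded_linear_rank1 w bl).1.
have [C C0 lC] := bounded_linear_bound bl.
move=> A /bounded_setP[M AM].
apply: (@precompact_norm _ _ ((fun t : R => t *: w) @` `[- (C * M), C * M])).
  apply: continuous_compact; last exact: segment_compact.
  by apply: continuous_subspaceT => t; exact: scalel_continuous.
move=> _ [x Ax <-]; exists (l x) => //=.
rewrite in_itv /= -ler_norml; apply: le_trans (lC x) _.
by rewrite ler_wpM2l ?(ltW C0)// AM.
Qed.

End CompactOperators.

Section Riesz.
Context {R : realType} (E : normedModType R) (ip : E -> E -> R).
Hypothesis ipC : forall x y, ip x y = ip y x.
Hypothesis ipL : forall t x y z, ip (t *: x + y) z = t * ip x z + ip y z.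
Hypothesis ip_gt0 : forall x, x != 0 -> 0 < ip x x.

Let ip0 z : ip 0 z = 0.
Proof. by have := ipL (-1) 0 0 z; rewrite scaler0 addr0 mulN1r addNr. Qed.

Let ipB x y z : ip (x - y) z = ip x z - ip y z.
Proof. by rewrite addrC -scaleN1r ipL mulN1r addrC. Qed.

Let ip_span0 (s : seq E) y x : (forall z, z \in s -> ip z y = 0) ->
  in_span s x -> ip x y = 0.
Proof.
elim: s x => [x _ /in_span_nil->//|a s IH x sy /in_span_cons[t [z [sz ->]]]].
rewrite ipL sy ?mem_head// mulr0 add0r IH// => v vs.
by apply: sy; rewrite inE vs orbT.
Qed.

Lemma orthogonal_projection (s : seq E) x :
  exists2 p, in_span s p & forall z, z \in s -> ip z (x - p) = 0.
Proof.
elim: s x => [|a s IH] x; first by exists 0 => //; exact/in_span_nil.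
have [q sq qs] := IH a; have [p sp ps] := IH x.
have [aq|aq] := eqVneq (a - q) 0.
  exists p; first exact: in_span_behead.
  move=> z; rewrite inE => /predU1P[->|/ps//].
  by rewrite (subr0_eq aq); exact: ip_span0 ps sq.
have a0 := ip_gt0 aq; set a' := a - q in aq a0 qs *.
pose k := ip x a' / ip a' a'.
have h y : in_span s y -> ip y (x - (k *: a' + p)) = 0.
  move=> sy; rewrite ipC opprD addrCA -scaleNr ipL !(ipC _ y).
  by rewrite (ip_span0 ps sy) (ip_span0 qs sy) mulr0 addr0.
have spa : in_span (a :: s) (k *: a' + p).
  apply/in_span_cons; exists k, (- k *: q + p); split.
    exact: in_span_linear.
  by rewrite /a' scalerBr scaleNr addrA.
exists (k *: a' + p) => // z; rewrite inE => /predU1P[->|zs]; last first.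
  by apply: h; exact: in_span_mem.
have -> : a = 1 *: a' + q by rewrite scale1r subrK.
rewrite ipL (h _ sq) addr0 mul1r ipC opprD addrCA -scaleNr ipL (ipB x p).
rewrite (ip_span0 qs sp) subr0 /k mulNr divfK ?gt_eqF// addNr//.
Qed.

End Riesz.

Lemma locally_compact_finite_dim (R : realType) (E : normedModType R)
    (C : set E) (x0 : E) : hilbertable E -> compact C -> nbhs x0 C ->
  exists s : seq E, forall x, in_span s x.
Proof.
move=> [[ip [c [d [ipC ipL c0 ipn]]]] _ _] cC /nbhs_ballP[r /= r0 rC].
have ip_gt0 x : x != 0 -> 0 < ip x x.
  move=> x0'; have /andP[+ _] := ipn x; apply: lt_le_trans.
  by rewrite mulr_gt0// exprn_gt0// normr_gt0.
pose k := c / (`|d| + c).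
have dc : 0 < `|d| + c by rewrite ltr_wpDl.
have k0 : 0 < k by rewrite divr_gt0.
have k1 : k <= 1 by rewrite ler_pdivrMr// mul1r lerDr.
pose e := r / 2 * k; have e0 : 0 < e by rewrite mulr_gt0// divr_gt0.
have de : `|d| * e ^+ 2 < c * (r / 2) ^+ 2.
  rewrite exprMn mulrCA mulrC ltr_pM2r ?exprn_gt0 ?divr_gt0//.
  apply: (@le_lt_trans _ _ (`|d| * k)).
    by rewrite ler_wpM2l// expr2 ler_piMl// ltW.
  by rewrite /k mulrA ltr_pdivrMr// mulrC ltr_pM2l// ltrDl.
have oB (x : E) : C x -> open (ball x e) by move=> _; exact: ball_open.
have Ccov : C `<=` cover C (fun x => ball x e).
  by move=> x Cx; exists x => //; exact: ballxx.
move: cC; rewrite compact_cover => /(_ _ _ _ oB Ccov)[D DC CD].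
pose s := [seq x - x0 | x <- finmap.enum_fset D].
exists s => x; apply: contrapT => nsx.
have [p sp ps] := orthogonal_projection ipC ipL ip_gt0 s x.
have xp0 : x - p != 0 by apply: contra_notN nsx => /eqP /subr0_eq ->.
pose u := (r / 2 / `|x - p|) *: (x - p).
have un : `|u| = r / 2.
  rewrite normrZ ger0_norm ?divr_ge0//; last by rewrite ltW.
  by rewrite divfK// normr_eq0.
have Cu : C (x0 + u).
  apply: rC; rewrite -ball_normE /= opprD addNKr normrN un.
  by rewrite ltr_pdivrMr// mulr_natr mulr2n ltrDl.
have [y /= yD] := CD _ Cu.
rewrite -ball_normE /= => yu.
have ipuy : ip (y - x0) u = 0.
  rewrite ipC -[u]addr0 ipL ipC (ps (y - x0)).
    by rewrite mulr0 add0r; have := ipL (-1) 0 0 (y - x0); rewrite scaler0 addr0 mulN1r addNr.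
  by apply: map_f.
have : ip u u <= ip (y - x0 - u) (y - x0 - u).
  set w := y - x0 in ipuy *.
  have -> : ip (w - u) (w - u) = ip w w + ip u u.
    have ipR t z v v' : ip z (t *: v + v') = t * ip z v + ip z v'.
      by rewrite ipC ipL !(ipC z).
    rewrite -scaleN1r (addrC w) ipL !ipR (ipC u w) ipuy.
    ring.
  rewrite lerDr; have [->|w0] := eqVneq w 0; last exact/ltW/ip_gt0.
  by have := ipL (-1) 0 0 0; rewrite scaler0 addr0 mulN1r addNr => ->.
have /andP[cu _] := ipn u; have /andP[_ dw] := ipn (y - x0 - u).
move=> /(le_trans cu)/le_trans/(_ dw); rewrite un leNgt => /negP; apply.
apply: le_lt_trans de.
apply: (@le_trans _ _ (`|d| * `|y - x0 - u| ^+ 2)).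
  by rewrite ler_wpM2r ?sqr_ge0// ler_norm.
rewrite ler_wpM2l// ler_pXn2r ?nnegrE ?(ltW e0)//.
by rewrite -addrA -opprD ltW.
Qed.

(** * Sobolev spaces of loops *)

Section SobolevInnerProduct.
Context {R : realType} {p n : nat}.
Implicit Types (x y z : Sob R p n) (c d : int -> Cn R n).

Lemma sob_partS c d N : sob_part p c d N.+1 = sob_part p c d N +
  (sobw R p N.+1%:Z * cdot (c N.+1%:Z) (d N.+1%:Z) +
   sobw R p (Negz N) * cdot (c (Negz N)) (d (Negz N))).
Proof.
by rewrite /sob_part /symsum big_ord_recr [X in _ + X = _]big_ord_recr /= addrACA.
Qed.

Lemma sob_partDr c d d' N :
  sob_part p c (d + d') N = sob_part p c d N + sob_part p c d' N.
Proof. by rewrite sob_partC sob_partD !(sob_partC c). Qed.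

Lemma Sob_norm_cvg x : sob_part p x x @ \oo --> `|x| ^+ 2.
Proof. by rewrite Sob_normE; exact/sob_part_is_cvg/fcoef_in. Qed.

Lemma sob_part_le_norm x N : sob_part p x x N <= `|x| ^+ 2.
Proof. exact/sob_part_le/fcoef_in. Qed.

Lemma Sob_norm_le x M : 0 <= M -> (forall N, sob_part p x x N <= M ^+ 2) ->
  `|x| <= M.
Proof. by move=> M0 xM; apply: sob_norm_le => //; exact: fcoef_in. Qed.

Definition sip x y : R := 2^-1 * (`|x + y| ^+ 2 - `|x| ^+ 2 - `|y| ^+ 2).

Lemma sip_cvg x y : sob_part p x y @ \oo --> sip x y.
Proof.
have -> : sob_part p x y = (fun N => 2^-1 * (sob_part p (x + y) (x + y) N -
    sob_part p x x N - sob_part p y y N)).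
  apply/funext => N.
  rewrite [fcoef (x + y)](_ : _ = fcoef x + fcoef y)// sob_partD !sob_partDr.
  by rewrite (sob_partC (fcoef y) (fcoef x)); field.
apply: cvgM; first exact: cvg_cst.
by apply: cvgB; [apply: cvgB|]; exact: Sob_norm_cvg.
Qed.

Lemma sip_uniq x y (l : R) : sob_part p x y @ \oo --> l -> sip x y = l.
Proof. move=> h; exact: (cvg_unique (@Rhausdorff R) (@sip_cvg x y) h). Qed.

Lemma sipC x y : sip x y = sip y x.
Proof. by rewrite /sip (addrC x) addrAC. Qed.

Lemma sipL t x y z : sip (t *: x + y) z = t * sip x z + sip y z.
Proof.
apply: sip_uniq.
have -> : sob_part p (t *: x + y) z =
    (fun N => t * sob_part p x z N + sob_part p y z N).
  by apply/funext => N; rewrite -sob_partZ -sob_partD.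
apply: cvgD; last exact: sip_cvg.
by apply: cvgM; [exact: cvg_cst|exact: sip_cvg].
Qed.

Lemma sip_norm x : sip x x = `|x| ^+ 2.
Proof. by apply: sip_uniq; exact: Sob_norm_cvg. Qed.

Lemma sipD x y z : sip (x + y) z = sip x z + sip y z.
Proof. by rewrite -[x in x + _]scale1r sipL mul1r. Qed.

Lemma sip0l z : sip 0 z = 0.
Proof. by have := sipL (-1) 0 0 z; rewrite scaler0 addr0 mulN1r addNr. Qed.

Lemma sipZ t x z : sip (t *: x) z = t * sip x z.
Proof. by rewrite -[t *: x]addr0 sipL sip0l addr0. Qed.

Lemma sip_bound x y : `|sip x y| <= `|x| * `|y|.
Proof.
rewrite -(@ler_pXn2r _ 2)// ?nnegrE ?mulr_ge0// real_normK ?num_real//.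
rewrite [leRHS]exprMn -!sip_norm; apply: (@sip_CS _ _ sip) => //.
- exact: sipD.
- by move=> *; exact: sipZ.
- exact: sipC.
- by move=> z; rewrite sip_norm sqr_ge0.
Qed.

Lemma bounded_bilinear_sip : bounded_bilinear (fun x y => sip x y : R^o).
Proof.
split=> [z t x y|z t x y|].
- by rewrite sipL.
- by rewrite !(sipC z) sipL.
- by exists 1 => // x y; rewrite mul1r; exact: sip_bound.
Qed.

Lemma Ck_sqr_norm k (E : normedModType R) (U : set E) (f : E -> Sob R p n) :
  open U -> Ck k U f -> Ck k U (fun e => `|f e| ^+ 2 : R^o).
Proof.
move=> oU fk.
have -> : (fun e => `|f e| ^+ 2 : R^o) = (fun e => sip (f e) (f e) : R^o).
  by apply/funext => e; rewrite sip_norm.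
exact: (Ck_bilinear (b := fun x y => sip x y : R^o) bounded_bilinear_sip).
Qed.

Lemma sob_term_ge0 c m : 0 <= sobw R p m * cdot (c m) (c m).
Proof. by rewrite mulr_ge0 ?sobw_ge0 ?csq_ge0. Qed.

Lemma sob_part_term c m : sobw R p m * cdot (c m) (c m) <= sob_part p c c `|m|%N.
Proof.
have h N : sob_part p c c N + (sobw R p N.+1 * cdot (c N.+1) (c N.+1)
    + sobw R p (Negz N) * cdot (c (Negz N)) (c (Negz N))) <= sob_part p c c N.+1.
  by rewrite sob_partS.
case: m => [[|N]|N].
- by rewrite absz_nat /sob_part /symsum big_ord1 big_ord0 addr0.
- rewrite absz_nat; apply: le_trans (h N).
  by rewrite addrCA lerDl addr_ge0 ?sob_part_ge0 ?sob_term_ge0.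
- rewrite NegzE abszN absz_nat -NegzE; apply: le_trans (h N).
  by rewrite addrA lerDr addr_ge0 ?sob_part_ge0 ?sob_term_ge0.
Qed.

Lemma sobw_ge1 m : 1 <= sobw R p m.
Proof.
rewrite /sobw; case: eqP => // /eqP m0.
by rewrite ler1n expn_gt0 absz_gt0 m0.
Qed.

Lemma Sob_coef_le x m : cdot (x m) (x m) <= `|x| ^+ 2.
Proof.
apply: le_trans (sob_part_le_norm x `|m|%N).
apply: le_trans (sob_part_term x m).
by rewrite ler_peMl ?csq_ge0// sobw_ge1.
Qed.

Lemma cdot_coord_le (z : Cn R n) (k : 'I_n) :
  (z.1 ord0 k ^+ 2 <= cdot z z) * (z.2 ord0 k ^+ 2 <= cdot z z).
Proof.
have h : z.1 ord0 k * z.1 ord0 k + z.2 ord0 k * z.2 ord0 k <= cdot z z.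
  rewrite /cdot (bigD1 k) //= lerDl sumr_ge0// => i _.
  by rewrite addr_ge0// -expr2 sqr_ge0.
rewrite -!expr2 in h; split; apply: le_trans h.
  by rewrite lerDl sqr_ge0.
by rewrite lerDr sqr_ge0.
Qed.

Lemma Sob_coord_le x m k : `|(x m).1 ord0 k| <= `|x| /\ `|(x m).2 ord0 k| <= `|x|.
Proof.
have [h1 h2] := cdot_coord_le (x m) k; have h := Sob_coef_le x m.
by split; rewrite -(@ler_pXn2r _ 2)// ?nnegrE// real_normK ?num_real//;
  apply: le_trans h.
Qed.

Lemma bounded_linear_coord1 m k :
  bounded_linear (fun x : Sob R p n => (x m).1 ord0 k : R^o).
Proof.
apply: (@bound_bounded_linear _ _ _ _ 1).
  by move=> t x y /=; rewrite !mxE.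
by move=> x; rewrite mul1r; have [] := Sob_coord_le x m k.
Qed.

Lemma bounded_linear_coord2 m k :
  bounded_linear (fun x : Sob R p n => (x m).2 ord0 k : R^o).
Proof.
apply: (@bound_bounded_linear _ _ _ _ 1).
  by move=> t x y /=; rewrite !mxE.
by move=> x; rewrite mul1r; have [] := Sob_coord_le x m k.
Qed.

Lemma sob_part_cvg (T : Type) (F : set_system T) (f : T -> int -> Cn R n)
    (c : int -> Cn R n) N : Filter F ->
  (forall m, cdot (f a m) (f a m) @[a --> F] --> cdot (c m) (c m)) ->
  sob_part p (f a) (f a) N @[a --> F] --> sob_part p c c N.
Proof.
move=> FF h; have hw m : sobw R p m * cdot (f a m) (f a m) @[a --> F] -->
    sobw R p m * cdot (c m) (c m) by apply: cvgM => //; exact: cvg_cst.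
elim: N => [|N IH].
  rewrite /sob_part /symsum big_ord1 big_ord0 addr0.
  under eq_fun do rewrite big_ord1 big_ord0 addr0.
  exact: hw.
rewrite sob_partS; under eq_fun do rewrite sob_partS.
by apply: cvgD => //; exact: cvgD.
Qed.

Lemma cdot0l (z : Cn R n) : cdot 0 z = 0.
Proof. by rewrite -(scale0r (0 : Cn R n)) cdotZ mul0r. Qed.

Lemma sob_part0 N : sob_part p (0 : int -> Cn R n) 0 N = 0.
Proof. by rewrite -(scale0r (0 : int -> Cn R n)) sob_partZ mul0r. Qed.

End SobolevInnerProduct.

Section Multipliers.
Context {R : realType} {p n : nat}.

Lemma mul_in_sob (mu : int -> R) (c : int -> Cn R n) :
  (forall m, `|mu m| <= 1) -> c \in in_sob R p n ->
  (fun m => mu m *: c m) \in in_sob R p n /\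
  forall N, sob_part p (fun m => mu m *: c m) (fun m => mu m *: c m) N <=
            sob_part p c c N.
Proof.
move=> mu1 cS.
have h N : sob_part p (fun m => mu m *: c m) (fun m => mu m *: c m) N <=
            sob_part p c c N.
  have h m : sobw R p m * cdot (mu m *: c m) (mu m *: c m) <=
             sobw R p m * cdot (c m) (c m).
    rewrite ler_wpM2l ?sobw_ge0// cdotZ cdotC cdotZ mulrA -expr2.
    rewrite ler_piMl ?csq_ge0// -real_normK ?num_real// exprn_ile1//.
  by apply: lerD; apply: ler_sum => k _; exact: h.
split=> //; move/in_sobP: cS => [M cM]; apply/in_sobP; exists M => N.
exact: le_trans (h N) (cM N).
Qed.

Definition fmul (mu : int -> R) (mu1 : forall m, `|mu m| <= 1) (x : Sob R p n) :
  Sob R p n := MkSob (mul_in_sob mu1 (fcoef_in x)).1.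

Lemma bounded_linear_fmul mu (mu1 : forall m, `|mu m| <= 1) :
  bounded_linear (fmul mu1) /\ forall x, `|fmul mu1 x| <= `|x|.
Proof.
have h x : `|fmul mu1 x| <= `|x|.
  apply: Sob_norm_le => // N; apply: le_trans (sob_part_le_norm x N).
  exact: (mul_in_sob mu1 (fcoef_in x)).2.
split=> //; apply: (@bound_bounded_linear _ _ _ _ 1); last first.
  by move=> x; rewrite mul1r.
move=> t x y; apply: val_inj; apply/funext => m /=.
by rewrite scalerDr !scalerA mulrC -scalerA.
Qed.

End Multipliers.

Section InitialTopology.

Lemma ultra_fmap (S T : Type) (f : S -> T) (F : set_system S) :
  UltraFilter F -> UltraFilter (f x @[x --> F]).
Proof.
move=> FU; split; first exact: fmap_proper_filter.
move=> G GF FG; apply/seteqP; split=> A; last exact: FG.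
move=> GA; have [//|FnA] := in_ultra_setVsetC (f @^-1` A) FU.
have GnA : G (~` A) by apply: FG; rewrite /fmap /= preimage_setC.
by have [y []] := filter_ex (filterI GA GnA).
Qed.

Lemma ultra_compact_cvg (S : Type) (T : topologicalType) (f : S -> T)
    (F : set_system S) (K : set T) : UltraFilter F -> compact K ->
  F (f @^-1` K) -> exists2 y, K y & f x @[x --> F] --> y.
Proof.
rewrite compact_ultra => FU cK FK.
by have [y [Ky Fy]] := cK _ (ultra_fmap f FU) FK; exists y.
Qed.

Lemma cvg_initialP (S : choiceType) (T : topologicalType) (f : S -> T)
    (F : set_system S) (s : S) : Filter F ->
  F --> (s : initial_topology f) <-> f x @[x --> F] --> f s.
Proof.
move=> FF; split=> [h A /(@initial_continuous _ _ f)/h//|h A].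
move=> [B [[C oC <-] Cs] CA]; apply: filterS CA _.
by apply: h; exact: open_nbhs_nbhs.
Qed.

Lemma cvg_weakP (R : realType) (E : normedModType R) (F : set_system E) (y : E) :
  Filter F ->
  F --> (y : weak E) <->
  forall l : E -> R^o, bounded_linear l -> l x @[x --> F] --> l y.
Proof.
move=> FF; rewrite cvg_initialP cvg_sup; split=> [h l [lL lc]|h l].
  pose m := GRing.isLinear.Build R E R^o *:%R l lL.
  pose l' : {linear E -> R^o} := HB.pack l m.
  have := h (exist _ l' lc : dual E).
  by rewrite cvg_initialP.
rewrite cvg_initialP; apply: h; split; last exact: svalP l.
by move=> t a b; exact: linearP.
Qed.

End InitialTopology.


Section Inclusions.
Context {R : realType} {p q n : nat}.

Definition sincl (pq : (p <= q)%N) (x : Sob R q n) : Sob R p n :=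
  MkSob (in_sobS pq (fcoef_in x)).

Lemma sob_part_mono (c : int -> Cn R n) N : (p <= q)%N ->
  sob_part p c c N <= sob_part q c c N.
Proof.
by move=> pq; apply: lerD; apply: ler_sum => k _; rewrite ler_wpM2r ?csq_ge0 ?sobw_le.
Qed.

Lemma bounded_linear_sincl (pq : (p <= q)%N) :
  bounded_linear (sincl pq) /\ forall x, `|sincl pq x| <= `|x|.
Proof.
have h x : `|sincl pq x| <= `|x|.
  apply: Sob_norm_le => // N; apply: le_trans (sob_part_le_norm x N).
  exact: sob_part_mono.
split=> //; apply: (@bound_bounded_linear _ _ _ _ 1); last first.
  by move=> x; rewrite mul1r.
by move=> t x y; exact: val_inj.
Qed.

Lemma sobw_tail (m : int) N : (p < q)%N -> (N < `|m|)%N ->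
  sobw R p m <= N.+1%:R^-1 * sobw R q m.
Proof.
move=> pq Nm; rewrite /sobw; case: eqP Nm => [->//|_] Nm.
rewrite mulrC ler_pdivlMr ?ltr0n// -natrM ler_nat.
rewrite -(subnKC pq) addSn -addnS expnD leq_mul2l; apply/orP; right.
by rewrite expnS; apply: (leq_trans Nm); rewrite leq_pmulr// expn_gt0 (leq_trans _ Nm).
Qed.

Lemma sob_part_tail (c : int -> Cn R n) N M : (p < q)%N ->
  sob_part p c c M <= sob_part p c c N + N.+1%:R^-1 * sob_part q c c M.
Proof.
move=> pq; have [MN|/ltnW NM] := leqP M N.
  apply: le_trans (@sob_part_nd R p n c _ _ MN) _.
  by rewrite lerDl mulr_ge0 ?sob_part_ge0.
rewrite -(subnKC NM); elim: (M - N)%N => [|k IH].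
  by rewrite addn0 lerDl mulr_ge0 ?sob_part_ge0.
rewrite addnS; have := leq_addr k N; move: (N + k)%N IH => L IH NL.
rewrite (sob_partS (p := p)) (sob_partS (p := q)).
rewrite (mulrDr N.+1%:R^-1) [leRHS]addrA lerD// mulrDr; apply: lerD.
  by rewrite mulrA ler_wpM2r ?csq_ge0// sobw_tail// absz_nat ltnS.
by rewrite mulrA ler_wpM2r ?csq_ge0// sobw_tail// NegzE abszN absz_nat ltnS.
Qed.

Lemma sincl_cvg (pq : (p < q)%N) (T : Type) (F : set_system T)
    (f : T -> Sob R q n) (y : Sob R q n) (M : R) :
  Filter F -> (\forall a \near F, `|f a| <= M) ->
  (forall m, cdot (f a m - y m) (f a m - y m) @[a --> F] --> (0 : R)) ->
  sincl (ltnW pq) (f a) @[a --> F] --> sincl (ltnW pq) y.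
Proof.
move=> FF fM h; apply/cvgrPdist_le => e e0.
pose K := (M + `|y|) ^+ 2.
have K0 : 0 <= K by exact: sqr_ge0.
have e2 : 0 < e ^+ 2 / 2 by rewrite divr_gt0// exprn_gt0.
have [N NK] : exists N : nat, N.+1%:R^-1 * K <= e ^+ 2 / 2.
  exists (Num.bound (K / (e ^+ 2 / 2))).
  have := archi_boundP (divr_ge0 K0 (ltW e2)).
  set B := Num.bound _ => KB.
  rewrite mulrC ler_pdivrMr ?ltr0n// mulrC -ler_pdivrMr//.
  by apply: le_trans (ltW KB) _; rewrite ler_nat.
have h0 m : cdot (f a m - y m) (f a m - y m) @[a --> F] -->
    cdot ((0 : int -> Cn R n) m) ((0 : int -> Cn R n) m) by rewrite cdot0l.
have := @sob_part_cvg R p n T F (fun a m => f a m - y m) 0 N FF h0.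
rewrite sob_part0 => /cvgr0Pnorm_le /(_ _ e2).
apply: filterS2 fM => a fM hN.
rewrite distrC; apply: Sob_norm_le; first exact: ltW.
move=> L; apply: le_trans (sob_part_tail _ N L pq) _.
rewrite (splitr (e ^+ 2)); apply: lerD.
  by apply: le_trans hN; exact: ler_norm.
apply: le_trans NK; rewrite ler_wpM2l//.
apply: le_trans (sob_part_le_norm (f a - y) L) _.
rewrite ler_pXn2r ?nnegrE//; last first.
  by apply: le_trans (_ : `|f a| + `|y| <= _); [rewrite addr_ge0|rewrite lerD2r].
by apply: le_trans (ler_normB _ _) _; rewrite lerD2r.
Qed.

Lemma cdot_cvg (T : Type) (F : set_system T) (f : T -> Cn R n) (z : Cn R n) :
  Filter F ->
  (forall k, (f a).1 ord0 k @[a --> F] --> z.1 ord0 k) ->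
  (forall k, (f a).2 ord0 k @[a --> F] --> z.2 ord0 k) ->
  cdot (f a) (f a) @[a --> F] --> cdot z z.
Proof.
move=> FF h1 h2; rewrite /cdot; apply: cvg_big => [|k _]; first exact: add_continuous.
by apply: cvgD; exact: cvgM.
Qed.

Lemma cdot_cvg0 (T : Type) (F : set_system T) (f : T -> Cn R n) (z : Cn R n) :
  Filter F ->
  (forall k, (f a).1 ord0 k @[a --> F] --> z.1 ord0 k) ->
  (forall k, (f a).2 ord0 k @[a --> F] --> z.2 ord0 k) ->
  cdot (f a - z) (f a - z) @[a --> F] --> (0 : R).
Proof.
move=> FF h1 h2; rewrite -(cdot0l (0 : Cn R n)); apply: cdot_cvg => k.
  under eq_fun do rewrite !mxE; rewrite mxE -(subrr (z.1 ord0 k)).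
  by apply: cvgB => //; exact: cvg_cst.
under eq_fun do rewrite !mxE; rewrite mxE -(subrr (z.2 ord0 k)).
by apply: cvgB => //; exact: cvg_cst.
Qed.

Lemma sincl_compact (pq : (p < q)%N) M :
  compact [set sincl (ltnW pq) x | x in [set x : Sob R q n | `|x| <= M]].
Proof.
pose I := initial_topology (sincl (ltnW pq)).
suff cI : compact ([set x : Sob R q n | `|x| <= M] : set I).
  by apply: continuous_compact cI; apply: continuous_subspaceT;
    exact: initial_continuous.
rewrite compact_ultra => F FU FM.
have lim1 (g : Sob R q n -> R) : (forall x, `|g x| <= `|x|) ->
    exists t : R, g x @[x --> F] --> t.
  move=> gx.
  have [|t _ ht] := @ultra_compact_cvg _ _ g F _ FU (@segment_compact R (- M) M).
    by apply: filterS FM => x /= xM; rewrite in_itv /= -ler_norml; exact: le_trans xM.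
  by exists t.
have /choice[c hc] : forall m : int, exists z : Cn R n,
    (forall k : 'I_n, ((x : Sob R q n) m).1 ord0 k @[x --> F] --> z.1 ord0 k) /\
    (forall k : 'I_n, ((x : Sob R q n) m).2 ord0 k @[x --> F] --> z.2 ord0 k).
  move=> m.
  have /choice[a ha] : forall k : 'I_n, exists t : R, ((x : Sob R q n) m).1 ord0 k @[x --> F] --> t.
    by move=> k; apply: lim1 => x; have [] := Sob_coord_le x m k.
  have /choice[b hb] : forall k : 'I_n, exists t : R, ((x : Sob R q n) m).2 ord0 k @[x --> F] --> t.
    by move=> k; apply: lim1 => x; have [] := Sob_coord_le x m k.
  by exists (\row_k a k, \row_k b k); split=> k; rewrite mxE.
have cM N : sob_part q c c N <= M ^+ 2.
  have h : sob_part q (x : Sob R q n) (x : Sob R q n) N @[x --> F] --> sob_part q c c N.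
    by apply: sob_part_cvg => m; have [h1 h2] := hc m; exact: cdot_cvg.
  apply: (cvgr_to_le h).
  apply: filterS FM => x /= xM; apply: le_trans (sob_part_le_norm x N) _.
  by rewrite ler_pXn2r ?nnegrE// (le_trans _ xM).
have cS : c \in in_sob R q n by apply/in_sobP; exists (M ^+ 2).
have M0 : 0 <= M by have [x /= xM] := filter_ex FM; apply: le_trans xM.
exists (MkSob cS); split; first exact: Sob_norm_le.
apply/cvg_initialP; apply: (sincl_cvg _ FM) => m.
by have [] := hc m; exact: cdot_cvg0.
Qed.

End Inclusions.

Section Truncation.
Context {R : realType} {p n : nat}.

Definition trunc_coef (N : nat) (c : int -> Cn R n) : int -> Cn R n :=
  fun m => if (`|m| <= N)%N then c m else 0.

Lemma sob_part_trunc (q : nat) N c M :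
  sob_part q (trunc_coef N c) (trunc_coef N c) M = sob_part q c c (minn M N).
Proof.
elim: M => [|M IH].
  by rewrite min0n /sob_part /symsum !big_ord1 !big_ord0 /trunc_coef absz_nat.
rewrite sob_partS IH /trunc_coef NegzE abszN !absz_nat.
have [h|] := boolP (M < N)%N.
  by rewrite (minn_idPl (ltnW h)) (minn_idPl h) sob_partS NegzE.
rewrite -leqNgt => h; rewrite !cdot0l !mulr0 !addr0.
by rewrite (minn_idPr h) (minn_idPr (leqW h)).
Qed.

Lemma trunc_in_sob (q : nat) N c : trunc_coef N c \in in_sob R q n.
Proof.
apply/in_sobP; exists (sob_part q c c N) => M; rewrite sob_part_trunc.
by apply: sob_part_nd; rewrite geq_minr.
Qed.

Definition trunc (q : nat) N (x : Sob R p n) : Sob R q n := MkSob (trunc_in_sob q N x).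

Lemma sob_part_sub_trunc (x : Sob R p n) N M :
  sob_part p (x - trunc p N x) (x - trunc p N x) M =
  sob_part p x x M - sob_part p x x (minn M N).
Proof.
have -> : fcoef (x - trunc p N x) = (fun m => if (`|m| <= N)%N then 0 else x m).
  apply/funext => m; rewrite -[LHS]/(x m - trunc_coef N x m) /trunc_coef.
  by case: ifP => _; rewrite ?subrr ?subr0.
elim: M => [|M IH].
  by rewrite min0n subrr /sob_part /symsum !big_ord1 !big_ord0 /= cdot0l mulr0 addr0.
rewrite !sob_partS IH NegzE abszN !absz_nat.
have [h|] := boolP (M < N)%N; last first.
  rewrite -leqNgt => h; rewrite (minn_idPr h) (minn_idPr (leqW h)).
  by rewrite addrAC.
rewrite !cdot0l !mulr0 !addr0 (minn_idPl (ltnW h)) (minn_idPl h).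
by rewrite sob_partS NegzE !subrr.
Qed.

Lemma trunc_cvg (x : Sob R p n) : trunc p N x @[N --> \oo] --> x.
Proof.
apply/cvgrPdist_le => e e0.
have /cvgrPdist_le /(_ _ (exprn_gt0 2 e0)) := @Sob_norm_cvg _ _ _ x.
apply: filterS => N; rewrite ger0_norm ?subr_ge0 ?sob_part_le_norm// => h.
apply: Sob_norm_le => [|M]; first exact: ltW.
rewrite sob_part_sub_trunc; case: (leqP M N) => _; first by rewrite subrr sqr_ge0.
by apply: le_trans h; rewrite lerD2r sob_part_le_norm.
Qed.

End Truncation.

Section Polarization.
Context {R : realType} {n : nat}.
Local Notation B := (Bhalf R n).
Implicit Types x y : B.

Lemma mJdE (c : int -> Cn R n) m : mJd c m = m%:~R *: c m.
Proof.
rewrite /mJd /Jst /=; case: (c m) => a b /=.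
by rewrite !scalerN; congr pair => /=; rewrite ?opprK.
Qed.

Definition single (m : int) (v : Cn R n) : int -> Cn R n :=
  fun k => if k == m then v else 0.

Lemma single_in_sob (q : nat) m v : single m v \in in_sob R q n.
Proof.
have -> : single m v = trunc_coef `|m|%N (single m v).
  apply/funext => k; rewrite /trunc_coef /single; case: eqP => [->|_].
    by rewrite leqnn.
  by rewrite if_same.
exact: trunc_in_sob.
Qed.

Definition Ssingle m v : B := MkSob (single_in_sob 1 m v).

Lemma mJd_single m v : mJd (Ssingle m v) = m%:~R *: fcoef (Ssingle m v).
Proof.
apply/funext => k; rewrite mJdE -[RHS]/(m%:~R *: single m v k) /= /single.
by case: eqP => [->//|_]; rewrite !scaler0.
Qed.

Lemma trunc_span (A : set B) x N :
  (forall m, A (Ssingle m (x m))) ->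
  exists2 s : seq B, {in s, forall y, A y} & in_span s (trunc 1 N x).
Proof.
move=> Ax; elim: N => [|N [s sA sx]].
  exists [:: Ssingle 0 (x 0)] => [y|]; first by rewrite inE => /eqP ->.
  have -> : trunc 1 0 x = Ssingle 0 (x 0).
    apply: val_inj; apply/funext => k /=; rewrite /trunc_coef /single leqn0 absz_eq0.
    by case: eqP => [->|].
  by apply: in_span_mem; rewrite inE.
exists [:: Ssingle N.+1 (x N.+1), Ssingle (Negz N) (x (Negz N)) & s] => [y|].
  by rewrite !inE => /predU1P[->//|/predU1P[->//|/sA]].
have -> : trunc 1 N.+1 x = Ssingle N.+1 (x N.+1) +
    (Ssingle (Negz N) (x (Negz N)) + trunc 1 N x).
  apply: val_inj; apply/funext => k /=.
  rewrite -[RHS]/(single N.+1 (x N.+1) k + (single (Negz N) (x (Negz N)) k +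
    trunc_coef N x k)).
  rewrite /trunc_coef /single; case: k => k.
    rewrite absz_nat !eqz_nat/= leq_eqVlt ltnS add0r.
    by case: eqP => [->|]; rewrite ?ltnn ?addr0 ?add0r.
  rewrite !NegzE abszN absz_nat -!NegzE/= add0r leq_eqVlt !ltnS.
  have -> : (Negz k == Negz N) = (k == N) by [].
  by rewrite eqSS; case: eqP => [->|]; rewrite ?ltnn ?addr0 ?add0r.
apply: in_spanD; first by apply: in_span_mem; rewrite mem_head.
apply: in_spanD; last by do 2! apply: in_span_behead.
by apply: in_span_mem; rewrite !inE eqxx orbT.
Qed.

Lemma closed_coef (Q : pred int) : closed [set x : B | forall m, Q m -> x m = 0].
Proof.
have -> : [set x : B | forall m, Q m -> x m = 0] =
    \bigcap_(mk in [set mk : int * 'I_n | Q mk.1])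
      [set x : B | (x mk.1).1 ord0 mk.2 = 0 /\ (x mk.1).2 ord0 mk.2 = 0].
  apply/seteqP; split=> [x h [m k] /= /h ->|x h m Qm /=]; first by rewrite !mxE.
  have h1 : (x m).1 = 0.
    by apply/rowP => k; have [/= h1 _] := h (m, k) Qm; rewrite h1 mxE.
  have h2 : (x m).2 = 0.
    by apply/rowP => k; have [/= _ h2] := h (m, k) Qm; rewrite h2 mxE.
  by rewrite [LHS]surjective_pairing h1 h2.
apply: closed_bigI => -[m k] _ /=; apply: closedI.
  apply: (@preimage_closed _ _ (fun x : B => (x m).1 ord0 k : R) [set 0]).
    by move=> x _; exact: (bounded_linear_coord1 m k).2.
  exact: closed_eq.
apply: (@preimage_closed _ _ (fun x : B => (x m).2 ord0 k : R) [set 0]).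
  by move=> x _; exact: (bounded_linear_coord2 m k).2.
exact: closed_eq.
Qed.

Lemma closed_spanP (Q : pred int) (A : set B) :
  (forall x, A x -> forall m, Q m -> x m = 0) ->
  (forall m v, ~~ Q m -> A (Ssingle m v)) -> A 0 ->
  closed_span A = [set x : B | forall m, Q m -> x m = 0].
Proof.
move=> AQ QA A0; apply/seteqP; split.
  apply: (@subset_trans _ (closure [set x : B | forall m, Q m -> x m = 0])).
    apply: closureS => x [s sA sx] m Qm.
    elim: s x sA sx => [x _ /in_span_nil->//|a s IH x sA /in_span_cons[t [y [sy ->]]]].
    have -> : (t *: a + y) m = t *: a m + y m by [].
    have am0 : a m = 0 by apply: AQ => //; apply: sA; rewrite mem_head.
    rewrite am0 scaler0 add0r; apply: IH => // z zs.
    by apply: sA; rewrite inE zs orbT.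
  by move=> x; exact: closed_coef.
move=> x xQ; apply: (closed_cvg _ (@closed_closure _ _)) (@trunc_cvg _ _ _ x).
apply: nearW => N; apply: subset_closure; apply: trunc_span => m.
have [Qm|nQm] := boolP (Q m); last exact: QA.
rewrite xQ//; have -> : Ssingle m 0 = 0 => //.
by apply: val_inj; apply/funext => k /=; rewrite /single if_same.
Qed.

Lemma TminusE : Tminus = [set x : B | forall m, m <= 0 -> x m = 0].
Proof.
apply: (closed_spanP (Q := fun m => m <= 0)).
- move=> x [l l0 xl] m m0; have := congr1 (fun c => c m) xl.
  rewrite /= mJdE => /eqP; rewrite -subr_eq0 -scalerBl scaler_eq0 subr_eq0.
  case/orP => /eqP // ml; move: l0; rewrite -ml.
  by rewrite ltr0z ltNge m0.
- move=> m v; rewrite -ltNge => m0; exists m%:~R; first by rewrite ltr0z.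
  exact: mJd_single.
- exists 1 => //; apply/funext => m; rewrite mJdE.
  by rewrite -[LHS]/(m%:~R *: (0 : Cn R n)) -[RHS]/(1 *: (0 : Cn R n)) !scaler0.
Qed.

Lemma TplusE : Tplus = [set x : B | forall m, 0 < m -> x m = 0].
Proof.
apply: (closed_spanP (Q := fun m => 0 < m)).
- move=> x [l l0 xl] m m0; have := congr1 (fun c => c m) xl.
  rewrite /= mJdE => /eqP; rewrite -subr_eq0 -scalerBl scaler_eq0 subr_eq0.
  case/orP => /eqP // ml; move: l0; rewrite -ml.
  by rewrite lerz0 leNgt m0.
- move=> m v; rewrite -leNgt => m0; exists m%:~R; first by rewrite lerz0.
  exact: mJd_single.
- exists 0 => //; apply/funext => m; rewrite mJdE.
  by rewrite -[LHS]/(m%:~R *: (0 : Cn R n)) -[RHS]/(0 *: (0 : Cn R n)) !scaler0.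
Qed.

Let pos_le1 (m : int) : `|(0 < m)%R%:R : R| <= 1.
Proof. by case: (0 < m)%R; rewrite ?normr1 ?normr0. Qed.

Definition pos_part : B -> B := fmul pos_le1.

Lemma bounded_linear_pos_part : bounded_linear pos_part.
Proof. exact: (bounded_linear_fmul pos_le1).1. Qed.

Lemma pos_partE x m : pos_part x m = if 0 < m then x m else 0.
Proof. by rewrite /= ; case: ifP => _; rewrite ?scale1r ?scale0r. Qed.

Lemma PiminusE : Piminus = pos_part :> (B -> B).
Proof.
apply/funext => x; apply: xget_unique.
  rewrite TminusE TplusE; split=> m m0; first by rewrite pos_partE ltNge m0.
  by rewrite -[LHS]/(x m - pos_part x m) pos_partE m0 subrr.
move=> y; rewrite TminusE TplusE => -[y1 y2]; apply: val_inj; apply/funext => m.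
rewrite -[RHS]/(pos_part x m) pos_partE; case: ltP => [m0|/y1//].
by have /eqP := y2 m m0; rewrite subr_eq0 => /eqP.
Qed.

Lemma PiplusE : Piplus = (fun x => x - pos_part x) :> (B -> B).
Proof.
apply/funext => x; apply: xget_unique.
  rewrite TminusE TplusE; split=> m m0.
    by rewrite -[LHS]/(x m - pos_part x m) pos_partE m0 subrr.
  by rewrite opprB addrC subrK pos_partE ltNge m0.
move=> y; rewrite TminusE TplusE => -[y1 y2]; apply: val_inj; apply/funext => m.
rewrite -[RHS]/(x m - pos_part x m) pos_partE; case: ltP => [/y1 h|/y2].
  by rewrite subrr; exact: h.
by move=> /eqP; rewrite subr_eq0 subr0 => /eqP.
Qed.

Lemma bounded_linear_Piminus : bounded_linear (@Piminus R n).
Proof. by rewrite PiminusE; exact: bounded_linear_pos_part. Qed.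

Lemma bounded_linear_Piplus : bounded_linear (@Piplus R n).
Proof.
rewrite PiplusE; have [L c] := bounded_linear_pos_part; split.
  by move=> t x y; rewrite L scalerBr opprD addrACA.
by move=> x; exact: (cvgB cvg_id (@c x)).
Qed.

Lemma Tminus_linear t x y : Tminus x -> Tminus y -> Tminus (t *: x + y).
Proof.
rewrite !TminusE => hx hy m m0.
by rewrite -[LHS]/(t *: x m + y m) hx// hy// scaler0 addr0.
Qed.

Lemma Tminus_Piminus x : Tminus (Piminus x).
Proof. by rewrite PiminusE TminusE => m m0; rewrite pos_partE ltNge m0. Qed.

End Polarization.

(** * Fourier series of loops and the integral of the Hamiltonian *)

Section Hamiltonian.
Context {R : realType} {n : nat}.
Implicit Types (z w k : Cn R n).

Lemma cdotDr z w w' : cdot z (w + w') = cdot z w + cdot z w'.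
Proof. by rewrite cdotC cdotD !(cdotC z). Qed.

Lemma cdotZr t z w : cdot z (t *: w) = t * cdot z w.
Proof. by rewrite cdotC cdotZ (cdotC z). Qed.

Lemma csqE z : csq z = cdot z z. Proof. by []. Qed.

Lemma csqD z w : csq (z + w) = csq z + 2 * cdot z w + csq w.
Proof. by rewrite /csq cdotD !cdotDr (cdotC w z); ring. Qed.

Lemma csqZ t z : csq (t *: z) = t ^+ 2 * csq z.
Proof. by rewrite /csq cdotZ cdotZr mulrA expr2. Qed.

Lemma csqN z : csq (- z) = csq z.
Proof. by rewrite -scaleN1r csqZ sqrrN expr1n mul1r. Qed.

Lemma csqD_le z w : csq (z + w) <= 2 * (csq z + csq w).
Proof.
have := csq_ge0 (z - w); rewrite -csqE csqD csqN -scaleN1r cdotZr => h.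
by rewrite csqD; lra.
Qed.

Lemma Cn_coord_le z (i : 'I_n) : `|z.1 ord0 i| <= `|z| /\ `|z.2 ord0 i| <= `|z|.
Proof.
rewrite prod_normE; split; rewrite le_max; apply/orP; [left|right];
  by rewrite [leRHS]/Num.norm /= mx_normrE; apply: (le_bigmax _ _ (ord0, i)).
Qed.

Lemma Cn_norm_le z (M : R) : 0 <= M ->
  (forall i, `|z.1 ord0 i| <= M /\ `|z.2 ord0 i| <= M) -> `|z| <= M.
Proof.
move=> M0 h; rewrite prod_normE ge_max; apply/andP; split;
  rewrite [leLHS]/Num.norm /= mx_normrE; apply/bigmax_leP; split=> // -[i j] _;
  by rewrite (ord1 i); have [] := h j.
Qed.

Lemma norm_csq z : `|z| ^+ 2 <= csq z.
Proof.
rewrite -[leRHS]sqr_sqrtr ?csq_ge0// ler_pXn2r ?nnegrE ?sqrtr_ge0//.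
apply: Cn_norm_le => [|i]; first exact: sqrtr_ge0.
have [h1 h2] := cdot_coord_le z i.
by split; rewrite -sqrtr_sqr; apply: ler_wsqrtr.
Qed.

Lemma cdot_norm z w : `|cdot z w| <= (2 * `|z| * `|w|) *+ n.
Proof.
apply: le_trans (ler_norm_sum _ _ _) _.
have -> : (2 * `|z| * `|w|) *+ n = \sum_(i < n) 2 * `|z| * `|w|.
  by rewrite sumr_const card_ord.
apply: ler_sum => i _.
apply: le_trans (ler_normD _ _) _; rewrite !normrM.
have [z1 z2] := Cn_coord_le z i; have [w1 w2] := Cn_coord_le w i.
rewrite -mulrA mulr_natl mulr2n; apply: lerD; exact: ler_pM.
Qed.

Lemma bounded_bilinear_cdot : bounded_bilinear (fun z w => cdot z w : R^o).
Proof.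
split=> [w t z z'|z t w w'|].
- by rewrite cdotD cdotZ.
- by rewrite cdotDr cdotZr.
- exists (2 *+ n); first by rewrite mulrn_wge0.
  by move=> z w; apply: le_trans (cdot_norm z w) _; rewrite !mulrnAl.
Qed.

Lemma continuous_csq : continuous (fun z => csq z : R).
Proof.
move=> z; have /is_diff_differentiable/differentiable_continuous :=
  bounded_bilinear_diff_comp bounded_bilinear_cdot
    (is_diff_differentiable (is_diff_id z)) (is_diff_differentiable (is_diff_id z)).
by [].
Qed.

Lemma ball_compact (M : R) : compact [set z : Cn R n | `|z| <= M].
Proof.
have cb : compact [set v : 'rV[R]_n | `|v| <= M].
  apply: bounded_closed_compact.
    by apply/bounded_setP; exists M.
  apply: (@preimage_closed _ _ (fun v : 'rV[R]_n => `|v| : R) [set t | t <= M]).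
    by move=> v _; exact: norm_continuous.
  exact: closed_le.
apply: subclosed_compact (compact_setX cb cb) _.
  apply: (@preimage_closed _ _ (fun v : Cn R n => `|v| : R) [set t | t <= M]).
    by move=> v _; exact: norm_continuous.
  exact: closed_le.
by move=> z /=; rewrite prod_normE ge_max => /andP[].
Qed.

Variables (eps : R) (H : Cn R n -> R).
Hypothesis HH : is_hamiltonian eps H.

Let dH z : differentiable (H : Cn R n -> R^o) z.
Proof. by have [/(_ 1%N)[h _] _ _] := HH; exact: h. Qed.

Lemma hamiltonian_diff_bound : exists2 C : R, 0 <= C &
  forall y k, `|'d (H : Cn R n -> R^o) y k| <= C * (1 + `|y|) * `|k|.
Proof.
have [/(_ 1%N)[_ /= cH] _ [r Hr]] := HH.
pose D (p : Cn R n * Cn R n) : R := 'd (H : Cn R n -> R^o) (p.1) p.2.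
have cD : continuous D by move=> p; exact: cH.
have cK : compact ([set z : Cn R n | `|z| <= 1 + `|r|] `*` [set z : Cn R n | `|z| <= 1]).
  by apply: compact_setX; exact: ball_compact.
have /compact_bounded/bounded_setP[M DM] : compact (D @`
    ([set z : Cn R n | `|z| <= 1 + `|r|] `*` [set z : Cn R n | `|z| <= 1])).
  by apply: continuous_compact cK; exact: continuous_subspaceT.
pose A : R := `|M| + 2 * `|1 + eps| * (2 *+ n).
have A0 : 0 <= A by rewrite addr_ge0// !mulr_ge0// mulrn_wge0.
exists A => // y k.
have [ry|ry] := ltP r (csq y).
  have e : is_diff y (H : Cn R n -> R^o)
      (fun h => (1 + eps) *: (cdot y h + cdot h y : R^o)).
    apply: (@near_eq_is_diff _ _ _ (fun z => (1 + eps) *: (csq z : R^o))).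
      have : \forall z \near y, r < csq z.
        exact: (cvgr_gt (csq y) (@continuous_csq y) _ ry).
      by apply: filterS => z /ltW rz; rewrite Hr.
    have d2 := bounded_bilinear_diff_comp bounded_bilinear_cdot
      (is_diff_differentiable (is_diff_id y)) (is_diff_differentiable (is_diff_id y)).
    have d3 := @is_diffZ _ (Cn R n) (R^o : normedModType R) _ _ (1 + eps) y d2.
    apply: (is_diff_eq d3); apply/funext => h.
    rewrite -[LHS]/((1 + eps) *: (cdot y ('d id y h) + cdot ('d id y h) y : R^o)).
    by rewrite !(is_diffE _ (is_diff_id y)).
  rewrite (is_diffE _ e) (cdotC k) normrZ -mulr2n normrMn -mulr_natl.
  apply: (@le_trans _ _ (`|1 + eps| * (2 * ((2 * `|y| * `|k|) *+ n)))).
    by rewrite !ler_wpM2l// cdot_norm.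
  have aux (a b c : R) : a * (2 * ((2 * b * c) *+ n)) = 2 * a * (2 *+ n) * b * c.
    by rewrite -(mulr_natr (2 * b * c) n) -(mulr_natr 2 n); ring.
  rewrite aux.
  rewrite ler_wpM2r//; by apply: ler_pM => //; rewrite ?lerDr ?ler01//.
have yr : `|y| <= 1 + `|r|.
  rewrite leNgt; apply/negP => h; move: ry; apply/negP; rewrite -ltNge.
  apply: lt_le_trans (norm_csq y); apply: le_lt_trans (ler_norm r) _.
  apply: (@lt_le_trans _ _ `|y|); first by apply: le_lt_trans h; rewrite lerDr.
  by rewrite expr2 ler_peMr// (le_trans _ (ltW h))// lerDl.
have [->|k0] := eqVneq k 0.
  by rewrite linear0 normr0 normr0 mulr0.
have nk : 0 < `|k| by rewrite normr_gt0.
have -> : k = `|k| *: (`|k|^-1 *: k) by rewrite scalerA divff ?gt_eqF// scale1r.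
rewrite linearZ normrZ normr_id [in leRHS]normrZ normr_id normrZ normfV normr_id.
rewrite mulVf ?gt_eqF// mulr1 mulrC ler_wpM2r//.
have : `|D (y, `|k|^-1 *: k)| <= M.
  apply: DM; exists (y, `|k|^-1 *: k) => //; split=> //=.
  by rewrite normrZ normfV normr_id mulVf ?gt_eqF.
move=> /le_trans; apply; apply: le_trans (ler_norm M) _.
by rewrite -[leLHS]mulr1; apply: ler_pM => //; rewrite ?lerDl.
Qed.

Lemma hamiltonian_lipschitz : exists2 C : R, 0 <= C &
  forall z w, `|H z - H w| <= C * (1 + `|z| + `|w|) * `|z - w|.
Proof.
have [C C0 dHC] := hamiltonian_diff_bound; exists C => // z w.
pose g (t : R) : Cn R n := t *: (z - w) + w.
pose f (t : R) : R := H (g t).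
have gd t : is_diff t (g : R^o -> Cn R n) (fun h => h *: (z - w)).
  apply: bounded_linear_near0.
    have := @bounded_linear_rank1 R (R^o : normedModType R) (Cn R n) id (z - w).
    by apply; split=> // x; exact: cvg_id.
  move=> e e0; apply: (@filterE _ (nbhs (0 : R^o))) => h.
  have -> : g (h + t) - g t - h *: (z - w) = 0.
    by rewrite /g opprD addrACA subrr addr0 -scalerBl addrK subrr.
  by rewrite normr0 mulr_ge0// ltW.
have fd t : is_diff t (f : R^o -> R^o) (fun h => 'd (H : Cn R n -> R^o) (g t) (h *: (z - w))).
  have hH : is_diff (g t) (H : Cn R n -> R^o) ('d (H : Cn R n -> R^o) (g t)) by exact: DiffDef.
  have c := @is_diff_comp _ _ _ _ _ _ _ _ t (gd t) hH.
  exact: c.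
have fder t : is_derive t (1 : R) f ('d (H : Cn R n -> R^o) (g t) (z - w)).
  split; first by apply/derivable1_diffP; exact: is_diff_differentiable (fd t).
  by rewrite deriveE ?(is_diff_differentiable (fd t))// (is_diffE _ (fd t)) scale1r.
have fc : {within `[(0 : R), 1], continuous f}.
  apply: continuous_subspaceT => t.
  exact: differentiable_continuous (is_diff_differentiable (fd t)).
have [c] := @MVT R f _ 0 1 ltr01 (fun t _ => fder t) fc.
rewrite in_itv /= => /andP[c0 c1]; rewrite /f /g scale0r add0r scale1r subrK subr0 mulr1.
move=> ->; apply: le_trans (dHC _ _) _; rewrite ler_wpM2r// ler_wpM2l//.
rewrite -addrA lerD2l.
have -> : c *: (z - w) + w = c *: z + (1 - c) *: w.
  by rewrite scalerBr scalerBl scale1r addrAC addrA.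
apply: le_trans (ler_normD _ _) _; rewrite !normrZ.
have c1' : 0 <= 1 - c by rewrite subr_ge0 ltW.
rewrite (ger0_norm (ltW c0)) (ger0_norm c1').
by apply: lerD; rewrite ler_piMl// ?(ltW c1)// gerBl ltW.
Qed.

Lemma hamiltonian_am_gm : exists2 C : R, 0 <= C & forall t z w, 0 < t ->
  `|H z - H w| <= C * (t * (1 + csq z + csq w) + csq (z - w) / t).
Proof.
have [C C0 HC] := hamiltonian_lipschitz; exists (2 * C); first by rewrite mulr_ge0.
move=> t z w t0; apply: le_trans (HC z w) _.
rewrite -mulrA (mulrC 2) -mulrA ler_wpM2l//.
set a := `|z|; set b := `|w|; set d := `|z - w|.
have := norm_csq z; have := norm_csq w; have := norm_csq (z - w).
rewrite -/a -/b -/d => hd hb ha.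
apply: (@le_trans _ _ (2 * (t * (1 + a ^+ 2 + b ^+ 2) + d ^+ 2 / t))); last first.
  rewrite ler_wpM2l// lerD//; last by rewrite ler_wpM2r// invr_ge0 ltW.
  by rewrite ler_wpM2l ?(ltW t0)// -!addrA lerD2l lerD.
have h1 : (1 + a + b) * d <= (t * (1 + a + b) ^+ 2 + d ^+ 2 / t) / 2.
  have -> : (t * (1 + a + b) ^+ 2 + d ^+ 2 / t) / 2 =
      (1 + a + b) * d + (d - t * (1 + a + b)) ^+ 2 / t / 2 by field; rewrite gt_eqF.
  by rewrite lerDl !divr_ge0 ?sqr_ge0// ltW.
have h2 : t * (1 + a + b) ^+ 2 <= t * (3 * (1 + a ^+ 2 + b ^+ 2)).
  rewrite ler_wpM2l ?(ltW t0)//.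
  have := sqr_ge0 (a - b); have := sqr_ge0 (a - 1); have := sqr_ge0 (b - 1).
  by nra.
have h3 : 0 <= d ^+ 2 / t by rewrite divr_ge0 ?sqr_ge0// ltW.
have h4 : 0 <= t * (1 + a ^+ 2 + b ^+ 2).
  by rewrite mulr_ge0 ?(ltW t0)// !addr_ge0 ?sqr_ge0.
move: h1 h2 h3 h4; set X := t * _ ^+ 2; set Y := _ / t; set S := 1 + a ^+ 2 + _.
by rewrite (mulrCA t); lra.
Qed.

End Hamiltonian.

Section MeasurableCn.
Context {R : realType} {n : nat}.

Definition Cn_measurable (D : set R) (g : R -> Cn R n) : Prop :=
  forall k : 'I_n, measurable_fun D (fun t => (g t).1 ord0 k) /\
                   measurable_fun D (fun t => (g t).2 ord0 k).

(* [h @^-1` O] is a countable union of rational boxes, whose preimages under [g] are measurable. *)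
Lemma measurable_fun_Cn (D : set R) (g : R -> Cn R n) (h : Cn R n -> R) :
  measurable D -> Cn_measurable D g -> continuous h ->
  measurable_fun D (fun t => h (g t)).
Proof.
move=> mD mg ch _; apply: (measurability _ (RGenOpens.measurableE R)) => //.
move=> _ [_ [a [b ->] <-]].
pose O := h @^-1` `]a, b[%classic.
have oO : open O by apply: open_comp => [x _|]; [exact: ch|exact: interval_open].
pose I := ('rV[rat]_n * 'rV[rat]_n * nat)%type.
pose e (i : I) : R := i.2.+1%:R^-1.
pose box (i : I) : set (Cn R n) := [set z : Cn R n | forall k,
  `|z.1 ord0 k - ratr (i.1.1 ord0 k)| < e i /\ `|z.2 ord0 k - ratr (i.1.2 ord0 k)| < e i].
have -> : D `&` (fun t => h (g t)) @^-1` `]a, b[%classic =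
    \bigcup_(i : I) (D `&` [set t | box i `<=` O /\ box i (g t)]).
  apply/seteqP; split=> [t [Dt Ot]|t [i _ [Dt [bO bt]]]]; last first.
    by split=> //; exact: bO.
  have : nbhs (g t) O by apply: open_nbhs_nbhs; split.
  move=> /nbhs_normP[d /= d0 dO].
  have [N Nd] : exists N : nat, 2 * N.+1%:R^-1 < d.
    exists (Num.bound (2 / d)); rewrite mulrC ltr_pdivrMl ?ltr0n// -ltr_pdivrMr//.
    apply: lt_trans (archi_boundP (divr_ge0 _ (ltW d0))) _ => //.
    by rewrite ltr_nat.
  have eN0 : 0 < N.+1%:R^-1 :> R by rewrite invr_gt0 ltr0n.
  have rat_near (x : R) : exists q : rat, `|x - ratr q| < N.+1%:R^-1.
    move: eN0; set d1 := N.+1%:R^-1 => eN0.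
    have /rat_in_itvoo[q] : x - d1 < x + d1 by lra.
    by rewrite in_itv /= => /andP[h1 h2]; exists q; rewrite ltr_norml; apply/andP; split; lra.
  have /choice[q1 hq1] : forall k, exists q : rat, `|(g t).1 ord0 k - ratr q| < N.+1%:R^-1.
    by move=> k.
  have /choice[q2 hq2] : forall k, exists q : rat, `|(g t).2 ord0 k - ratr q| < N.+1%:R^-1.
    by move=> k.
  exists ((\row_k q1 k, \row_k q2 k), N) => //; split=> //; split=> [z bz|k]; last first.
    by rewrite /= !mxE; split.
  apply: dO => /=; apply: le_lt_trans Nd; apply: Cn_norm_le.
    by rewrite mulr_ge0// ltW.
  move=> k; have := bz k; rewrite /= !mxE /e /= => -[z1 z2].
  split; [have := hq1 k|have := hq2 k] => h1; rewrite mulr_natl mulr2n.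
    rewrite -(subrK (ratr (q1 k)) ((g t).1 ord0 k)) -addrA.
    by apply: le_trans (ler_normD _ _) _; apply: lerD; [exact: ltW|rewrite distrC ltW].
  rewrite -(subrK (ratr (q2 k)) ((g t).2 ord0 k)) -addrA.
  by apply: le_trans (ler_normD _ _) _; apply: lerD; [exact: ltW|rewrite distrC ltW].
apply: countable_bigcupT_measurable => [|i]; first exact: countableP.
have [bO|nbO] := pselect (box i `<=` O); last first.
  by rewrite (_ : _ `&` _ = set0)//; apply/seteqP; split=> // t [_ []].
have -> : D `&` [set t | box i `<=` O /\ box i (g t)] = D `&` \bigcap_(k in [set: 'I_n])
    ((D `&` (fun t => (g t).1 ord0 k) @^-1` ball (ratr (i.1.1 ord0 k) : R) (e i)) `&`
     (D `&` (fun t => (g t).2 ord0 k) @^-1` ball (ratr (i.1.2 ord0 k) : R) (e i))).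
  apply/seteqP; split=> t [Dt] => [[_ bt]|bt]; split=> //.
    by move=> k _ /=; rewrite -ball_normE /= !(distrC (ratr _)); have [] := bt k.
  split=> // k; have := bt k Logic.I; rewrite /= -ball_normE /=.
  by rewrite !(distrC (ratr _)) => -[[_ ?] [_ ?]].
apply: measurableI => //; apply: fin_bigcap_measurable => // k _.
have [m1 m2] := mg k.
by apply: measurableI; [apply: m1|apply: m2] => //; apply: open_measurable; exact: ball_open.
Qed.

Lemma Cn_measurableB (D : set R) (g h : R -> Cn R n) :
  Cn_measurable D g -> Cn_measurable D h -> Cn_measurable D (fun t => g t - h t).
Proof.
move=> mg mh k; have [g1 g2] := mg k; have [h1 h2] := mh k.
by split; under eq_fun do rewrite !mxE; exact: measurable_funB.
Qed.

Lemma Cn_measurable_csq (D : set R) (g : R -> Cn R n) : measurable D ->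
  Cn_measurable D g -> measurable_fun D (fun t => csq (g t)).
Proof. by move=> mD mg; apply: measurable_fun_Cn => //; exact: continuous_csq. Qed.

End MeasurableCn.

Section Trigonometric.
Context {R : realType}.
Local Notation mu := (@lebesgue_measure R).
Local Notation D := (`[(0 : R), 2 * pi]%classic).

Lemma twopi_gt0 : 0 < 2 * pi :> R.
Proof. by rewrite mulr_gt0// pi_gt0. Qed.

Lemma measurable_D : measurable (D : set R).
Proof. exact: measurable_itv. Qed.

Lemma integrable_D (f : R -> R) : continuous f -> mu.-integrable D (EFin \o f).
Proof.
move=> cf; apply: continuous_compact_integrable; first exact: segment_compact.
exact: continuous_subspaceT.
Qed.

Definition J (f : R -> R) : R := \int[mu]_(t in D) f t.

Lemma J_E (f : R -> R) : continuous f -> (\int[mu]_(t in D) (f t)%:E)%E = (J f)%:E.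
Proof.
move=> cf; rewrite /J /Rintegral fineK//; apply: integrable_fin_num.
  exact: measurable_D.
exact: integrable_D.
Qed.

Lemma JD (f g : R -> R) : continuous f -> continuous g -> J (fun t => f t + g t) = J f + J g.
Proof.
by move=> cf cg; apply: RintegralD; [exact: measurable_D|exact: integrable_D..].
Qed.

Lemma JZ (a : R) (f : R -> R) : continuous f -> J (fun t => a * f t) = a * J f.
Proof. by move=> cf; apply: RintegralZl; [exact: measurable_D|exact: integrable_D]. Qed.

Lemma J_cst a : J (fun _ => a) = 2 * pi * a.
Proof.
rewrite /J Rintegral_cst; last exact: measurable_D.
have := @lebesgue_measure_itv R `[0, 2 * pi].
by rewrite /= lte_fin twopi_gt0 /= oppr0 addr0 => ->; rewrite mulrC.
Qed.

Lemma J_ftc (F f : R -> R) : continuous f -> (forall t, is_derive t (1 : R) F (f t)) ->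
  J f = F (2 * pi) - F 0.
Proof.
move=> cf dF.
have cF t : {for t, continuous F}.
  by apply: differentiable_continuous; apply/derivable1_diffP; have [] := dF t.
apply: EFin_inj; rewrite -J_E// (@continuous_FTC2 _ f F)//.
- exact: twopi_gt0.
- exact: continuous_subspaceT.
- split=> [t _||]; first by have [] := dF t.
    by apply: cvg_at_right_filter; exact: cF.
  by apply: cvg_at_left_filter; exact: cF.
- by move=> t _; rewrite derive1E; have [_ ->] := dF t.
Qed.

Lemma sin_2pi_int (m : int) : sin (m%:~R * (2 * pi) : R) = 0.
Proof.
have h (k : nat) : sin (k%:R * (2 * pi) : R) = 0.
  have := periodicn (@sinD2pi R) k 0; rewrite add0r sin0.
  by rewrite mulr_natl (mulr_natl pi).
by case: m => k; rewrite ?NegzE ?mulrNz ?mulNr ?sinN; rewrite -pmulrn h ?oppr0.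
Qed.

Lemma cos_2pi_int (m : int) : cos (m%:~R * (2 * pi) : R) = 1.
Proof.
have h (k : nat) : cos (k%:R * (2 * pi) : R) = 1.
  have := periodicn (@cosD2pi R) k 0; rewrite add0r cos0.
  by rewrite mulr_natl (mulr_natl pi).
by case: m => k; rewrite ?NegzE ?mulrNz ?mulNr ?cosN; rewrite -pmulrn h.
Qed.

Lemma continuous_mull (a : R) : continuous (fun t : R => a * t).
Proof. by move=> t; apply: cvgM; [exact: cvg_cst|exact: cvg_id]. Qed.

Lemma continuous_cos_mul (a : R) : continuous (fun t : R => cos (a * t)).
Proof.
move=> t; apply: (@continuous_comp _ _ _ (fun t => a * t) cos).
  exact: continuous_mull.
exact: continuous_cos.
Qed.

Lemma continuous_sin_mul (a : R) : continuous (fun t : R => sin (a * t)).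
Proof.
move=> t; apply: (@continuous_comp _ _ _ (fun t => a * t) sin).
  exact: continuous_mull.
exact: continuous_sin.
Qed.

Lemma J_cos (m : int) : m != 0 -> J (fun t => cos (m%:~R * t)) = 0.
Proof.
move=> m0; have mr0 : m%:~R != 0 :> R by rewrite intr_eq0.
have dF t : is_derive t (1 : R) (fun t : R => m%:~R^-1 * sin (m%:~R * t)) (cos (m%:~R * t)).
  have h : is_derive t (1 : R) (fun t : R => m%:~R * t) (m%:~R : R).
    have := @is_deriveZ _ _ _ id (m%:~R : R) t 1 1 (is_derive_id t 1).
    by rewrite [_ *: 1]mulr1.
  have := is_derive1_comp (is_derive_sin _) h.
  move=> /(@is_deriveZ _ _ _ _ (m%:~R^-1 : R) t 1 _) hh.
  by apply: is_derive_eq hh _; rewrite [LHS]mulrC -mulrA divff// mulr1.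
rewrite (J_ftc _ dF); last exact: continuous_cos_mul.
by rewrite sin_2pi_int !mulr0 sin0 mulr0 subrr.
Qed.

Lemma J_sin (m : int) : J (fun t => sin (m%:~R * t)) = 0.
Proof.
have [->|m0] := eqVneq m 0.
  rewrite (_ : (fun _ => _) = fun=> 0) ?J_cst ?mulr0//.
  by apply/funext => t; rewrite mul0r sin0.
have mr0 : m%:~R != 0 :> R by rewrite intr_eq0.
have dF t : is_derive t (1 : R) (fun t : R => - m%:~R^-1 * cos (m%:~R * t)) (sin (m%:~R * t)).
  have h : is_derive t (1 : R) (fun t : R => m%:~R * t) (m%:~R : R).
    have := @is_deriveZ _ _ _ id (m%:~R : R) t 1 1 (is_derive_id t 1).
    by rewrite [_ *: 1]mulr1.
  have := is_derive1_comp (is_derive_cos _) h.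
  move=> /(@is_deriveZ _ _ _ _ (- m%:~R^-1 : R) t 1 _) hh.
  by apply: is_derive_eq hh _; rewrite -[LHS]/(- m%:~R^-1 * (- sin (m%:~R * t) * m%:~R)); field.
rewrite (J_ftc _ dF); last exact: continuous_sin_mul.
by rewrite cos_2pi_int mulr0 cos0 subrr.
Qed.

End Trigonometric.

Section FourierSums.
Context {R : realType} {n : nat}.
Local Notation mu := (@lebesgue_measure R).
Local Notation D := (`[(0 : R), 2 * pi]%classic).
Implicit Types (c d : int -> Cn R n) (s : seq int) (z w : Cn R n).

Lemma cdot_Jst z w : (cdot (Jst z) (Jst w) = cdot z w) *
  (cdot z (Jst w) = - cdot (Jst z) w).
Proof.
split; rewrite /cdot; first by apply: eq_bigr => k _; rewrite !mxE; ring.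
by rewrite -sumrN; apply: eq_bigr => k _; rewrite !mxE; ring.
Qed.

Lemma cdot_crot (a b : R) z w : cdot (crot a z) (crot b w) =
  cos (a - b) * cdot z w + sin (a - b) * cdot (Jst z) w.
Proof.
rewrite /crot !cdotD !cdotDr !cdotZ !cdotZr !cdot_Jst cosB sinB; ring.
Qed.

Lemma cdot_crot_int (m k : int) z w (t : R) :
  cdot (crot (m%:~R * t) z) (crot (k%:~R * t) w) =
  cdot z w * cos ((m - k)%:~R * t) + cdot (Jst z) w * sin ((m - k)%:~R * t).
Proof. by rewrite cdot_crot rmorphB /= mulrBl; ring. Qed.

Lemma continuous_cdot_crot (m k : int) z w :
  continuous (fun t : R => cdot (crot (m%:~R * t) z) (crot (k%:~R * t) w)).
Proof.
under eq_fun do rewrite cdot_crot_int.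
move=> t; apply: cvgD; apply: cvgM; try exact: cvg_cst.
  exact: continuous_cos_mul.
exact: continuous_sin_mul.
Qed.

Lemma J_cdot_crot (m k : int) z w :
  J (fun t : R => cdot (crot (m%:~R * t) z) (crot (k%:~R * t) w)) =
  if m == k then 2 * pi * cdot z w else 0.
Proof.
have cC a (l : int) : continuous (fun t : R => a * cos (l%:~R * t)).
  by move=> t; apply: cvgM; [exact: cvg_cst|exact: continuous_cos_mul].
have cS a (l : int) : continuous (fun t : R => a * sin (l%:~R * t)).
  by move=> t; apply: cvgM; [exact: cvg_cst|exact: continuous_sin_mul].
under [J _]eq_Rintegral do rewrite cdot_crot_int.
rewrite [LHS](JD (cC _ _) (cS _ _)) !JZ; last 2 first.
- exact: continuous_sin_mul.
- exact: continuous_cos_mul.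
rewrite J_sin mulr0 addr0; case: eqP => [->|/eqP mk]; last first.
  by rewrite J_cos ?mulr0// subr_eq0.
rewrite subrr (_ : (fun t => cos _) = fun=> 1) ?J_cst; first by ring.
by apply/funext => t; rewrite mul0r cos0.
Qed.

Definition trig_sum s c (t : R) : Cn R n := \sum_(m <- s) crot (m%:~R * t) (c m).

Lemma cdot_trig_sum (k : int) w s c :
  continuous (fun t : R => cdot (crot (k%:~R * t) w) (trig_sum s c t)) /\
  (k \notin s -> J (fun t : R => cdot (crot (k%:~R * t) w) (trig_sum s c t)) = 0).
Proof.
elim: s => [|m s [cs Js]].
  have -> : (fun t => cdot (crot (k%:~R * t) w) (trig_sum [::] c t)) = fun=> 0.
    by apply/funext => t; rewrite /trig_sum big_nil cdotC cdot0l.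
  by split; [move=> t; exact: cvg_cst|rewrite J_cst mulr0].
have e : (fun t => cdot (crot (k%:~R * t) w) (trig_sum (m :: s) c t)) =
    (fun t => cdot (crot (k%:~R * t) w) (crot (m%:~R * t) (c m)) +
              cdot (crot (k%:~R * t) w) (trig_sum s c t)).
  by apply/funext => t; rewrite /trig_sum big_cons cdotDr.
rewrite e; split.
  by move=> t; apply: cvgD; [exact: continuous_cdot_crot|exact: cs].
rewrite inE negb_or => /andP[km ks].
by rewrite (JD (@continuous_cdot_crot _ _ _ _) cs) J_cdot_crot (negbTE km) add0r Js.
Qed.

Lemma csq_trig_sum s c :
  continuous (fun t : R => csq (trig_sum s c t)) /\
  (uniq s -> J (fun t : R => csq (trig_sum s c t)) = 2 * pi * \sum_(m <- s) csq (c m)).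
Proof.
elim: s => [|m s [cs Js]].
  have -> : (fun t => csq (trig_sum [::] c t)) = fun=> 0.
    by apply/funext => t; rewrite /trig_sum big_nil csqE cdot0l.
  by split; [move=> t; exact: cvg_cst|rewrite J_cst !mulr0 big_nil mulr0].
have e : (fun t => csq (trig_sum (m :: s) c t)) =
    (fun t => (cdot (crot (m%:~R * t) (c m)) (crot (m%:~R * t) (c m)) +
      2 * cdot (crot (m%:~R * t) (c m)) (trig_sum s c t)) + csq (trig_sum s c t)).
  by apply/funext => t; rewrite /trig_sum big_cons csqD.
have [c2 J2] := cdot_trig_sum m (c m) s c.
have c2' : continuous (fun t : R => 2 * cdot (crot (m%:~R * t) (c m)) (trig_sum s c t)).
  by move=> t; apply: cvgM; [exact: cvg_cst|exact: c2].
have c1 := @continuous_cdot_crot m m (c m) (c m).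
have c12 : continuous (fun t : R => cdot (crot (m%:~R * t) (c m)) (crot (m%:~R * t) (c m)) +
      2 * cdot (crot (m%:~R * t) (c m)) (trig_sum s c t)).
  by move=> t; apply: cvgD; [exact: c1|exact: c2'].
rewrite e; split; first by move=> t; apply: cvgD; [exact: c12|exact: cs].
move=> /= /andP[ms us]; rewrite (JD c12 cs) (JD c1 c2') (JZ _ c2) J2// Js//.
by rewrite mulr0 addr0 J_cdot_crot eqxx big_cons [RHS]mulrDr csqE.
Qed.

Lemma trig_sum_measurable s c : Cn_measurable D (trig_sum s c).
Proof.
move=> k; elim: s => [|m s [m1 m2]].
  split; [rewrite (_ : (fun t => _) = fun=> 0)|rewrite (_ : (fun t => _) = fun=> 0)];
    try exact: measurable_cst; by apply/funext => t; rewrite /trig_sum big_nil mxE.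
have mc (a b : R) : measurable_fun D (fun t : R => cos (m%:~R * t) * a + sin (m%:~R * t) * b).
  apply: measurable_funTS; apply: continuous_measurable_fun => t.
  apply: cvgD; apply: cvgM; try exact: cvg_cst.
    exact: continuous_cos_mul.
  exact: continuous_sin_mul.
split.
  rewrite (_ : (fun t => _) = (fun t => cos (m%:~R * t) * (c m).1 ord0 k +
    sin (m%:~R * t) * (Jst (c m)).1 ord0 k + (trig_sum s c t).1 ord0 k)).
    by apply: measurable_funD.
  by apply/funext => t; rewrite /trig_sum big_cons !mxE.
rewrite (_ : (fun t => _) = (fun t => cos (m%:~R * t) * (c m).2 ord0 k +
  sin (m%:~R * t) * (Jst (c m)).2 ord0 k + (trig_sum s c t).2 ord0 k)).
  by apply: measurable_funD.
by apply/funext => t; rewrite /trig_sum big_cons !mxE.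
Qed.

Definition freqs (N : nat) : seq int :=
  [seq Posz k | k <- iota 0 N.+1] ++ [seq Negz k | k <- iota 0 N].

Lemma freqs_uniq N : uniq (freqs N).
Proof.
rewrite cat_uniq !map_inj_uniq ?iota_uniq//=; last 2 first.
- by move=> a b [].
- by move=> a b [].
rewrite andbT; apply/hasPn => _ /mapP[k _ ->] /=.
by apply/negP => /orP[//|/mapP[]].
Qed.

Lemma symsum_freqs (V : nmodType) (f : int -> V) N :
  symsum f N = \sum_(m <- freqs N) f m.
Proof.
have h (g : nat -> V) M : \sum_(k < M) g k = \sum_(j <- iota 0 M) g j.
  by rewrite -(big_mkord xpredT) /index_iota subn0.
by rewrite /symsum (h (fun k => f k%:Z)) (h (fun k => f (Negz k))) big_cat !big_map.
Qed.

Lemma fourier_sumE c N : fourier_sum c N = trig_sum (freqs N) c.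
Proof. by apply/funext => t; rewrite /fourier_sum symsum_freqs. Qed.

Definition L2sq (g : R -> Cn R n) : \bar R := (\int[mu]_(t in D) (csq (g t))%:E)%E.

Lemma L2sq_fourier c N : L2sq (fourier_sum c N) = (2 * pi * sob_part 0 c c N)%:E.
Proof.
have [cc Jc] := csq_trig_sum (freqs N) c.
rewrite /L2sq fourier_sumE (J_E cc) Jc ?freqs_uniq//; congr (_ * _)%:E.
rewrite /sob_part symsum_freqs; apply: eq_bigr => m _.
by rewrite /sobw expn0; case: ifP => _; rewrite mul1r.
Qed.

Lemma crotB (a : R) z w : crot a (z - w) = crot a z - crot a w.
Proof.
have JB : Jst (z - w) = Jst z - Jst w.
  by rewrite /Jst /= opprD; congr pair.
by rewrite /crot JB !scalerBr addrACA -opprD.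
Qed.

Lemma fourier_sumB c d N t :
  fourier_sum (c - d) N t = fourier_sum c N t - fourier_sum d N t.
Proof.
rewrite /fourier_sum !symsum_freqs -sumrB; apply: eq_bigr => m _.
exact: crotB.
Qed.

Lemma fourier_sum_trunc c M N t : (M <= N)%N ->
  fourier_sum (trunc_coef M c) N t = fourier_sum c M t.
Proof.
have fS (d : int -> Cn R n) K : fourier_sum d K.+1 t = fourier_sum d K t +
    (crot (K.+1%:~R * t) (d K.+1) + crot ((Negz K)%:~R * t) (d (Negz K))).
  by rewrite /fourier_sum /symsum big_ord_recr [X in _ + X = _]big_ord_recr /= addrACA.
have c0 a : crot a (0 : Cn R n) = 0 by have := crotB a 0 0; rewrite !subrr.
have same K : (K <= M)%N -> fourier_sum (trunc_coef M c) K t = fourier_sum c K t.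
  move=> KM; rewrite /fourier_sum /symsum; congr (_ + _); apply: eq_bigr => k _.
    by rewrite /trunc_coef absz_nat (leq_trans _ KM)// -ltnS.
  by rewrite /trunc_coef NegzE abszN absz_nat (leq_trans (ltn_ord k) KM).
move=> MN; rewrite -(subnKC MN); elim: (N - M)%N => [|k IH]; first by rewrite addn0 same.
rewrite addnS fS IH /trunc_coef NegzE abszN !absz_nat.
by rewrite ltnNge leq_addr /= !c0 !addr0.
Qed.

Lemma L2sq_fourier_diff (x : Bhalf R n) M N : (M <= N)%N ->
  (L2sq (fun t => fourier_sum x N t - fourier_sum x M t)%R <=
   (2 * pi * (M.+1%:R^-1 * `|x| ^+ 2))%:E)%E.
Proof.
move=> MN.
have -> : (fun t => fourier_sum x N t - fourier_sum x M t) =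
    fourier_sum (fcoef x - trunc_coef M x) N.
  by apply/funext => t; rewrite fourier_sumB fourier_sum_trunc.
rewrite L2sq_fourier lee_fin ler_wpM2l ?(ltW twopi_gt0)//.
have := sob_part_sub_trunc (sincl (leq0n 1) x) M N; rewrite (minn_idPr MN) => /= ->.
rewrite lerBlDl; apply: le_trans (sob_part_tail x M N (ltn0Sn 0)) _.
by rewrite lerD2l ler_wpM2l// sob_part_le_norm.
Qed.

Lemma L2sqD_le (g h : R -> Cn R n) : Cn_measurable D g -> Cn_measurable D h ->
  (L2sq (fun t => g t - h t)%R <= 2%:E * (L2sq g + L2sq h))%E.
Proof.
move=> mg mh; have mD : measurable (D : set R) by exact: measurable_D.
have c0 (k : R -> Cn R n) t : (0 <= (csq (k t))%:E)%E by rewrite lee_fin csq_ge0.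
have mc (k : R -> Cn R n) : Cn_measurable D k ->
    measurable_fun D (fun t => (csq (k t))%:E : \bar R).
  by move=> mk; apply/measurable_EFinP; exact: Cn_measurable_csq.
rewrite -ge0_integralD//; try exact: mc.
rewrite -ge0_integralZl//; last 2 first.
- by apply: emeasurable_funD; exact: mc.
- by move=> t _; rewrite adde_ge0.
apply: ge0_le_integral => //.
- by move=> t _; rewrite lee_fin csq_ge0.
- by apply: (mc (fun t => g t - h t)); exact: Cn_measurableB.
- by apply: emeasurable_funM; [exact: measurable_cst|apply: emeasurable_funD; exact: mc].
- move=> t _; rewrite -EFinD -EFinM lee_fin; apply: le_trans (csqD_le _ _) _.
  by rewrite csqN.
Qed.

End FourierSums.

Section RieszFischer.
Context {R : realType} {n : nat}.
Local Notation mu := (@lebesgue_measure R).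
Local Notation D := (`[(0 : R), 2 * pi]%classic).
Implicit Types x y : Bhalf R n.

Lemma fourier_sum_measurable c N : Cn_measurable D (fourier_sum c N : R -> Cn R n).
Proof. by rewrite fourier_sumE; exact: trig_sum_measurable. Qed.

Lemma L2sq_ge0 (g : R -> Cn R n) : (0 <= L2sq g)%E.
Proof. by apply: integral_ge0 => t _; rewrite lee_fin csq_ge0. Qed.

Lemma Cn_coordB1 (z w : Cn R n) k : (z - w).1 ord0 k = z.1 ord0 k - w.1 ord0 k.
Proof. by rewrite !mxE. Qed.

Lemma Cn_coordB2 (z w : Cn R n) k : (z - w).2 ord0 k = z.2 ord0 k - w.2 ord0 k.
Proof. by rewrite !mxE. Qed.

Lemma Cn_measurableN (g : R -> Cn R n) :
  Cn_measurable D g -> Cn_measurable D (fun t => - g t).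
Proof.
move=> mg; have m0 : Cn_measurable D (fun _ : R => 0 : Cn R n).
  by move=> k; split; exact: measurable_cst.
have -> : (fun t => - g t) = (fun t => 0 - g t) by apply/funext => t; rewrite sub0r.
exact: Cn_measurableB.
Qed.

Lemma bounded_increments_cvg (a b : R^nat) (M : R) :
  (forall k, `|a k.+1 - a k| <= b k) -> (forall K, \sum_(k < K) b k <= M) ->
  cvgn a.
Proof.
move=> ab bM; have b0 k : 0 <= b k by apply: le_trans (ab k).
have ct : cvgn (series (telescope a)).
  apply: normed_cvg; apply: nondecreasing_is_cvgn.
    by apply/nondecreasing_seqP => K; rewrite /normed_series_of !seriesEord /= big_ord_recr /= lerDl.
  exists M => _ [K _ <-]; apply: le_trans (bM K); rewrite /normed_series_of seriesEord /=.
  by apply: ler_sum => k _; exact: ab.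
have -> : a = (fun k => a 0%N + series (telescope a) k).
  by apply/funext => k; exact: eq_sum_telescope.
by apply: is_cvgD => //; exact: is_cvg_cst.
Qed.

Lemma geometric_half_sum K : \sum_(k < K) (2^-1 ^+ k : R) <= 2.
Proof.
suff -> : \sum_(k < K) (2^-1 ^+ k : R) = 2 - 2 * 2^-1 ^+ K.
  by rewrite gerBl mulr_ge0// exprn_ge0// invr_ge0.
elim: K => [|K IH]; first by rewrite big_ord0 expr0 mulr1 subrr.
by rewrite big_ord_recr /= IH exprS; field.
Qed.

(* Along the frequencies 4^k the squared increments d_k have integral
   O(4^-k), so that sum_k 2^k d_k is finite almost everywhere; there
   2 sqrt(d_k) <= 2^-k + 2^k d_k makes the partial sums converge. *)
Lemma is_loop_exists x : exists g, is_loop x g.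
Proof.
have mD : measurable (D : set R) by exact: measurable_D.
pose u k := fourier_sum x (4 ^ k).
pose d k t := csq (u k.+1 t - u k t).
have mu_ k : Cn_measurable D (u k) by exact: fourier_sum_measurable.
have md k : measurable_fun D (d k).
  by apply: Cn_measurable_csq => //; exact: Cn_measurableB.
have d0 k t : 0 <= d k t by exact: csq_ge0.
pose A := 2 * pi * `|x| ^+ 2.
have A0 : 0 <= A by rewrite mulr_ge0 ?sqr_ge0// ltW// twopi_gt0.
have Id k : (\int[mu]_(t in D) (2 ^+ k * d k t)%:E <= (A * 2^-1 ^+ k)%:E)%E.
  under eq_integral do rewrite EFinM.
  rewrite ge0_integralZl//; last 2 first.
  - by apply/measurable_EFinP; exact: md.
  - by move=> t _; rewrite lee_fin.
  apply: (@le_trans _ _ ((2 ^+ k)%:E * (2 * pi * ((4 ^ k).+1%:R^-1 * `|x| ^+ 2))%:E)%E).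
    apply: lee_wpmul2l; first by rewrite lee_fin exprn_ge0.
    by apply: L2sq_fourier_diff; rewrite leq_pexp2l.
  rewrite -EFinM lee_fin.
  have h4 : (4 ^ k).+1%:R^-1 <= (4^-1 ^+ k : R).
    by rewrite exprVn lef_pV2 ?posrE ?ltr0n ?exprn_gt0// -natrX ler_nat.
  apply: (@le_trans _ _ (2 ^+ k * (2 * pi * (4^-1 ^+ k * `|x| ^+ 2)))).
    by rewrite !ler_wpM2l ?ler_wpM2r ?sqr_ge0// ltW// twopi_gt0.
  have -> : (4^-1 ^+ k : R) = 2^-1 ^+ k * 2^-1 ^+ k.
    by rewrite -exprMn; congr (_ ^+ _); field.
  rewrite [leLHS](_ : _ = A * 2^-1 ^+ k * (2 ^+ k * 2^-1 ^+ k)); last by rewrite /A; ring.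
  by rewrite -exprMn divff// expr1n mulr1.
pose G t := (\sum_(0 <= k <oo) (2 ^+ k * d k t)%:E)%E.
have G0 k t : (0 <= (2 ^+ k * d k t)%:E)%E by rewrite lee_fin mulr_ge0// exprn_ge0.
have mG k : measurable_fun D (fun t => (2 ^+ k * d k t)%:E).
  by apply/measurable_EFinP; apply: measurable_funM.
have IG : mu.-integrable D G.
  apply/integrableP; split; first by apply: (@ge0_emeasurable_sum _ _ _ _ _ xpredT) => [k t _ _|k _]; [exact: G0|exact: mG].
  under eq_integral do rewrite gee0_abs ?nneseries_ge0//.
  rewrite integral_nneseries//.
  apply: (@le_lt_trans _ _ (A * 2)%:E); last exact: ltry.
  apply: lime_le.
    by apply: is_cvg_nneseries => k _ _; apply: integral_ge0.
  apply: nearW => K; rewrite big_mkord.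
  apply: (@le_trans _ _ (\sum_(k < K) (A * 2^-1 ^+ k)%:E)%E); first exact: lee_sum.
  by rewrite sumEFin lee_fin -mulr_sumr ler_wpM2l// geometric_half_sum.
have [N0 [mN0 muN0 GN0]] := @integrable_ae _ _ R mu D mD G IG.
pose E := D `\` N0.
have mE : measurable (E : set R) by exact: measurableD.
have inc k t (i : 'I_n) : (`|(u k.+1 t).1 ord0 i - (u k t).1 ord0 i| <= 2^-1 ^+ k + 2 ^+ k * d k t)
    /\ (`|(u k.+1 t).2 ord0 i - (u k t).2 ord0 i| <= 2^-1 ^+ k + 2 ^+ k * d k t).
  have [h1 h2] := cdot_coord_le (u k.+1 t - u k t) i.
  have aux (z : R) : z ^+ 2 <= d k t -> `|z| <= 2^-1 ^+ k + 2 ^+ k * d k t.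
    move=> zd; have p0 : 0 < 2 ^+ k :> R by rewrite exprn_gt0.
    rewrite exprVn; set p : R := 2 ^+ k in p0 *.
    apply: (@le_trans _ _ (p^-1 + p * z ^+ 2)); last first.
      by rewrite lerD2l ler_wpM2l// ltW.
    suff h (w : R) : w <= p^-1 + p * w ^+ 2 by rewrite -real_normK ?num_real.
    have -> : p^-1 + p * w ^+ 2 = w + ((p * w - 1/2) ^+ 2 + 3/4) / p.
      by field; rewrite gt_eqF.
    by rewrite lerDl divr_ge0 ?addr_ge0 ?sqr_ge0 ?divr_ge0// ltW.
  by split; apply: aux; [move: h1|move: h2]; rewrite ?Cn_coordB1 ?Cn_coordB2.
have cvgE t : E t -> forall i : 'I_n, cvgn (fun k => (u k t).1 ord0 i) /\
    cvgn (fun k => (u k t).2 ord0 i).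
  move=> [Dt nN0t] i.
  have Gfin : G t \is a fin_num.
    by apply: contrapT => h; apply: nN0t; apply: GN0 => /= /(_ Dt).
  have bnd K : \sum_(k < K) (2^-1 ^+ k + 2 ^+ k * d k t) <= 2 + fine (G t).
    rewrite big_split /= lerD ?geometric_half_sum//.
    rewrite -lee_fin fineK// -sumEFin -(big_mkord xpredT (fun k => (2 ^+ k * d k t)%:E)).
    exact: nneseries_lim_ge.
  split.
    apply: (@bounded_increments_cvg _ (fun k => 2^-1 ^+ k + 2 ^+ k * d k t) _ _ bnd) => k.
    by have [h _] := inc k t i; exact: h.
  apply: (@bounded_increments_cvg _ (fun k => 2^-1 ^+ k + 2 ^+ k * d k t) _ _ bnd) => k.
  by have [_ h] := inc k t i; exact: h.
pose g t : Cn R n := if t \in E then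
  (\row_i limn (fun k => (u k t).1 ord0 i), \row_i limn (fun k => (u k t).2 ord0 i))
  else 0.
have glim t (i : 'I_n) : E t ->
    ((fun k => (u k t).1 ord0 i) @ \oo --> (g t).1 ord0 i) /\
    ((fun k => (u k t).2 ord0 i) @ \oo --> (g t).2 ord0 i).
  move=> Et; have [c1 c2] := cvgE t Et i.
  by rewrite /g (mem_set Et) !mxE; split; [exact: c1|exact: c2].
have gout t (i : 'I_n) : t \notin E -> (g t).1 ord0 i = 0 /\ (g t).2 ord0 i = 0.
  by move=> /negbTE tE; rewrite /g tE !mxE.
have cut (a : nat -> R -> R) (b : R -> R) : (forall k, measurable_fun D (a k)) ->
    (forall t, E t -> (fun k => a k t) @ \oo --> b t) ->
    (forall t, t \notin E -> b t = 0) -> measurable_fun D b.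
  move=> ma ab b0; have m1 : measurable_fun D (\1_E : R -> R) by exact: measurable_indic.
  apply: (@measurable_realfun.measurable_fun_cvg _ _ R D (fun k t => \1_E t * a k t)).
    by move=> k; apply: measurable_funM => //; exact: ma.
  move=> t Dt; rewrite indicE; case: (boolP (t \in E)) => tE.
    by under eq_fun do rewrite mul1r; exact: ab (set_mem tE).
  by under eq_fun do rewrite mul0r; rewrite (b0 _ tE); exact: cvg_cst.
have mg : Cn_measurable D g.
  move=> i; split.
    apply: (cut (fun k t => (u k t).1 ord0 i)).
    - by move=> k; have [] := mu_ k i.
    - by move=> t Et; have [] := glim t i Et.
    - by move=> t tE; have [] := gout t i tE.
  apply: (cut (fun k t => (u k t).2 ord0 i)).
  - by move=> k; have [] := mu_ k i.
  - by move=> t Et; have [] := glim t i Et.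
  - by move=> t tE; have [] := gout t i tE.
exists g; split=> //.
have key N : (L2sq (fun t => g t - fourier_sum x N t)%R <= (A * N.+1%:R^-1)%:E)%E.
  have mgN : Cn_measurable D (fun t => g t - fourier_sum x N t).
    by apply: Cn_measurableB => //; exact: fourier_sum_measurable.
  rewrite /L2sq (ge0_negligible_integral mN0)//; last 2 first.
  - by apply/measurable_EFinP; exact: Cn_measurable_csq.
  - by move=> t _; rewrite lee_fin csq_ge0.
  pose f k t := (csq (u (k + N)%N t - fourier_sum x N t))%:E : \bar R.
  have mf k : measurable_fun D (f k).
    apply/measurable_EFinP; apply: Cn_measurable_csq => //.
    by apply: Cn_measurableB; [exact: mu_|exact: fourier_sum_measurable].
  have f0 k t : (0 <= f k t)%E by rewrite lee_fin csq_ge0.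
  have ED : E `<=` D by move=> t [].
  have -> : (\int[mu]_(t in D `\` N0) (csq (g t - fourier_sum x N t)%R)%:E =
      \int[mu]_(t in E) limn_einf (f^~ t))%E.
    apply: eq_integral => t tE; apply/esym.
    suff h : f k t @[k --> \oo] --> (csq (g t - fourier_sum x N t))%:E.
      by have [->] := cvg_limn_einf_sup h.
    apply: cvg_EFin; first by apply: nearW.
    apply: cdot_cvg => i; have [l1 l2] := glim t i (set_mem tE).
      under eq_fun do rewrite Cn_coordB1; rewrite Cn_coordB1; apply: cvgB; last exact: cvg_cst.
      exact: (cvg_comp (addn^~ N) _ (cvg_addnr N) l1).
    under eq_fun do rewrite Cn_coordB2; rewrite Cn_coordB2; apply: cvgB; last exact: cvg_cst.
    exact: (cvg_comp (addn^~ N) _ (cvg_addnr N) l2).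
  apply: le_trans (fatou mu mE _ _) _.
  - by move=> k; exact: measurable_funS (mf k).
  - by move=> k t _.
  rewrite limn_einf_lim; apply: lime_le; first exact: is_cvg_einfs.
  apply: nearW => k; apply: (@le_trans _ _ (\int[mu]_(t in E) f k t)%E).
    by apply: ereal_inf_lbound; exists k => /=.
  apply: (@le_trans _ _ (\int[mu]_(t in D) f k t)%E).
    by apply: ge0_subset_integral => //; exact: mf.
  have Nk : (N <= 4 ^ (k + N))%N.
    by apply: leq_trans (leq_addl k N) _; apply: ltnW; exact: ltn_expl.
  apply: le_trans (L2sq_fourier_diff x Nk) _.
  by rewrite lee_fin /A -[leRHS]mulrA (mulrC (`|x| ^+ 2)).
apply: (@squeeze_cvge _ _ _ _ (cst 0%E) _ (fun N => (A * N.+1%:R^-1)%:E)).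
- by apply: nearW => N; rewrite L2sq_ge0 key.
- exact: cvg_cst.
- apply: cvg_EFin; first exact: nearW.
  rewrite -[X in _ --> X](mulr0 A); apply: cvgM; first exact: cvg_cst.
  exact: cvg_harmonic.
Qed.

Lemma loopP x : is_loop x (loop x).
Proof. exact: (@xgetPex _ (cst 0) [set g | is_loop x g] (is_loop_exists x)). Qed.

Lemma loop_measurable x : Cn_measurable D (loop x).
Proof. by have [] := loopP x. Qed.

Lemma loop_fourier x (e : R) : 0 < e ->
  exists N0, forall N, (N0 <= N)%N ->
  (L2sq (fun t => loop x t - fourier_sum x N t)%R <= e%:E)%E.
Proof.
move=> e0; have [_ /fine_cvgP[hf /cvgr0Pnorm_le/(_ _ e0) h]] := loopP x.
have [N0 _ hN] := filterI hf h; exists N0 => N /hN[fin /=].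
by move=> /(le_trans (ler_norm _)) h'; rewrite /L2sq -(fineK fin) lee_fin.
Qed.

Lemma L2sq_loop_le x : (L2sq (loop x) <= (4 * pi * `|sincl (leq0n 1) x| ^+ 2)%:E)%E.
Proof.
apply/lee_addgt0Pr => e e0; have e2 : 0 < e / 2 by rewrite divr_gt0.
have [N /(_ N (leqnn N)) hN] := loop_fourier x e2.
have -> : loop x = (fun t => (loop x t - fourier_sum x N t) - (- fourier_sum x N t)).
  by apply/funext => t; rewrite opprK subrK.
apply: le_trans (L2sqD_le _ _) _.
- by apply: Cn_measurableB; [exact: loop_measurable|exact: fourier_sum_measurable].
- by apply: Cn_measurableN; exact: fourier_sum_measurable.
have -> : L2sq (fun t => - fourier_sum x N t) = L2sq (fourier_sum x N).
  by apply: eq_integral => t _; rewrite csqN.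
rewrite L2sq_fourier.
apply: (@le_trans _ _ (2%:E * ((e / 2)%:E + (2 * pi * sob_part 0 x x N)%:E))%E).
  apply: lee_wpmul2l; first by rewrite lee_fin.
  by apply: leeD; [exact: hN|exact: lexx].
rewrite -!(EFinD, EFinM) lee_fin.
have := sob_part_le_norm (sincl (leq0n 1) x) N; set s := sob_part _ _ _ _.
set B := _ ^+ 2 => sB.
have : pi * s <= pi * B by rewrite ler_wpM2l// pi_ge0.
by rewrite -!(mulrA _ pi); set X := pi * s; set Y := pi * B => XY; lra.
Qed.

Lemma L2sq_loopB_le x y : (L2sq (fun t => loop x t - loop y t)%R <=
  (8 * pi * `|sincl (leq0n 1) (x - y)| ^+ 2)%:E)%E.
Proof.
apply/lee_addgt0Pr => e e0; have e2 : 0 < e / 6 by rewrite divr_gt0.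
have [N1 h1] := loop_fourier x e2; have [N2 h2] := loop_fourier y e2.
pose N := maxn N1 N2.
have {}h1 := h1 N (leq_maxl _ _); have {}h2 := h2 N (leq_maxr _ _).
have -> : (fun t => loop x t - loop y t) = (fun t => (loop x t - fourier_sum x N t) -
    ((loop y t - fourier_sum y N t) - fourier_sum (fcoef x - fcoef y) N t)).
  apply/funext => t; rewrite fourier_sumB (opprB (fourier_sum x N t)).
  by rewrite (addrA (_ - _)) subrK opprB addrA subrK.
have m1 : Cn_measurable D (fun t => loop x t - fourier_sum x N t).
  by apply: Cn_measurableB; [exact: loop_measurable|exact: fourier_sum_measurable].
have m2 : Cn_measurable D (fun t => loop y t - fourier_sum y N t).
  by apply: Cn_measurableB; [exact: loop_measurable|exact: fourier_sum_measurable].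
have m3 : Cn_measurable D (fourier_sum (fcoef x - fcoef y) N : R -> Cn R n).
  exact: fourier_sum_measurable.
have m23 := Cn_measurableB m2 m3.
apply: le_trans (L2sqD_le m1 m23) _.
have h23 := L2sqD_le m2 m3; rewrite L2sq_fourier in h23.
set s := sob_part _ _ _ _ in h23.
apply: (@le_trans _ _ (2%:E * ((e / 6)%:E + 2%:E * ((e / 6)%:E + (2 * pi * s)%:E)))%E).
  apply: lee_wpmul2l; first by rewrite lee_fin.
  apply: leeD; first exact: h1.
  apply: (le_trans h23); apply: lee_wpmul2l; first by rewrite lee_fin.
  by apply: leeD; [exact: h2|exact: lexx].
have := sob_part_le_norm (sincl (leq0n 1) (x - y)) N; rewrite -[X in X <= _]/s.
set B := _ ^+ 2 => sB.
rewrite -!(EFinD, EFinM) lee_fin.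
have : pi * s <= pi * B by rewrite ler_wpM2l// pi_ge0.
by rewrite -!(mulrA _ pi); set X := pi * s; set Y := pi * B => XY; lra.
Qed.

End RieszFischer.

Section Action.
Context {R : realType} {n : nat}.
Local Notation mu := (@lebesgue_measure R).
Local Notation D := (`[(0 : R), 2 * pi]%classic).
Local Notation B := (Bhalf R n).
Implicit Types (x y z w : B).

Definition l2norm x : R := `|sincl (leq0n 1) x|.

Lemma l2norm_ge0 x : 0 <= l2norm x. Proof. exact: normr_ge0. Qed.

Lemma l2norm_le x : l2norm x <= `|x|.
Proof. exact: (bounded_linear_sincl (leq0n 1)).2. Qed.

Lemma l2normD x y : l2norm (x + y) <= l2norm x + l2norm y.
Proof.
by rewrite /l2norm (linear_funD (bounded_linear_sincl (leq0n 1)).1.1) ler_normD.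
Qed.

Lemma integrable_csq_loop x : mu.-integrable D (fun t => (csq (loop x t))%:E).
Proof.
apply/integrableP; split.
  apply/measurable_EFinP; apply: Cn_measurable_csq; first exact: measurable_D.
  exact: loop_measurable.
under eq_integral do rewrite gee0_abs ?lee_fin ?csq_ge0//.
exact: le_lt_trans (L2sq_loop_le x) (ltry _).
Qed.

Lemma integrable_csq_loopB x y :
  mu.-integrable D (fun t => (csq (loop x t - loop y t))%:E).
Proof.
apply/integrableP; split.
  apply/measurable_EFinP; apply: Cn_measurable_csq; first exact: measurable_D.
  by apply: Cn_measurableB; exact: loop_measurable.
under eq_integral do rewrite gee0_abs ?lee_fin ?csq_ge0//.
exact: le_lt_trans (L2sq_loopB_le x y) (ltry _).
Qed.

Lemma integrable_cst_D (a : R) : mu.-integrable D (fun _ => a%:E).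
Proof. by apply: (@integrable_D R (fun _ => a)) => t; exact: cvg_cst. Qed.

Lemma J_csq_loop x : J (fun t => csq (loop x t)) <= 4 * pi * l2norm x ^+ 2.
Proof.
rewrite -lee_fin /J /Rintegral fineK; first exact: L2sq_loop_le.
by apply: integrable_fin_num; [exact: measurable_D|exact: integrable_csq_loop].
Qed.

Lemma J_csq_loopB x y :
  J (fun t => csq (loop x t - loop y t)) <= 8 * pi * l2norm (x - y) ^+ 2.
Proof.
rewrite -lee_fin /J /Rintegral fineK; first exact: L2sq_loopB_le.
by apply: integrable_fin_num; [exact: measurable_D|exact: integrable_csq_loopB].
Qed.

Variables (eps : R) (H : Cn R n -> R).
Hypothesis HH : is_hamiltonian eps H.

Let cH : continuous H.
Proof.
by move=> z; have [/(_ 0%N) h _ _] := HH; exact: (h z).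
Qed.

Definition ham_integral x : R := \int[mu]_(t in D) H (loop x t).

Lemma integrable_ham_loop x : mu.-integrable D (fun t => (H (loop x t))%:E).
Proof.
have [C C0 HC] := hamiltonian_am_gm HH.
have H0 : H 0 = 0 by have [_ /nbhs_singleton h _] := HH.
have mD : (R.-ocitv.-measurable).-sigma.-measurable D by exact: measurable_D.
have ib : mu.-integrable D (fun t => (C%:E * (1%:E + 2%:E * (csq (loop x t))%:E))%E).
  apply: integrableZl => //; apply: integrableD => //; first exact: integrable_cst_D.
  by apply: integrableZl => //; exact: integrable_csq_loop.
apply: (le_integrable mD _ _ ib).
  apply/measurable_EFinP; apply: measurable_fun_Cn => //.
  exact: loop_measurable.
move=> t _; rewrite -!(EFinM, EFinD) /= lee_fin; apply: le_trans (ler_norm _).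
have := HC 1 (loop x t) 0 ltr01; rewrite H0 !subr0 /csq cdot0l => /le_trans; apply.
by rewrite ler_wpM2l//; set s := cdot _ _; lra.
Qed.

Lemma ham_integral_lipschitz : exists2 C : R, 0 <= C & forall x y,
  `|ham_integral x - ham_integral y| <= C * (1 + l2norm x + l2norm y) * l2norm (x - y).
Proof.
have [C C0 HC] := hamiltonian_am_gm HH.
have pi0 : 0 <= pi :> R by exact: pi_ge0.
exists (16 * pi * C); first by rewrite !mulr_ge0.
move=> x y; set a := l2norm x; set b := l2norm y; set d := l2norm (x - y).
have a0 : 0 <= a := l2norm_ge0 x; have b0 : 0 <= b := l2norm_ge0 y.
have d0 : 0 <= d := l2norm_ge0 (x - y).
have mD : (R.-ocitv.-measurable).-sigma.-measurable D by exact: measurable_D.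
have key (t : R) : 0 < t -> `|ham_integral x - ham_integral y| <=
    8 * pi * C * (t * (1 + a ^+ 2 + b ^+ 2) + d ^+ 2 / t).
  move=> t0; rewrite /ham_integral -RintegralB//; try exact: integrable_ham_loop.
  have iB : mu.-integrable D (EFin \o (fun u => H (loop x u) - H (loop y u))).
    exact: (integrableB mD (integrable_ham_loop x) (integrable_ham_loop y)).
  apply: le_trans (le_normr_Rintegral mD iB) _.
  have ix := integrable_csq_loop x; have iy := integrable_csq_loop y.
  have ixy := integrable_csq_loopB x y; have i1 := integrable_cst_D 1.
  have i2 : mu.-integrable D (EFin \o (fun u => 1 + csq (loop x u))).
    exact: (integrableD mD i1 ix).
  have i3 : mu.-integrable D (EFin \o (fun u => 1 + csq (loop x u) + csq (loop y u))).
    exact: (integrableD mD i2 iy).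
  have i4 : mu.-integrable D (EFin \o (fun u => t * (1 + csq (loop x u) + csq (loop y u)))).
    exact: (integrableZl mD t i3).
  have i5 : mu.-integrable D (EFin \o (fun u => t^-1 * csq (loop x u - loop y u))).
    exact: (integrableZl mD t^-1 ixy).
  have i6 : mu.-integrable D (EFin \o (fun u => t * (1 + csq (loop x u) + csq (loop y u))
      + t^-1 * csq (loop x u - loop y u))).
    exact: (integrableD mD i4 i5).
  have i7 : mu.-integrable D (EFin \o (fun u => C * (t * (1 + csq (loop x u) + csq (loop y u))
      + t^-1 * csq (loop x u - loop y u)))).
    exact: (integrableZl mD C i6).
  have bound (X Y Z : R) : X <= 4 * pi * a ^+ 2 -> Y <= 4 * pi * b ^+ 2 ->
      Z <= 8 * pi * d ^+ 2 -> C * (t * (2 * pi * 1 + X + Y) + t^-1 * Z) <=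
      8 * pi * C * (t * (1 + a ^+ 2 + b ^+ 2) + d ^+ 2 / t).
    move=> jx jy jd.
    rewrite [leRHS](_ : _ = C * (t * (8 * pi + 8 * pi * a ^+ 2 + 8 * pi * b ^+ 2)
        + t^-1 * (8 * pi * d ^+ 2))); last by ring.
    rewrite ler_wpM2l// lerD// ler_wpM2l ?invr_ge0 ?(ltW t0)//.
    have pa : 0 <= pi * a ^+ 2 by rewrite mulr_ge0 ?sqr_ge0.
    have pb : 0 <= pi * b ^+ 2 by rewrite mulr_ge0 ?sqr_ge0.
    move: jx jy pa pb; rewrite -!(mulrA _ pi); set A := pi * a ^+ 2.
    by set A' := pi * b ^+ 2; lra.
  apply: (@le_trans _ _ (\int[mu]_(u in D) (C * (t * (1 + csq (loop x u) + csq (loop y u))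
      + t^-1 * csq (loop x u - loop y u))))).
    apply: le_Rintegral => //; first exact: (integrable_norm iB).
    by move=> u _; rewrite (mulrC t^-1); exact: HC.
  rewrite (RintegralZl _ mD i6) (RintegralD mD i4 i5) (RintegralZl _ mD i3).
  rewrite (RintegralZl _ mD ixy) (RintegralD mD i2 iy) (RintegralD mD i1 ix).
  rewrite [X in X + _ + _](J_cst 1).
  have jx := J_csq_loop x; have jy := J_csq_loop y; have jd := J_csq_loopB x y.
  exact: bound jx jy jd.
have S0 : 0 < 1 + a + b by rewrite -addrA ltr_wpDr// addr_ge0.
apply/ler_addgt0Pr => e e0.
pose K := 8 * pi * C * (1 + a + b).
have K0 : 0 <= K by rewrite !mulr_ge0// ltW.
pose e1 : R := e / (K + 1).
have e10 : 0 < e1 by rewrite divr_gt0// ltr_wpDl.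
have de : 0 < d + e1 by rewrite ltr_wpDl.
apply: le_trans (key ((d + e1) / (1 + a + b)) _) _; first by rewrite divr_gt0.
apply: (@le_trans _ _ (K * (2 * d + e1))).
  rewrite /K -[leRHS]mulrA ler_wpM2l ?mulr_ge0//.
  have h1 : (d + e1) / (1 + a + b) * (1 + a ^+ 2 + b ^+ 2) <= (d + e1) * (1 + a + b).
    rewrite -mulrA ler_wpM2l ?(ltW de)// ler_pdivrMl// -expr2.
    by have := mulr_ge0 a0 b0; move=> ab; nra.
  have h2 : d ^+ 2 / ((d + e1) / (1 + a + b)) <= d * (1 + a + b).
    rewrite invf_div mulrA ler_pdivrMr// expr2 -!mulrA ler_wpM2l//.
    by rewrite mulrC ler_wpM2l ?(ltW S0)// lerDl ltW.
  apply: le_trans (lerD h1 h2) _.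
  by rewrite (_ : _ + _ * _ = (1 + a + b) * (2 * d + e1))//; ring.
rewrite mulrDr; apply: lerD.
  by rewrite [leLHS](_ : _ = 16 * pi * C * (1 + a + b) * d)// /K; ring.
by rewrite /e1 mulrC mulrAC ler_pdivrMr ?ltr_wpDl// ler_wpM2l ?(ltW e0)// lerDl.
Qed.


Let sgn_le1 (m : int) : `|(sgz m)%:~R : R| <= 1.
Proof. by case: sgzP; rewrite /= ?normr0 ?normr1 ?normrN ?normr1. Qed.

Definition sgnop : B -> B := fmul sgn_le1.

Lemma bounded_linear_sgnop : bounded_linear sgnop /\ forall x, `|sgnop x| <= `|x|.
Proof. exact: bounded_linear_fmul. Qed.

Lemma sip_sgnop x y : sip x (sgnop y) = sip y (sgnop x).
Proof.
apply: sip_uniq; have -> : sob_part 1 x (sgnop y) = sob_part 1 y (sgnop x).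
  apply/funext => N.
  rewrite /sob_part /symsum; congr (_ + _); apply: eq_bigr => k _;
    by rewrite /= !cdotZr (cdotC (y _)).
exact: sip_cvg.
Qed.

Lemma actionE x : action H x = pi * sip x (sgnop x) - ham_integral x.
Proof.
rewrite /action /ham_integral; congr (_ - _).
rewrite (mulrA 2^-1) (mulrA 2^-1 2) mulVf// mul1r; congr (pi * _).
apply: cvg_lim; first exact: Rhausdorff.
have e (m : int) : sobw R 1 m * cdot (x m) (sgnop x m) = cdot (mJd x m) (x m).
  rewrite mJdE cdotZ /= cdotZr mulrA; congr (_ * _).
  rewrite /sobw expn1; case: eqP => [->|_]; first by rewrite mulr0.
  rewrite natr_absz; have [m0|m0|->] := ltgtP m 0.
  - by rewrite ltr0_sgz// ltr0_norm// !mulrNz mulrN1 opprK.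
  - by rewrite gtr0_sgz// gtr0_norm// mulr1.
  - by rewrite normr0 mul0r.
suff -> : symsum (fun m => cdot (mJd x m) (x m)) = sob_part 1 x (sgnop x).
  exact: sip_cvg.
by apply/funext => N; rewrite /sob_part /symsum; congr (_ + _); apply: eq_bigr => k _;
  rewrite e.
Qed.

Lemma action_diff x w : action H (x + w) - action H x =
  pi * (2 * sip x (sgnop w) + sip w (sgnop w)) -
  (ham_integral (x + w) - ham_integral x).
Proof.
rewrite !actionE (linear_funD bounded_linear_sgnop.1.1) sipD !(sipC _ (_ + _)) !sipD.
rewrite (sipC (sgnop x) x) (sipC (sgnop w) x) (sipC (sgnop x) w) (sipC (sgnop w) w).
rewrite (sip_sgnop w x); move: (sip _ _) (sip _ _) (sip _ _) (ham_integral _) => a b c d.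
by move: (ham_integral _) => e; ring.
Qed.

Lemma action_diff_bound : exists2 C : R, 0 <= C & forall x w,
  `|action H (x + w) - action H x| <= C * (1 + `|x| + `|w|) * `|w|.
Proof.
have [C C0 HC] := ham_integral_lipschitz.
have pi0 : 0 <= pi :> R by exact: pi_ge0.
exists (2 * pi + 2 * C); first by rewrite addr_ge0// mulr_ge0.
move=> x w; rewrite action_diff; apply: le_trans (ler_normB _ _) _.
rewrite -[leRHS]mulrA [leRHS]mulrDl; apply: lerD.
  rewrite normrM ger0_norm// (mulrC 2 pi) -!mulrA ler_wpM2l//.
  apply: le_trans (ler_normD _ _) _; rewrite normrM ger0_norm//.
  have h1 : `|sip x (sgnop w)| <= `|x| * `|w|.
    apply: le_trans (sip_bound _ _) _; rewrite ler_wpM2l//.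
    exact: bounded_linear_sgnop.2.
  have h2 : `|sip w (sgnop w)| <= `|w| * `|w|.
    apply: le_trans (sip_bound _ _) _; rewrite ler_wpM2l//.
    exact: bounded_linear_sgnop.2.
  have aux (a b s t : R) : 0 <= a -> 0 <= b -> s <= a * b -> t <= b * b ->
      2 * s + t <= 2 * ((1 + a + b) * b).
    by move=> a0 b0 sa tb; nra.
  exact: aux.
apply: le_trans (HC _ _) _.
have -> : x + w - x = w by rewrite addrAC subrr add0r.
have h1 : l2norm (x + w) <= `|x| + `|w| := le_trans (l2norm_le _) (ler_normD _ _).
have h2 := l2norm_le x; have h3 := l2norm_le w.
rewrite [leRHS](_ : _ = C * ((1 + `|x| + `|w|) * 2) * `|w|); last first.
  have aux (c s t : R) : 2 * c * (s * t) = c * (s * 2) * t by ring.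
  exact: aux.
apply: ler_pM => //.
- by rewrite mulr_ge0// !addr_ge0 ?l2norm_ge0.
- exact: l2norm_ge0.
rewrite ler_wpM2l//.
have aux (a b s t : R) : 0 <= a -> 0 <= b -> s <= a + b -> t <= a ->
    1 + s + t <= (1 + a + b) * 2.
  by move=> *; lra.
exact: aux.
Qed.

Lemma ham_integral_cvg (T : Type) (F : set_system T) (s : T -> B) z (M : R) :
  Filter F -> (\forall a \near F, `|s a| <= M) ->
  l2norm (s a - z) @[a --> F] --> (0 : R) ->
  ham_integral (s a) @[a --> F] --> ham_integral z.
Proof.
move=> FF sM sz; have [C C0 HC] := ham_integral_lipschitz.
apply/cvgrPdist_le => e e0.
pose K := C * (1 + `|M| + l2norm z) + 1.
have K0 : 0 < K by rewrite ltr_wpDl// mulr_ge0// !addr_ge0 ?l2norm_ge0.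
have /cvgr0Pnorm_le /(_ _ (divr_gt0 e0 K0)) := sz.
apply: filterS2 sM => a sM h; rewrite distrC; apply: le_trans (HC _ _) _.
apply: (@le_trans _ _ (K * (e / K))); last by rewrite mulrC divfK ?gt_eqF.
apply: ler_pM.
- by rewrite mulr_ge0// !addr_ge0 ?l2norm_ge0.
- exact: l2norm_ge0.
- rewrite /K ler_wpDr// ler_wpM2l// lerD2r lerD2l.
  exact: le_trans (l2norm_le _) (le_trans sM (ler_norm _)).
- exact: le_trans (ler_norm _) h.
Qed.

Lemma weak_l2_cvg (T : Type) (F : set_system T) (s : T -> B) z (M : R) :
  Filter F -> (\forall a \near F, `|s a| <= M) ->
  (forall l : B -> R^o, bounded_linear l -> l (s a) @[a --> F] --> l z) ->
  l2norm (s a - z) @[a --> F] --> (0 : R).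
Proof.
move=> FF sM sz.
have : sincl (ltnW (ltn0Sn 0)) (s a) @[a --> F] --> sincl (ltnW (ltn0Sn 0)) z.
  apply: (sincl_cvg _ sM) => m; apply: cdot_cvg0 => k.
    exact: sz (bounded_linear_coord1 m k).
  exact: sz (bounded_linear_coord2 m k).
move=> /cvgrPdist_le h; apply/cvgr0Pnorm_le => e e0.
by apply: filterS (h e e0) => a; rewrite distrC /l2norm normr_id.
Qed.

End Action.

Lemma cvg0_leD {R : realType} (T : Type) (F : set_system T) (f g h : T -> R) :
  Filter F -> (forall a, 0 <= f a <= g a + h a) ->
  g a @[a --> F] --> 0 -> h a @[a --> F] --> 0 -> f a @[a --> F] --> 0.
Proof.
move=> FF fgh /cvgr0Pnorm_le g0 /cvgr0Pnorm_le h0; apply/cvgr0Pnorm_le => e e0.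
have e2 : 0 < e / 2 by lra.
apply: filterS2 (g0 _ e2) (h0 _ e2) => a; rewrite !ler_norml => /andP[_ ga] /andP[_ ha].
have /andP[f0 fa] := fgh a; apply/andP; split; lra.
Qed.

Lemma bounded_bilinear_cvg {R : realType} (E1 E2 G : normedModType R)
    (b : E1 -> E2 -> G) (T : Type) (F : set_system T) (f : T -> E1) (g : T -> E2)
    (x : E1) (y : E2) : bounded_bilinear b -> Filter F ->
  f a @[a --> F] --> x -> g a @[a --> F] --> y ->
  b (f a) (g a) @[a --> F] --> b x y.
Proof.
move=> bb FF fx gy.
have bc := differentiable_continuous (is_diff_differentiable
  (bounded_bilinear_is_diff (x, y) bb)).
exact: (@cvg_comp _ _ _ (fun a => (f a, g a)) (fun p : E1 * E2 => b p.1 p.2)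
  _ _ _ (cvg_pair fx gy) bc).
Qed.

(** * The action under a cut off perturbation *)

Section Cutoff.
Context {R : realType} (rho : R -> R).
Hypothesis Hrho : is_cutoff rho.

Lemma cutoff_continuous : continuous rho.
Proof. by move=> t; have [/(_ 0%N) h _ _ _] := Hrho; exact: (h t). Qed.

Lemma cutoff_gt0 t : 0 < rho t. Proof. by have [_ h _ _] := Hrho. Qed.

Lemma cutoff_far (s : R) : 0 <= s -> 2 < s ^+ 2 ->
  rho (s ^+ 2) = s ^-2 ^+ 2 /\ rho (s ^+ 2) * (1 + s) <= 2 * s ^- 2.
Proof.
move=> s0 s2; have [_ _ _ h] := Hrho.
have s1 : 1 <= s.
  by rewrite leNgt; apply/negP => s1; have := mulr_ilt1 s0 s0 s1 s1; rewrite -expr2; lra.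
have sp : 0 < s := lt_le_trans ltr01 s1.
have -> : rho (s ^+ 2) = s ^- 2 ^+ 2.
  by rewrite h ?ger0_norm ?sqr_ge0// div1r exprVn.
split=> //; rewrite expr2 -mulrA mulrC ler_wpM2r ?invr_ge0 ?sqr_ge0//.
rewrite ler_pdivrMl ?exprn_gt0// expr2; nra.
Qed.

Lemma cutoff_near_bounds : exists c M : R, [/\ 0 < c, 0 < M &
  forall t, 0 <= t <= 2 -> c <= rho t <= M].
Proof.
have c02 : {within `[(0 : R), 2], continuous rho}.
  by apply: continuous_subspaceT; exact: cutoff_continuous.
have [a _ ha] := EVT_min (ler0n _ 2) c02; have [b _ hb] := EVT_max (ler0n _ 2) c02.
exists (rho a), (rho b); split; try exact: cutoff_gt0.
by move=> t t02; rewrite ha ?hb.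
Qed.

Lemma cutoff_bound : exists2 M : R, 0 < M &
  forall s, 0 <= s -> rho (s ^+ 2) * (1 + s) <= M.
Proof.
have [c [M [c0 M0 h]]] := cutoff_near_bounds.
exists (3 * M + 2) => [|s s0]; first by rewrite ltr_wpDl// mulr_ge0// ltW.
have [s2|s2] := leP (s ^+ 2) 2.
  have /andP[_ rM] := h (s ^+ 2) (introT andP (conj (sqr_ge0 s) s2)).
  have s3 : s <= 2 by rewrite leNgt; apply/negP => h2; nra.
  have := cutoff_gt0 (s ^+ 2); nra.
have [_ hs] := cutoff_far s0 s2; apply: le_trans hs _.
have : s ^- 2 <= 1 by rewrite invf_le1 ?(lt_trans _ s2)//; lra.
lra.
Qed.

Lemma cutoff_small (e : R) : 0 < e -> exists2 d : R, 0 < d &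
  forall s, 0 <= s -> rho (s ^+ 2) < d -> rho (s ^+ 2) * (1 + s) < e.
Proof.
move=> e0; have [c [M [c0 M0 h]]] := cutoff_near_bounds.
exists (Num.min c ((e / 2) ^+ 2)).
  by rewrite lt_min c0 exprn_gt0// divr_gt0.
move=> s s0; rewrite lt_min => /andP[sc se].
have [s2|s2] := leP (s ^+ 2) 2.
  have /andP[+ _] := h (s ^+ 2) (introT andP (conj (sqr_ge0 s) s2)).
  by rewrite leNgt sc.
have [rs hs] := cutoff_far s0 s2; apply: le_lt_trans hs _.
rewrite mulrC -ltr_pdivlMr//; move: se; rewrite rs ltr_pXn2r ?nnegrE//.
  by rewrite invr_ge0 sqr_ge0.
by rewrite divr_ge0// ltW.
Qed.

Lemma cutoff_large (r : R) : 0 < r -> exists M : R,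
  forall s, 0 <= s -> r <= rho (s ^+ 2) -> s <= M.
Proof.
move=> r0; exists (2 + r^-1) => s s0 rs; rewrite leNgt; apply/negP => sM.
have s2 : 2 < s by apply: le_lt_trans sM; rewrite lerDl invr_ge0 ltW.
have s22 : 2 < s ^+ 2 by rewrite expr2; nra.
have [e _] := cutoff_far s0 s22; move: rs; rewrite e.
have sr : r^-1 < s by apply: le_lt_trans sM; rewrite lerDr.
apply/negP; rewrite -ltNge -exprVn -exprM.
have si : s^-1 < r by rewrite invf_plt ?posrE//; lra.
have si1 : s^-1 < 1 by rewrite invf_lt1; lra.
have si0 : 0 < s^-1 by rewrite invr_gt0; lra.
apply: le_lt_trans si; rewrite -[leRHS]expr1; apply: ler_wiXn2l => //; exact: ltW.
Qed.

End Cutoff.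

Lemma perturb_norm_aux {R : realType} (M x y w t q : R) :
  y <= t * M -> w <= q -> x <= w + y -> 1 + x + w <= 2 * (1 + q) + M * t.
Proof. move=> *; lra. Qed.

Lemma perturb_bound_aux {R : realType} (M1 M C e x y t q : R) (k := C * M1 * (2 + M1 * M)) :
  0 < M1 -> 0 < M -> 0 <= C -> 0 < t -> 0 <= q -> t * (1 + q) <= M -> 0 <= x -> 0 <= y ->
  t * (1 + q) <= e / (k + 1) -> y <= t * M1 -> x <= 2 * (1 + q) + M1 * t ->
  C * x * y <= e.
Proof.
move=> M10 M0 C0.
move=> t0 q0 tM x0 y0 te yt xt.
have k0 : 0 <= k by rewrite !mulr_ge0 ?addr_ge0 ?mulr_ge0// ltW.
have k1 : 0 < k + 1 by rewrite ltr_wpDl.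
have e0 : 0 <= e.
  by have := le_trans (mulr_ge0 (ltW t0) (addr_ge0 ler01 q0)) te; rewrite pmulr_lge0 ?invr_gt0.
have tM' : t <= M by nra.
have e1 : x * y <= (2 * (1 + q) + M1 * t) * (t * M1) by exact: ler_pM.
have e2 : t <= t * (1 + q) by nra.
have e3 : M1 * t <= M1 * M * (1 + q).
  rewrite -mulrA ler_wpM2l ?(ltW M10)//; nra.
have e4 : (2 * (1 + q) + M1 * t) * (t * M1) <= M1 * (2 + M1 * M) * (e / (k + 1)).
  apply: (@le_trans _ _ ((2 + M1 * M) * (1 + q) * (t * M1))).
    rewrite ler_wpM2r ?mulr_ge0 ?(ltW t0) ?(ltW M10)//.
    by rewrite (mulrDl 2 (M1 * M)) lerD2l.
  rewrite (_ : _ * (t * M1) = M1 * (2 + M1 * M) * (t * (1 + q))); last by ring.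
  by rewrite ler_wpM2l// mulr_ge0 ?addr_ge0 ?mulr_ge0// ltW.
rewrite -mulrA; apply: (@le_trans _ _ (C * (M1 * (2 + M1 * M) * (e / (k + 1))))).
  by rewrite ler_wpM2l// (le_trans e1).
rewrite (_ : C * _ = k * (e / (k + 1))); last by rewrite /k; ring.
have kk : k / (k + 1) <= 1 by rewrite ler_pdivrMr//; lra.
by rewrite mulrCA -[leRHS]mulr1 ler_wpM2l.
Qed.

Section PerturbedAction.
Context {R : realType} {n : nat}.
Local Notation B := (Bhalf R n).
Variables (eps : R) (H : Cn R n -> R) (rho : R -> R).
Hypotheses (HH : is_hamiltonian eps H) (Hrho : is_cutoff rho).

Lemma action_perturb_bound : exists2 C : R, 0 <= C & forall s v : B, `|v| <= 1 ->
  `|action H (s + rho (`|s| ^+ 2) *: v) - action H s| <= C.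
Proof.
have [C C0 HC] := action_diff_bound HH; have [M M0 HM] := cutoff_bound Hrho.
exists (C * ((1 + M) * M)); first by rewrite !mulr_ge0 ?addr_ge0// ltW.
move=> s v v1; apply: le_trans (HC _ _) _; rewrite -mulrA ler_wpM2l//.
have r0 := cutoff_gt0 Hrho (`|s| ^+ 2); set r := rho _ in r0 *.
have wr : `|r *: v| <= r by rewrite normrZ gtr0_norm// ler_piMr// ltW.
have rM : r * (1 + `|s|) <= M by exact: HM.
apply: (@le_trans _ _ ((1 + `|s| + r) * r)).
  by apply: ler_pM => //; rewrite lerD2l.
have aux (t : R) : 0 <= t -> r * (1 + t) <= M -> (1 + t + r) * r <= (1 + M) * M.
  move=> t0 h; have rM1 : r <= M by nra.
  rewrite mulrDl (mulrDl 1 M) mul1r (mulrC _ r) lerD//.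
  by apply: ler_pM => //; exact: ltW.
exact: aux.
Qed.

Lemma perturb_action_cvg (T : Type) (F : set_system T) (s v : T -> B) (z v0 : B)
    (r0 : R) : ProperFilter F ->
  (forall l : B -> R^o, bounded_linear l -> l (s a) @[a --> F] --> l z) ->
  rho (`|s a| ^+ 2) @[a --> F] --> r0 -> v a @[a --> F] --> v0 ->
  action H (s a + rho (`|s a| ^+ 2) *: v a) - action H (s a) @[a --> F] -->
  action H (z + r0 *: v0) - action H z.
Proof.
move=> FF sz rr0 vv0; set r := fun a => rho (`|s a| ^+ 2) in rr0 *.
have [M M0 HM] := cutoff_bound Hrho.
have rg0 a : 0 < r a by exact: cutoff_gt0.
have rsM a : r a * (1 + `|s a|) <= M by exact: HM.
have [sL sn] := @bounded_linear_sgnop R n.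
have [bsip1 bsip2 _] := @bounded_bilinear_sip R 1 n.
have ww0 : r a *: v a @[a --> F] --> r0 *: v0 by exact: cvgZ.
have vd : `|v a - v0| @[a --> F] --> (0 : R).
  apply/cvgr0Pnorm_le => e e0; have /cvgrPdist_le /(_ _ e0) := vv0.
  by apply: filterS => a; rewrite distrC normr_id.
under eq_fun do rewrite action_diff; rewrite action_diff.
apply: cvgB; first (apply: cvgM; [exact: cvg_cst|apply: cvgD]).
- apply: cvgM; first exact: cvg_cst.
  have -> : (fun a => sip (s a) (sgnop (r a *: v a))) =
      (fun a => r a * sip (s a) (sgnop v0) + r a * sip (s a) (sgnop (v a - v0))).
    apply/funext => a; rewrite (linear_funZ _ sL.1) sipC sipZ sipC -mulrDr.
    by rewrite -(linear_funD (bsip2 _)) -(linear_funD sL.1) addrC subrK.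
  have -> : sip z (sgnop (r0 *: v0)) = r0 * sip z (sgnop v0) + 0.
    by rewrite addr0 (linear_funZ _ sL.1) sipC sipZ sipC.
  apply: cvgD.
    apply: cvgM => //; apply: (sz (fun x => sip x (sgnop v0) : R^o)).
    apply: (@bound_bounded_linear _ _ _ _ `|sgnop v0|); first exact: bsip1.
    by move=> x; rewrite mulrC; exact: sip_bound.
  apply/cvgr0Pnorm_le => e e0; have /cvgr0Pnorm_le /(_ _ (divr_gt0 e0 M0)) := vd.
  apply: filterS => a; rewrite normr_id => h.
  rewrite normrM gtr0_norm//.
  apply: (@le_trans _ _ (r a * (`|s a| * `|v a - v0|))).
    rewrite ler_wpM2l ?(ltW (rg0 a))//; apply: le_trans (sip_bound _ _) _.
    by rewrite ler_wpM2l.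
  rewrite mulrA; apply: (@le_trans _ _ (M * (e / M))).
    apply: ler_pM => //; first by rewrite mulr_ge0// ltW.
    by apply: le_trans (rsM a); rewrite ler_wpM2l ?lerDr// ltW.
  by rewrite mulrC divfK ?gt_eqF.
- have [C C0 bC] := @bounded_linear_bound _ _ _ _ sL.
  have sw : sgnop (r a *: v a) @[a --> F] --> sgnop (r0 *: v0).
    exact: (@cvg_comp _ _ _ _ sgnop _ _ _ ww0 (sL.2 _)).
  have bc : continuous (fun p : B * B => sip p.1 p.2 : R^o).
    move=> p; have := bounded_bilinear_is_diff p (@bounded_bilinear_sip R 1 n).
    by move=> /is_diff_differentiable/differentiable_continuous.
  exact: (bounded_bilinear_cvg (@bounded_bilinear_sip R 1 n) FF ww0 sw).
have r00 : 0 <= r0 by apply: (cvgr_to_ge rr0); apply: nearW => a; exact: ltW.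
have lD (x y : B) : l2norm (x + y) <= l2norm x + l2norm y by exact: l2normD.
have dE a : l2norm (s a + r a *: v a - (z + r0 *: v0)) <=
    l2norm (s a - z) + `|r a *: v a - r0 *: v0|.
  rewrite opprD addrACA; apply: le_trans (lD _ _) _.
  by rewrite lerD2l l2norm_le.
have [M1 M10 HM1] : exists2 M1 : R, 0 < M1 & \forall a \near F, `|v a| <= M1.
  exists (`|v0| + 1); first by rewrite ltr_wpDl.
  have /cvgrPdist_le /(_ _ ltr01) := vv0; apply: filterS => a h.
  by rewrite -lerBlDl; apply: le_trans h; rewrite distrC; exact: lerB_dist.
have [r0p|r0n] := ltP 0 r0.
  have [M2 HM2] := cutoff_large Hrho (divr_gt0 r0p (ltr0n _ 2)).
  have sb : \forall a \near F, `|s a| <= M2.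
    have : \forall a \near F, r0 / 2 <= r a.
      by apply: (cvgr_ge _ rr0); lra.
    by apply: filterS => a h; exact: HM2.
  have FF0 : Filter F by apply: filter_filter.
  have sl := weak_l2_cvg FF0 sb sz.
  apply: cvgB; last exact: (ham_integral_cvg HH FF0 sb sl).
  have swb : \forall a \near F, `|s a + r a *: v a| <= M2 + M * M1.
    apply: filterS2 sb HM1 => a h1 h2; apply: le_trans (ler_normD _ _) _.
    rewrite normrZ gtr0_norm//.
    have := rsM a; have := rg0 a; move: h1 h2 (normr_ge0 (s a)) (normr_ge0 (v a)).
    move: `|s a| `|v a| (r a) => x y t h1 h2 x0 y0 t0 tM.
    have tM' : t <= M by nra.
    by apply: lerD => //; apply: ler_pM => //; exact: ltW.
  have wd : `|r a *: v a - r0 *: v0| @[a --> F] --> (0 : R).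
    apply/cvgr0Pnorm_le => e e0; have /cvgrPdist_le /(_ _ e0) := ww0.
    by apply: filterS => a; rewrite distrC normr_id.
  have swl : l2norm (s a + r a *: v a - (z + r0 *: v0)) @[a --> F] --> (0 : R).
    by apply: (cvg0_leD FF0 _ sl wd) => a; rewrite l2norm_ge0; exact: dE.
  exact: (ham_integral_cvg HH FF0 swb swl).
have {r00 r0n}r0E : r0 = 0 by apply/eqP; rewrite eq_le r0n r00.
have zE : z + r0 *: v0 = z by rewrite r0E scale0r addr0.
have lim0 : ham_integral H (z + r0 *: v0) - ham_integral H z = 0.
  by rewrite (congr1 (ham_integral H) zE); exact: subrr.
apply: (eq_ind_r (fun t : R => (fun a => ham_integral H (s a + r a *: v a) -
  ham_integral H (s a)) @ F --> t) _ lim0).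
rewrite r0E in rr0.
have [C C0 HC] := ham_integral_lipschitz HH.
pose k := C * M1 * (2 + M1 * M).
have k0 : 0 <= k by rewrite !mulr_ge0 ?addr_ge0 ?mulr_ge0// ltW.
apply/cvgr0Pnorm_le => e e0.
have k1 : 0 < k + 1 by rewrite ltr_wpDl.
have [d d0 hd] := cutoff_small Hrho (divr_gt0 e0 k1).
have rd : \forall a \near F, r a < d by exact: (cvgr_lt _ rr0 _ d0).
apply: filterS2 rd HM1 => a /(hd _ (normr_ge0 _)) h va.
have w1 : l2norm (r a *: v a) <= r a * M1.
  by apply: le_trans (l2norm_le _) _; rewrite normrZ gtr0_norm// ler_wpM2l// ltW.
have dd : s a + r a *: v a - s a = r a *: v a by rewrite addrAC subrr add0r.
apply: le_trans (HC _ _) _; rewrite (congr1 (@l2norm R n) dd).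
have w2 : 1 + l2norm (s a + r a *: v a) + l2norm (s a) <= 2 * (1 + `|s a|) + M1 * r a.
  exact: (perturb_norm_aux w1 (l2norm_le (s a)) (lD (s a) (r a *: v a))).
apply: (perturb_bound_aux M10 M0 C0 (rg0 a) (normr_ge0 (s a)) (rsM a) _ _ (ltW h) w1 w2).
  by rewrite !addr_ge0 ?l2norm_ge0.
exact: l2norm_ge0.
Qed.

End PerturbedAction.

Lemma second_countable_prod (T U : topologicalType) :
  @second_countable T -> @second_countable U -> @second_countable (T * U)%type.
Proof.
move=> [B cB [Bo Bb]] [C cC [Co Cb]].
exists [set W | exists V1 V2, [/\ B V1, C V2 & W = V1 `*` V2]].
  have -> : [set W | exists V1 V2, [/\ B V1, C V2 & W = V1 `*` V2]] =
      (fun p : set T * set U => p.1 `*` p.2) @` (B `*` C).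
    apply/seteqP; split=> [_ [V1 [V2 [b1 c2 ->]]]|_ [[V1 V2] [/= b1 c2] <-]].
      by exists (V1, V2).
    by exists V1, V2.
  by apply: (sub_countable (card_image_le _ _)); exact: countableX.
split=> [_ [V1 [V2 [b1 c2 ->]]]|[x y] W [[W1 W2] [/= W1x W2y] WW]].
  by apply: open_setX; [exact: Bo|exact: Co].
have [V1 [b1 V1x] V1W] := Bb x _ W1x; have [V2 [c2 V2y] V2W] := Cb y _ W2y.
exists (V1 `*` V2); first by split=> //; exists V1, V2.
by move=> z [z1 z2]; apply: WW; split; [exact: V1W|exact: V2W].
Qed.

Lemma hausdorff_prod (T U : topologicalType) :
  hausdorff_space T -> hausdorff_space U -> hausdorff_space (T * U)%type.
Proof.
move=> hT hU [x1 x2] [y1 y2] h; congr pair.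
  apply: hT => A B Ax By; have [[z w] /= [[Az _] [Bz _]]] :=
    h (A `*` setT) (B `*` setT) (ex_intro2 _ _ (A, setT) (conj Ax filterT) (@subset_refl _ _))
      (ex_intro2 _ _ (B, setT) (conj By filterT) (@subset_refl _ _)).
  by exists z.
apply: hU => A B Ax By; have [[z w] /= [[_ Az] [_ Bz]]] :=
    h (setT `*` A) (setT `*` B) (ex_intro2 _ _ (setT, A) (conj filterT Ax) (@subset_refl _ _))
      (ex_intro2 _ _ (setT, B) (conj filterT By) (@subset_refl _ _)).
by exists w.
Qed.

Lemma open_within_preimage (T U : topologicalType) (A : set T) (f : T -> U)
    (O : set U) : open A -> {within A, continuous f} -> open O ->
  open (A `&` f @^-1` O).
Proof.
move=> oA cf oO; rewrite setIC (open_setIS _ oA).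
by have /continuousP := cf; exact.
Qed.

Lemma within_continuous_maps (T U V : topologicalType) (A : set T) (B : set U)
    (f : T -> U) (g : U -> V) : (forall x, A x -> B (f x)) ->
  {within A, continuous f} -> {within B, continuous g} ->
  {within A, continuous (g \o f)}.
Proof.
move=> AB /subspace_continuousP cf /subspace_continuousP cg.
apply/subspace_continuousP => x Ax W Wgf.
have /(cf x Ax) := cg _ (AB x Ax) W Wgf.
by apply: filterS2 (withinT A (nbhs_filter x)) => z Az; apply; exact: AB.
Qed.

Lemma within_continuous_pair (T U V : topologicalType) (A : set T)
    (f : T -> U) (g : T -> V) : {within A, continuous f} ->
  {within A, continuous g} -> {within A, continuous (fun x => (f x, g x))}.
Proof. by move=> cf cg x; apply: cvg_pair; [exact: cf|exact: cg]. Qed.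

(** * Products of stratified spaces and of lc-manifolds *)

Section StratumProduct.
Context {R : realType} {P Q : @stratified R}.

Lemma sclosed_anti (S : @stratified R) k i j : is_stratified S k ->
  (i <= j)%N -> @sclosed R S j `<=` @sclosed R S i.
Proof.
move=> [_ _ _ h _]; elim: j => [|j IH]; first by rewrite leqn0 => /eqP ->.
rewrite leq_eqVlt => /orP[/eqP-> //|]; rewrite ltnS => /IH ij.
by move=> x /h /ij.
Qed.

Lemma ostrat_sclosed (S : @stratified R) k i j x : is_stratified S k ->
  @ostrat R S i x -> @sclosed R S j x <-> (j <= i)%N.
Proof.
move=> hS [Six Six']; split=> [Sj|ji]; last exact: (sclosed_anti hS ji).
by rewrite leqNgt; apply/negP => ij; apply: Six'; exact: (sclosed_anti hS ij).
Qed.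

Lemma ostrat_uniq (S : @stratified R) k i j x : is_stratified S k ->
  @ostrat R S i x -> @ostrat R S j x -> i = j.
Proof.
move=> hS xi xj; apply/eqP; rewrite eqn_leq.
by apply/andP; split; [apply/(ostrat_sclosed _ hS xj)/xi.1|apply/(ostrat_sclosed _ hS xi)/xj.1].
Qed.

Lemma ostrat_exists (S : @stratified R) k x : is_stratified S k ->
  exists i, @ostrat R S i x.
Proof.
move=> hS; have [_ [S0 Sk] _ _ _] := hS.
have ex0 : exists i, `[< @sclosed R S i x >] by exists 0%N; apply/asboolP; rewrite S0.
have ub i : `[< @sclosed R S i x >] -> (i <= k)%N.
  by move=> /asboolP; rewrite leqNgt; case: ltnP => // /Sk ->.
case: (ex_maxnP ex0 ub) => i /asboolP Si im; exists i; split=> //.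
by move=> /asboolP /im; rewrite ltnn.
Qed.

Variables (p q : nat).
Hypotheses (hP : is_stratified P p) (hQ : is_stratified Q q).
Local Notation PQ := (prod_strat P Q).

Lemma sclosed_prod i j m (z : PQ) : @ostrat R P i z.1 -> @ostrat R Q j z.2 ->
  @sclosed R PQ m z <-> (m <= i + j)%N.
Proof.
move=> zi zj; split=> [[i' [j' [<- /(ostrat_sclosed _ hP zi) ? /(ostrat_sclosed _ hQ zj) ?]]]|mij].
  exact: leq_add.
exists (minn m i), (m - minn m i)%N; split.
- by rewrite subnKC// geq_minl.
- by apply/(ostrat_sclosed _ hP zi); exact: geq_minr.
- by apply/(ostrat_sclosed _ hQ zj); lia.
Qed.

Lemma ostrat_prod i j (z : PQ) : @ostrat R P i z.1 -> @ostrat R Q j z.2 ->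
  @ostrat R PQ (i + j) z.
Proof.
move=> zi zj; split; first exact/(sclosed_prod _ zi zj).
by move=> /(sclosed_prod _ zi zj); rewrite ltnn.
Qed.

Lemma ostrat_prodP m (z : PQ) : @ostrat R PQ m z ->
  exists i j, [/\ (i + j)%N = m, @ostrat R P i z.1 & @ostrat R Q j z.2].
Proof.
move=> [zm zm']; have [i zi] := ostrat_exists z.1 hP.
have [j zj] := ostrat_exists z.2 hQ; exists i, j; split=> //.
apply/eqP; rewrite eqn_leq; apply/andP; split; last by apply/(sclosed_prod _ zi zj).
by rewrite leqNgt; apply/negP => /(sclosed_prod _ zi zj).
Qed.

Lemma rel_open_prod i j A B : rel_open (@ostrat R P i) A -> rel_open (@ostrat R Q j) B ->
  @rel_open PQ (@ostrat R PQ (i + j)) (A `*` B).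
Proof.
move=> [G1 oG1 ->] [G2 oG2 ->].
have [_ _ cP _ _] := hP; have [_ _ cQ _ _] := hQ.
exists ((G1 `&` ~` @sclosed R P i.+1) `*` (G2 `&` ~` @sclosed R Q j.+1)).
  by apply: open_setX; apply: openI => //; exact: closed_openC.
apply/seteqP; split=> [z [[z1 [zi zi']] [z2 [zj zj']]]|z [[[z1 zi] [z2 zj]]]].
  by split; [|exact: ostrat_prod].
move=> /ostrat_prodP[i' [j' [ij zi' zj']]].
have h1 : (i' <= i)%N by rewrite leqNgt; apply/negP => /(ostrat_sclosed _ hP zi').
have h2 : (j' <= j)%N by rewrite leqNgt; apply/negP => /(ostrat_sclosed _ hQ zj').
have [ei ej] : i' = i /\ j' = j by lia.
by subst i' j'.
Qed.

End StratumProduct.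

Lemma ball_prod (R : realType) (E F : normedModType R) (x z : E * F) e :
  ball x e z -> ball x.1 e z.1 /\ ball x.2 e z.2.
Proof.
move=> h; split; by case: h.
Qed.

Lemma hilbertable_prod (R : realType) (E F : normedModType R) :
  hilbertable E -> hilbertable F -> hilbertable (E * F)%type.
Proof.
move=> [[ip [c [d [ipC ipL c0 ipn]]]] EC [D cD dD]].
move=> [[iq [c' [d' [iqC iqL c'0 iqn]]]] FC [D' cD' dD']].
split.
- exists (fun x y => ip x.1 y.1 + iq x.2 y.2), (Num.min c c'), (`|d| + `|d'|); split.
  + by move=> x y; rewrite ipC iqC.
  + by move=> t x y z /=; rewrite ipL iqL mulrDr addrACA.
  + by rewrite lt_min c0.
  + move=> x; have /andP[l1 u1] := ipn x.1; have /andP[l2 u2] := iqn x.2.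
    have h1 : `|x.1| <= `|x| by rewrite prod_normE le_max lexx.
    have h2 : `|x.2| <= `|x| by rewrite prod_normE le_max lexx orbT.
    have h3 : `|x| = `|x.1| \/ `|x| = `|x.2|.
      by rewrite prod_normE; case: leP => _; [right|left].
    have aux (a b m cc cc' dd dd' i i' : R) : 0 <= a -> 0 <= b -> a <= m -> b <= m ->
        m = a \/ m = b -> 0 < cc -> 0 < cc' -> cc * a ^+ 2 <= i -> i <= dd * a ^+ 2 ->
        cc' * b ^+ 2 <= i' -> i' <= dd' * b ^+ 2 ->
        Num.min cc cc' * m ^+ 2 <= i + i' <= (`|dd| + `|dd'|) * m ^+ 2.
      move=> a0 b0 am bm mab cc0 cc'0 il iu il' iu'.
      have am2 : a ^+ 2 <= m ^+ 2 by rewrite ler_pXn2r ?nnegrE//; lra.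
      have bm2 : b ^+ 2 <= m ^+ 2 by rewrite ler_pXn2r ?nnegrE//; lra.
      have a2 : 0 <= a ^+ 2 := sqr_ge0 a; have b2 : 0 <= b ^+ 2 := sqr_ge0 b.
      have ca0 : 0 <= cc * a ^+ 2 by rewrite mulr_ge0// ltW.
      have cb0 : 0 <= cc' * b ^+ 2 by rewrite mulr_ge0// ltW.
      apply/andP; split.
        case: mab => ->.
          have : Num.min cc cc' * a ^+ 2 <= cc * a ^+ 2 by rewrite ler_wpM2r// ge_min lexx.
          lra.
        have : Num.min cc cc' * b ^+ 2 <= cc' * b ^+ 2 by rewrite ler_wpM2r// ge_min lexx orbT.
        lra.
      rewrite mulrDl; apply: lerD.
        by apply: le_trans iu _; apply: (@le_trans _ _ (`|dd| * a ^+ 2));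
          [rewrite ler_wpM2r// ler_norm|rewrite ler_wpM2l].
      by apply: le_trans iu' _; apply: (@le_trans _ _ (`|dd'| * b ^+ 2));
          [rewrite ler_wpM2r// ler_norm|rewrite ler_wpM2l].
    exact: (aux _ _ _ _ _ _ _ _ _ (normr_ge0 _) (normr_ge0 _) h1 h2 h3 c0 c'0 l1 u1 l2 u2).
- move=> G PG /cauchyP Gc.
  have G1 : cauchy (fst @ G).
    apply/cauchyP => e e0; have [x Gx] := Gc e e0; exists x.1.
    by change (G (fst @^-1` ball x.1 e)); apply: filterS Gx => z /ball_prod[h _]; exact: h.
  have G2 : cauchy (snd @ G).
    apply/cauchyP => e e0; have [x Gx] := Gc e e0; exists x.2.
    by change (G (snd @^-1` ball x.2 e)); apply: filterS Gx => z /ball_prod[_ h]; exact: h.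
  have [l1 Gl1] := (cvg_ex _).1 (EC _ _ G1); have [l2 Gl2] := (cvg_ex _).1 (FC _ _ G2).
  apply: (iffRL (cvg_ex _)); exists (l1, l2).
  apply: cvg_trans (cvg_pair Gl1 Gl2).
  by move=> A /=; rewrite /nbhs/= => h; apply: filterS h => -[].
- exists (D `*` D'); first exact: countableX.
  move=> W [[x y] Wxy] oW.
  have [[A B] /= [Ax By] AB] : nbhs (x, y) W by exact: open_nbhs_nbhs.
  have [a [Aa Da]] : (interior A) `&` D !=set0 by apply: dD; [exists x|exact: open_interior].
  have [b [Bb Db]] : (interior B) `&` D' !=set0 by apply: dD'; [exists y|exact: open_interior].
  exists (a, b); split=> //; apply: AB; split; exact: interior_subset.
Qed.

Lemma Ck_prodmap (R : realType) k (E1 E2 F1 F2 : normedModType R)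
    (U1 : set E1) (U2 : set E2) (f1 : E1 -> F1) (f2 : E2 -> F2) :
  open U1 -> open U2 -> Ck k U1 f1 -> Ck k U2 f2 ->
  Ck k (U1 `*` U2) (fun z : E1 * E2 => (f1 z.1, f2 z.2)).
Proof.
move=> oU1 oU2 h1 h2; have oU := open_setX oU1 oU2; apply: Ck_pair => //.
  apply: (Ck_comp oU oU1 _ _ h1); first by move=> z [].
  exact/Ck_linear/bounded_linear_fst.
apply: (Ck_comp oU oU2 _ _ h2); first by move=> z [].
exact/Ck_linear/bounded_linear_snd.
Qed.

Section ChartProduct.
Context {R : realType} {P Q : @stratified R} (p q : nat).
Hypotheses (hP : is_stratified P p) (hQ : is_stratified Q q).
Local Notation PQ := (prod_strat P Q).

Lemma cimg_prod (a : @chart R P) (b : @chart R Q) :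
  cimg (prod_chart a b) = cimg a `*` cimg b.
Proof.
apply/seteqP; split=> [_ [z [/= z1 z2] <-]|[x y] [[e e1 /= <-] [f f1 /= <-]]].
  by split; [exists z.1|exists z.2].
by exists (e, f).
Qed.

Lemma open_chart_overlap (S : @stratified R) i (a b : @chart R S) : @satlas R S i a ->
    is_chart (@ostrat R S i) a -> is_chart (@ostrat R S i) b ->
  open [set e | cdom e /\ cimg b (@cpar R S a e)].
Proof.
move=> _ [_ oa [G1 oG1 e1] _ [ca _]] [_ _ [G2 oG2 e2] _ _].
have -> : [set e | cdom e /\ cimg b (@cpar R S a e)] =
    @cdom R S a `&` @cpar R S a @^-1` G2.
  apply/seteqP; split=> e [ed]; rewrite e2.
    by move=> [].
  move=> G2e; split=> //; split=> //.
  have : cimg a (@cpar R S a e) by exists e.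
  by rewrite e1 => -[].
exact: open_within_preimage.
Qed.

Lemma is_chart_prod i j (a : @chart R P) (b : @chart R Q) :
  is_chart (@ostrat R P i) a -> is_chart (@ostrat R Q j) b ->
  @is_chart R PQ (@ostrat R PQ (i + j)) (prod_chart a b).
Proof.
move=> [ha oa ra ka [ca ca']] [hb ob rb kb [cb cb']]; split.
- exact: hilbertable_prod.
- exact: open_setX.
- by rewrite cimg_prod; exact: (rel_open_prod hP hQ ra rb).
- by move=> [e f] [/= ed fd]; rewrite ka ?kb.
- rewrite cimg_prod; split.
    apply: within_continuous_pair.
      by apply: (within_continuous_maps (f := fst) _ _ ca) => [z []//|];
        apply: continuous_subspaceT => z; exact: cvg_fst.
    by apply: (within_continuous_maps (f := snd) _ _ cb) => [z []//|];
      apply: continuous_subspaceT => z; exact: cvg_snd.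
  apply: within_continuous_pair.
    by apply: (within_continuous_maps (f := fst) _ _ ca') => [z []//|];
      apply: continuous_subspaceT => z; exact: cvg_fst.
  by apply: (within_continuous_maps (f := snd) _ _ cb') => [z []//|];
    apply: continuous_subspaceT => z; exact: cvg_snd.
Qed.

Lemma is_stratified_prod : is_stratified PQ (p + q).
Proof.
have [[sP hsP] [P0 Pp] cP dP aP] := hP; have [[sQ hsQ] [Q0 Qq] cQ dQ aQ] := hQ.
split.
- by split; [exact: second_countable_prod|exact: hausdorff_prod].
- split.
    by apply/seteqP; split=> // z _; exists 0%N, 0%N; rewrite P0 Q0.
  move=> m pqm; apply/seteqP; split=> // z.
  have [i zi] := ostrat_exists z.1 hP; have [j zj] := ostrat_exists z.2 hQ.
  move=> /(sclosed_prod hP hQ _ zi zj) mij.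
  have ip : (i <= p)%N by rewrite leqNgt; apply/negP => /Pp e; case: zi; rewrite e.
  have jq : (j <= q)%N by rewrite leqNgt; apply/negP => /Qq e; case: zj; rewrite e.
  by have := leq_trans pqm (leq_trans mij (leq_add ip jq)); rewrite ltnn.
- move=> m; have -> : @sclosed R PQ m =
      \bigcup_(i in `I_m.+1) (@sclosed R P i `*` @sclosed R Q (m - i)).
    apply/seteqP; split=> [z [i [j [<- zi zj]]]|z [i /= im [zi zj]]].
      by exists i; [rewrite /= ltnS leq_addr|split=> //; rewrite addKn].
    by exists i, (m - i)%N; split=> //; rewrite subnKC.
  by apply: closed_bigcup => [|i _]; [exact: finite_II|exact: closed_setX].
- by move=> m z [[|i] [j [e zi zj]]]; [exists 0%N, m|exists i, j]; split=> //; try lia;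
    [move: e; rewrite add0n => ej; subst j; exact: dQ|exact: dP].
move=> m; split.
- by move=> _ [i [j [a [b [<- ai bj ->]]]]]; have [ca _ _] := aP i; have [cb _ _] := aQ j;
    apply: is_chart_prod; [exact: ca|exact: cb].
- move=> z /(ostrat_prodP hP hQ) [i [j [e zi zj]]].
  have [_ /(_ _ zi)[a ai az] _] := aP i; have [_ /(_ _ zj)[b bj bz] _] := aQ j.
  exists (prod_chart a b); first by exists i, j, a, b.
  by rewrite cimg_prod.
- move=> _ _ [i [j [a [b [e ai bj ->]]]]] [i' [j' [a' [b' [e' ai' bj' ->]]]]] k.
  have [Pa _ Ps] := aP i; have [Qb _ Qs] := aQ j.
  have [Pa' _ _] := aP i'; have [Qb' _ _] := aQ j'.
  have [[ei ej]|ne] := pselect (i' = i /\ j' = j).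
    subst i' j'.
    have := Ck_prodmap (open_chart_overlap ai (Pa _ ai) (Pa _ ai'))
      (open_chart_overlap bj (Qb _ bj) (Qb _ bj')) (Ps _ _ ai ai' k) (Qs _ _ bj bj' k).
    by apply: Ck_sub => z [[z1 z2]]; rewrite cimg_prod => -[z3 z4].
  apply: (Ck_sub _ (@Ck_set0 _ _ _ _ _)) => z [[z1 z2]]; rewrite cimg_prod => -[/= z3 z4].
  apply: ne.
  have sub (S : @stratified R) s (A : @chart R S) (hA : is_chart (@ostrat R S s) A) x :
    cimg A x -> @ostrat R S s x by have [_ _ [G _ ->] _ _] := hA; case.
  split.
    apply: (ostrat_uniq hP (sub _ _ _ (Pa' _ ai') _ z3)).
    by apply: (sub _ _ _ (Pa _ ai)); exists z.1.
  apply: (ostrat_uniq hQ (sub _ _ _ (Qb' _ bj') _ z4)).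
  by apply: (sub _ _ _ (Qb _ bj)); exists z.2.
Qed.

End ChartProduct.

Section RowVectors.
Context {R : realType}.

Lemma bounded_linear_row_mx i j :
  bounded_linear (fun p : 'rV[R]_i * 'rV[R]_j => row_mx p.1 p.2).
Proof.
split=> [t [x1 x2] [y1 y2]|[x y] A /nbhs_ballP[e /= e0 eA]].
  by rewrite /= -add_row_mx -scale_row_mx.
apply/nbhs_ballP; exists e => //= -[x' y'] xy; have [[_ /= xx] [_ /= yy]] := ball_prod xy.
apply: eA; split=> // k l; rewrite !mxE.
by case: splitP => m _; [exact: xx|exact: yy].
Qed.

Lemma bounded_linear_kill i (Z : {set 'I_i}) : bounded_linear (@kill R i Z).
Proof.
split=> [t x y|u A /nbhs_ballP[e /= e0 eA]].
  by apply/rowP => k; rewrite !mxE; case: ifP => // _; rewrite mulr0 addr0.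
apply/nbhs_ballP; exists e => //= v [_ uv]; apply: eA; split => // k l.
by rewrite !mxE; case: ifP => // _; exact: ballxx.
Qed.

Lemma nvanish_split i j (u : 'rV[R]_(i + j)) :
  nvanish u = (nvanish (lsubmx u) + nvanish (rsubmx u))%N.
Proof.
rewrite /nvanish -!sum1_card big_mkcond big_split_ord -!big_mkcond /=.
by congr (_ + _)%N; apply: eq_bigl => k; rewrite !inE mxE.
Qed.

Lemma corner_split i j (u : 'rV[R]_(i + j)) :
  corner u <-> corner (lsubmx u) /\ corner (rsubmx u).
Proof.
split=> [uc|[uc uc'] k]; first by split=> k; rewrite mxE.
rewrite -(hsubmxK u); case: (split_ordP k) => l ->.
  by rewrite row_mxEl.
by rewrite row_mxEr.
Qed.

Definition lset i j (Z : {set 'I_(i + j)}) : {set 'I_i} := [set k | lshift j k \in Z].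
Definition rset i j (Z : {set 'I_(i + j)}) : {set 'I_j} := [set k | rshift i k \in Z].

Lemma lsubmx_kill i j (Z : {set 'I_(i + j)}) (u : 'rV[R]_(i + j)) :
  lsubmx (kill Z u) = kill (lset Z) (lsubmx u).
Proof. by apply/rowP => k; rewrite !mxE inE. Qed.

Lemma rsubmx_kill i j (Z : {set 'I_(i + j)}) (u : 'rV[R]_(i + j)) :
  rsubmx (kill Z u) = kill (rset Z) (rsubmx u).
Proof. by apply/rowP => k; rewrite !mxE inE. Qed.

Lemma nvanish_kill i (Z : {set 'I_i}) (u : 'rV[R]_i) :
  (forall k, k \notin Z -> 0 < u ord0 k) -> nvanish (kill Z u) = #|Z|.
Proof.
move=> uZ; apply: eq_card => k; rewrite !inE mxE.
by case: (boolP (k \in Z)) => [_|/uZ /gt_eqF //]; rewrite eqxx.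
Qed.

Lemma open_kill_face i (Z : {set 'I_i}) (W : set 'rV[R]_i) : open W ->
  open [set u : 'rV[R]_i | (forall k, k \notin Z -> 0 < u ord0 k < 1) /\ W (kill Z u)].
Proof.
move=> oW; apply: openI; last first.
  have /continuousP := (@bounded_linear_kill i Z).2; exact.
rewrite openE => u /= uZ; rewrite /interior.
apply: (@filter_forall _ _ (fun k (v : 'rV[R]_i) => k \notin Z -> 0 < v ord0 k < 1) (nbhs u)) => k.
case: (boolP (k \in Z)) => [kZ|kZ]; first by apply: nearW.
have /andP[u0 u1] := uZ k kZ.
have cu : (fun v : 'rV[R]_i => v ord0 k) @ nbhs u --> u ord0 k by exact: coord_continuous.
have h0 := cvgr_gt _ cu _ u0; have h1 := cvgr_lt _ cu _ u1.
by apply: filterS2 (h0 _) (h1 _) => v a b _; rewrite a b.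
Qed.

End RowVectors.

Section ChartOverlaps.
Context {R : realType} {S : @stratified R} (i : nat).

Lemma cimg_ostrat (A : set S) (a : @chart R S) x : is_chart A a -> cimg a x -> A x.
Proof. by move=> [_ _ [G _ ->] _ _] []. Qed.

Lemma open_face_overlap (V : set S) (U0 : set 'rV[R]_i) (f : S * 'rV[R]_i -> S)
    (Z : {set 'I_i}) (a b : @chart R S) :
  rel_open (@ostrat R S i) V -> rel_open (@corner R i) U0 ->
  (forall z, (V `*` U0) z -> @ostrat R S (nvanish z.2) (f z)) ->
  {within V `*` U0, continuous f} ->
  is_chart (@ostrat R S i) a -> is_chart (@ostrat R S #|Z|) b ->
  open [set z : cmod a * 'rV[R]_i |
     [/\ cdom z.1, V (cpar z.1), U0 (kill Z z.2),
         forall k, k \notin Z -> 0 < z.2 ord0 k &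
         cimg b (f (cpar z.1, kill Z z.2))]].
Proof.
move=> [OV oV VE] [OU oU UE] fs cf ha hb.
have [_ oa ra _ [ca _]] := ha; have [_ _ [Ob oOb bE] _ _] := hb.
pose A1 := @cdom R S a `&` @cpar R S a @^-1` OV.
pose B1 := [set u : 'rV[R]_i | (forall k, k \notin Z -> 0 < u ord0 k < 1) /\ OU (kill Z u)].
have oA1 : open A1 by exact: open_within_preimage.
have oB1 : open B1 by exact: open_kill_face.
pose phi (z : cmod a * 'rV[R]_i) := (@cpar R S a z.1, kill Z z.2).
have AB z : (A1 `*` B1) z -> (V `*` U0) (phi z).
  move=> [[zd zV] [zk zU]]; split; rewrite /phi /=.
    by rewrite VE; split=> //; apply: (cimg_ostrat ha); exists z.1.
  rewrite UE; split=> // k; rewrite mxE; case: ifPn => [_|/zk /andP[/ltW -> ->//]].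
  by rewrite lexx ltr01.
have cphi : {within A1 `*` B1, continuous phi}.
  apply: within_continuous_pair.
    apply: (within_continuous_maps (f := fst) _ _ ca) => [z [[]]//|].
    by apply: continuous_subspaceT => z; exact: cvg_fst.
  apply: continuous_subspaceT => z; apply: (@continuous_comp _ _ _ snd (kill Z)).
    exact: cvg_snd.
  exact: (bounded_linear_kill Z).2.
have cfphi := within_continuous_maps AB cphi cf.
have -> : [set z : cmod a * 'rV[R]_i |
     [/\ cdom z.1, V (cpar z.1), U0 (kill Z z.2),
         forall k, k \notin Z -> 0 < z.2 ord0 k &
         cimg b (f (cpar z.1, kill Z z.2))]] = (A1 `*` B1) `&` (f \o phi) @^-1` Ob.
  apply/seteqP; split=> [z [zd zV zU zk]|z [zAB zO]].
    rewrite bE => -[zO _]; split=> //; split.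
      by split=> //; move: zV; rewrite VE => -[].
    split; last by move: zU; rewrite UE => -[].
    move=> k kZ; rewrite zk//=; move: zU; rewrite UE => -[_ /(_ k)].
    by rewrite mxE (negbTE kZ) => /andP[].
  have [zV zU] := AB _ zAB; have [[zd _] [zk _]] := zAB.
  have zk' k : k \notin Z -> 0 < z.2 ord0 k by move=> /zk /andP[].
  split=> //; rewrite bE; split=> //.
  by have := fs _ (conj zV zU); rewrite /= nvanish_kill.
apply: open_within_preimage => //; exact: open_setX.
Qed.

Lemma open_inverse_overlap (V : set S) (W : set S) (g : S -> S * 'rV[R]_i)
    (B : set S) (a b : @chart R S) :
  V `<=` @ostrat R S i -> open W -> {within W, continuous g} ->
  (forall y, W y -> V (g y).1) ->
  is_chart (@ostrat R S i) a -> is_chart B b ->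
  open [set y : cmod b | [/\ cdom y, W (cpar y) & cimg a (g (cpar y)).1]].
Proof.
move=> Vi oW cg gV [_ _ [Oa oOa aE] _ _] [_ ob _ _ [cb _]].
pose A1 := @cdom R S b `&` @cpar R S b @^-1` W.
have oA1 : open A1 by exact: open_within_preimage.
have cb1 : {within A1, continuous (@cpar R S b)}.
  by apply: continuous_subspaceW cb => z [].
have cgb : {within A1, continuous (fst \o (g \o @cpar R S b))}.
  have h : {within A1, continuous (g \o @cpar R S b)}.
    by apply: (within_continuous_maps _ cb1 cg) => z [].
  apply: (within_continuous_maps (B := setT) _ h) => //.
  by apply: continuous_subspaceT => z; exact: cvg_fst.
have -> : [set y : cmod b | [/\ cdom y, W (cpar y) & cimg a (g (cpar y)).1]] =
    A1 `&` (fst \o (g \o @cpar R S b)) @^-1` Oa.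
  apply/seteqP; split=> [y [yd yW]|y [[yd yW] yO]].
    by rewrite aE => -[].
  by split=> //; rewrite aE; split=> //; apply: Vi; exact: gV.
exact: open_within_preimage.
Qed.

End ChartOverlaps.

Lemma continuous_pair (T U V : topologicalType) (f : T -> U) (g : T -> V) :
  continuous f -> continuous g -> continuous (fun x => (f x, g x)).
Proof. by move=> cf cg x; apply: cvg_pair; [exact: cf|exact: cg]. Qed.

Section Interleave.
Context {R : realType}.

Definition splitz {E F : Type} {i j} (z : (E * F) * 'rV[R]_(i + j)) :
  (E * 'rV[R]_i) * (F * 'rV[R]_j) := ((z.1.1, lsubmx z.2), (z.1.2, rsubmx z.2)).

Definition joinz {E F : Type} {i j} (z : (E * 'rV[R]_i) * (F * 'rV[R]_j)) :
  (E * F) * 'rV[R]_(i + j) := ((z.1.1, z.2.1), row_mx z.1.2 z.2.2).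

Lemma splitzK {E F : Type} i j : cancel (@splitz E F i j) (@joinz E F i j).
Proof. by move=> [[e f] u]; rewrite /joinz /= hsubmxK. Qed.

Lemma splitz_continuous (T U : topologicalType) i j : continuous (@splitz T U i j).
Proof.
apply: continuous_pair; apply: continuous_pair => z.
- by apply: (@continuous_comp _ _ _ fst fst); exact: cvg_fst.
- by apply: (@continuous_comp _ _ _ snd lsubmx);
    [exact: cvg_snd|exact: continuous_lsubmx].
- by apply: (@continuous_comp _ _ _ fst snd); [exact: cvg_fst|exact: cvg_snd].
- by apply: (@continuous_comp _ _ _ snd rsubmx);
    [exact: cvg_snd|exact: continuous_rsubmx].
Qed.

Lemma joinz_continuous (T U : topologicalType) i j : continuous (@joinz T U i j).
Proof.
apply: continuous_pair; first apply: continuous_pair => z.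
- by apply: (@continuous_comp _ _ _ fst fst); exact: cvg_fst.
- by apply: (@continuous_comp _ _ _ snd fst); [exact: cvg_snd|exact: cvg_fst].
have c : continuous (fun z : (T * 'rV[R]_i) * (U * 'rV[R]_j) => (z.1.2, z.2.2)).
  apply: continuous_pair => z.
    by apply: (@continuous_comp _ _ _ fst snd); [exact: cvg_fst|exact: cvg_snd].
  by apply: (@continuous_comp _ _ _ snd snd); exact: cvg_snd.
move=> z; exact: (@continuous_comp _ _ _ _ (fun x : 'rV[R]_i * 'rV[R]_j => row_mx x.1 x.2)
  z (c z) ((bounded_linear_row_mx i j).2 _)).
Qed.

Lemma bounded_linear_splitz (E F : normedModType R) i j : bounded_linear (@splitz E F i j).
Proof.
split; last exact: splitz_continuous.
by move=> t [[a b] u] [[a' b'] u']; rewrite /splitz /= !linearP.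
Qed.

Lemma bounded_linear_joinz (E F : normedModType R) i j : bounded_linear (@joinz E F i j).
Proof.
split; last exact: joinz_continuous.
by move=> t [[a b] [u c]] [[a' b'] [u' c']]; rewrite /joinz /= -add_row_mx -scale_row_mx.
Qed.

End Interleave.

Section LcProduct.
Context {R : realType} {P Q : @stratified R} (p q : nat).
Hypotheses (hP : is_stratified P p) (hQ : is_stratified Q q).
Local Notation PQ := (prod_strat P Q).

Definition lc_dom i j (U1 : set 'rV[R]_i) (U2 : set 'rV[R]_j) : set 'rV[R]_(i + j) :=
  [set u | U1 (lsubmx u) /\ U2 (rsubmx u)].

Definition lc_prod i j (f1 : P * 'rV[R]_i -> P) (f2 : Q * 'rV[R]_j -> Q)
    (z : PQ * 'rV[R]_(i + j)) : PQ :=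
  (f1 (z.1.1, lsubmx z.2), f2 (z.1.2, rsubmx z.2)).

Variables (i j : nat) (V1 : set P) (V2 : set Q) (U1 : set 'rV[R]_i)
  (U2 : set 'rV[R]_j) (f1 : P * 'rV[R]_i -> P) (f2 : Q * 'rV[R]_j -> Q).
Hypotheses (h1 : @lc_chart R P i V1 U1 f1) (h2 : @lc_chart R Q j V2 U2 f2).

Lemma lc_prod_img : lc_prod f1 f2 @` ((V1 `*` V2) `*` lc_dom U1 U2) =
  (f1 @` (V1 `*` U1)) `*` (f2 @` (V2 `*` U2)).
Proof.
apply/seteqP; split=> [_ [[[v w] u] [[/= Vv Vw] [Uu1 Uu2]] <-]|].
  by split; [exists (v, lsubmx u)|exists (w, rsubmx u)].
move=> [x y] [/= [[v u] [/= Vv Uu] <-] [[w u'] [/= Vw Uu'] <-]].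
exists ((v, w), row_mx u u'); first by split=> //; split; rewrite ?row_mxKl ?row_mxKr.
by rewrite /lc_prod /= row_mxKl row_mxKr.
Qed.

Lemma lc_chart_prod :
  @lc_chart R PQ (i + j) (V1 `*` V2) (lc_dom U1 U2) (lc_prod f1 f2).
Proof.
have [V1o [U1o U10] f10 fs1 [g1 [gf1 of1 [cf1 cg1] sf1 sg1]]] := h1.
have [V2o [U2o U20] f20 fs2 [g2 [gf2 of2 [cf2 cg2] sf2 sg2]]] := h2.
have [_ _ _ _ aP] := hP; have [_ _ _ _ aQ] := hQ.
have V1s : V1 `<=` @ostrat R P i by have [G _ ->] := V1o; move=> x [].
have V2s : V2 `<=` @ostrat R Q j by have [G _ ->] := V2o; move=> x [].
have gV1 y : (f1 @` (V1 `*` U1)) y -> V1 (g1 y).1.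
  by move=> [z zV <-]; rewrite gf1//; case: zV.
have gV2 y : (f2 @` (V2 `*` U2)) y -> V2 (g2 y).1.
  by move=> [z zV <-]; rewrite gf2//; case: zV.
split.
- exact: (rel_open_prod hP hQ).
- split; last by split; rewrite linear0.
  have [G1 oG1 U1E] := U1o; have [G2 oG2 U2E] := U2o.
  exists (lsubmx @^-1` G1 `&` rsubmx @^-1` G2).
    apply: openI.
      by have /continuousP := @continuous_lsubmx R 1 i j; exact.
    by have /continuousP := @continuous_rsubmx R 1 i j; exact.
  rewrite /lc_dom U1E U2E; apply/seteqP; split=> u.
    by move=> [[a b] [c d]]; split=> //; apply/corner_split.
  by move=> [[a b] /corner_split[c d]].
- by move=> [v w] [/= Vv Vw]; rewrite /lc_prod /= !linear0 f10// f20.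
- move=> [[v w] u] [[/= Vv Vw] [Uu Uu']]; rewrite nvanish_split.
  by apply: (ostrat_prod hP hQ); [exact: (fs1 (_, _))|exact: (fs2 (_, _))].
exists (fun x => joinz (g1 x.1, g2 x.2)); split.
- move=> [[v w] u] [[/= Vv Vw] [Uu Uu']].
  by rewrite gf1 ?gf2// -[RHS]splitzK.
- by rewrite lc_prod_img; exact: open_setX.
- split.
    apply: within_continuous_pair.
      apply: (within_continuous_maps (f := fst \o splitz) _ _ cf1).
        by move=> z [[a b] [c d]].
      apply: continuous_subspaceT => z.
      by apply: continuous_comp; [exact: splitz_continuous|exact: cvg_fst].
    apply: (within_continuous_maps (f := snd \o splitz) _ _ cf2).
      by move=> z [[a b] [c d]].
    apply: continuous_subspaceT => z.
    by apply: continuous_comp; [exact: splitz_continuous|exact: cvg_snd].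
  rewrite lc_prod_img.
  apply: (within_continuous_maps (B := setT) (f := fun x => (g1 x.1, g2 x.2)) (g := joinz)) => //.
    apply: within_continuous_pair.
      apply: (within_continuous_maps (f := fst) _ _ cg1) => [z []//|].
      by apply: continuous_subspaceT => z; exact: cvg_fst.
    apply: (within_continuous_maps (f := snd) _ _ cg2) => [z []//|].
    by apply: continuous_subspaceT => z; exact: cvg_snd.
  by apply: continuous_subspaceT; exact: joinz_continuous.
- move=> Z _ _ [i0 [j0 [a [a' [e0 ai aj ->]]]]] [i1 [j1 [b [b' [e1 bi bj ->]]]]].
  have [ca _ _] := aP i0; have [ca' _ _] := aQ j0.
  have [cb _ _] := aP i1; have [cb' _ _] := aQ j1.
  have [[ei ej ei1 ej1]|ne] :=
      pselect [/\ i0 = i, j0 = j, i1 = #|lset Z| & j1 = #|rset Z|]; last first.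
    move=> k0; apply: (Ck_sub _ (@Ck_set0 _ _ _ _ _)) => -[[/= v w] u] /=.
    rewrite cimg_prod /lc_dom /= lsubmx_kill rsubmx_kill.
    move=> [[vd wd] [Vv Vw] [Uu Uu'] uk [cv cw]]; apply: ne.
    have uk1 k : k \notin lset Z -> 0 < lsubmx u ord0 k.
      by rewrite inE => /uk; rewrite mxE.
    have uk2 k : k \notin rset Z -> 0 < rsubmx u ord0 k.
      by rewrite inE => /uk; rewrite mxE.
    have cva : cimg a (cpar v) by exists v.
    have cwa : cimg a' (cpar w) by exists w.
    split.
    + exact: (ostrat_uniq hP (cimg_ostrat (ca _ ai) cva) (V1s _ Vv)).
    + exact: (ostrat_uniq hQ (cimg_ostrat (ca' _ aj) cwa) (V2s _ Vw)).
    + rewrite -(nvanish_kill uk1).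
      exact: (ostrat_uniq hP (cimg_ostrat (cb _ bi) cv) (fs1 (_, _) (conj Vv Uu))).
    + rewrite -(nvanish_kill uk2).
      exact: (ostrat_uniq hQ (cimg_ostrat (cb' _ bj) cw) (fs2 (_, _) (conj Vw Uu'))).
  subst i0 j0 i1 j1 => k.
  have o1 := open_face_overlap V1o U1o fs1 cf1 (ca _ ai) (cb _ bi).
  have o2 := open_face_overlap V2o U2o fs2 cf2 (ca' _ aj) (cb' _ bj).
  have H := Ck_prodmap o1 o2 (sf1 _ _ _ ai bi k) (sf2 _ _ _ aj bj k).
  have bL := bounded_linear_splitz (cmod a) (cmod a') i j.
  have oS := open_setX o1 o2; have /continuousP/(_ _ oS) oS' := bL.2.
  have H' := Ck_comp oS' oS (fun x h => h) (Ck_linear k _ bL) H.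
  have : Ck k [set z : cmod (prod_chart a a') * 'rV[R]_(i + j) |
      [/\ cdom z.1, (V1 `*` V2) (cpar z.1), lc_dom U1 U2 (kill Z z.2),
          forall k, k \notin Z -> 0 < z.2 ord0 k &
          cimg (prod_chart b b') (lc_prod f1 f2 (cpar z.1, kill Z z.2))]]
      (fun z => (ccoord b (f1 (cpar z.1.1, kill (lset Z) (lsubmx z.2))),
                 ccoord b' (f2 (cpar z.1.2, kill (rset Z) (rsubmx z.2))))).
    apply: Ck_sub H' => -[[/= v w] u] /=.
    rewrite cimg_prod /lc_dom /= lsubmx_kill rsubmx_kill.
    move=> [[vd wd] [Vv Vw] [Uu Uu'] uk [cv cw]]; split; split=> //= l.
      by rewrite inE => /uk; rewrite mxE.
    by rewrite inE => /uk; rewrite mxE.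
  by congr Ck; apply/funext => z; rewrite /lc_prod /= lsubmx_kill rsubmx_kill.
- move=> m _ _ [i0 [j0 [a [a' [e0 ai aj ->]]]]] [i1 [j1 [b [b' [e1 bi bj ->]]]]].
  have [ca _ _] := aP i0; have [ca' _ _] := aQ j0.
  have [cb _ _] := aP i1; have [cb' _ _] := aQ j1.
  rewrite lc_prod_img.
  have [[ei ej]|ne] := pselect (i0 = i /\ j0 = j); last first.
    move=> k0; apply: (Ck_sub _ (@Ck_set0 _ _ _ _ _)) => -[v w] /=.
    rewrite cimg_prod /= => -[_ [/gV1 vi /gV2 wi] [cv cw]]; apply: ne; split.
      exact: (ostrat_uniq hP (cimg_ostrat (ca _ ai) cv) (V1s _ vi)).
    exact: (ostrat_uniq hQ (cimg_ostrat (ca' _ aj) cw) (V2s _ wi)).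
  subst i0 j0 => k.
  have o1 := open_inverse_overlap V1s of1 cg1 gV1 (ca _ ai) (cb _ bi).
  have o2 := open_inverse_overlap V2s of2 cg2 gV2 (ca' _ aj) (cb' _ bj).
  have H := Ck_prodmap o1 o2 (sg1 _ _ _ ai bi k) (sg2 _ _ _ aj bj k).
  have bL := bounded_linear_joinz (cmod a) (cmod a') i j.
  have H' := Ck_comp (open_setX o1 o2) openT (fun x h => I) H (Ck_linear k _ bL).
  apply: Ck_sub H' => -[v w] /=; rewrite cimg_prod /=.
  by move=> [[vd wd] [vi wi] [cv cw]].
Qed.

End LcProduct.

Lemma is_lc_manifold_prod (R : realType) (P Q : @stratified R) :
  is_lc_manifold P -> is_lc_manifold Q -> is_lc_manifold (prod_strat P Q).
Proof.
move=> [[p hP] lP] [[q hQ] lQ]; split; first by exists (p + q)%N; exact: is_stratified_prod.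
move=> [x y]; have [i [V1 [U1 [f1 [c1 x1]]]]] := lP x.
have [j [V2 [U2 [f2 [c2 y2]]]]] := lQ y.
exists (i + j)%N, (V1 `*` V2), (lc_dom U1 U2), (lc_prod f1 f2); split.
  exact: (lc_chart_prod hP hQ).
by rewrite lc_prod_img.
Qed.

Lemma continuous_scale_id (R : realType) (E : normedModType R) (d : E -> R^o) :
  continuous d -> continuous ((fun x => (d x : R) *: x) : E -> E).
Proof.
move=> cd x; exact: (@bounded_bilinear_cvg R _ _ _ _ _ _ d id (d x) x
  (@bounded_bilinear_scale R E) (nbhs_filter x) (cd x) cvg_id).
Qed.

Lemma is_diff_ext (R : realType) (E F : normedModType R) (f df dg : E -> F) x :
  is_diff x f df -> (forall h, df h = dg h) -> is_diff x f dg.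
Proof. by move=> fx /funext <-. Qed.

Lemma is_diff_add (R : realType) (E F : normedModType R) (f g df dg : E -> F) x :
  is_diff x f df -> is_diff x g dg ->
  is_diff x (fun y => f y + g y) (fun h => df h + dg h).
Proof. by move=> fx gx; exact: is_diffD. Qed.

Lemma differentiable_is_diff (R : realType) (E F : normedModType R) (f : E -> F) x :
  differentiable f x -> is_diff x f ('d f x).
Proof. by move=> fx; apply: DiffDef. Qed.

(** * Smoothness of the perturbed map *)

Section Perturbation.
Context {R : realType} {n : nat} (rho : R -> R).
Hypothesis Hrho : is_cutoff rho.
Local Notation B := (Bhalf R n).
Local Notation L := (L22 R n).

Lemma bounded_linear_incl22 :
  bounded_linear (@incl22 R n) /\ forall v, `|incl22 v : B| <= `|v|.
Proof. exact: (bounded_linear_sincl (isT : (1 <= 4)%N)). Qed.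

Lemma bounded_bilinear_scale_incl22 :
  bounded_bilinear (fun (t : R^o) (v : L) => (t : R) *: incl22 v : B).
Proof.
have [[iL _] ib] := bounded_linear_incl22; split=> [v t a b|a t v w|].
- by rewrite scalerDl scalerA.
- by rewrite iL scalerDr !scalerA mulrC.
- by exists 1 => // t v; rewrite normrZ mul1r ler_wpM2l.
Qed.

Definition radial (x : B) : R^o := rho (`|x| ^+ 2).
Definition dradial (x : B) : R^o := 'd (rho : R^o -> R^o) (`|x| ^+ 2) 2.

Lemma sqr_norm_continuous : continuous (fun x : B => `|x| ^+ 2 : R^o).
Proof.
have := @Ck_sqr_norm R 1 n 0 B setT id (@openT _) (fun x _ => cvg_id) .
by move=> h x; exact: (h x I).
Qed.

Lemma Ck_radial k : Ck k setT radial.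
Proof.
have [h _ _ _] := Hrho; apply: (Ck_comp openT openT _ _ (h k)) => //.
by apply: (Ck_sqr_norm openT); exact: (Ck_linear k setT (conj (fun t x y => erefl) (fun x => cvg_id))).
Qed.

Lemma radial_continuous : continuous radial.
Proof. by move=> x; have := Ck_radial 0%N; move=> /(_ x Logic.I). Qed.

Lemma dradial_continuous : continuous dradial.
Proof.
have [/(_ 1%N)[_ h] _ _ _] := Hrho; move=> x.
have c : {for ((`|x| ^+ 2 : R^o), (2 : R^o)),
    continuous (fun z : R^o * R^o => 'd (rho : R^o -> R^o) (z.1) z.2)}.
  by apply: h.
have c' : continuous (fun y : B => ((`|y| ^+ 2 : R^o), (2 : R^o))).
  by apply: continuous_pair; [exact: sqr_norm_continuous|exact: cst_continuous].
have c2 := @continuous_comp _ _ _ (fun y : B => ((`|y| ^+ 2 : R^o), (2 : R^o)))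
   (fun z : R^o * R^o => 'd (rho : R^o -> R^o) (z.1) z.2) x (c' x) c.
exact: c2.
Qed.

Lemma radial_is_diff (x : B) : is_diff x radial (fun h => dradial x * sip x h : R^o).
Proof.
have dr : differentiable (rho : R^o -> R^o) (`|x| ^+ 2).
  by have [/(_ 1%N)[h _] _ _ _] := Hrho; exact: h.
have sq : is_diff x (fun y : B => `|y| ^+ 2 : R^o) (fun h => 2 * sip x h : R^o).
  have di : is_diff x (fun y : B => y) (fun y => y).
    by apply: bounded_linear_is_diff; split=> // y; exact: cvg_id.
  have := bounded_bilinear_diff_comp (@bounded_bilinear_sip R 1 n)
    (is_diff_differentiable di) (is_diff_differentiable di).
  have -> : (fun y : B => sip y y : R^o) = (fun y : B => `|y| ^+ 2 : R^o).
    by apply/funext => y; rewrite sip_norm.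
  move=> [d1 d2]; apply: DiffDef => //; rewrite d2; apply/funext => h.
  rewrite (is_diffE _ di) (sipC h).
  by move: (sip x h : R) => t; rewrite -mulr2n mulr_natl.
have dr' : is_diff (`|x| ^+ 2 : R^o) (rho : R^o -> R^o) ('d (rho : R^o -> R^o) (`|x| ^+ 2)).
  exact: DiffDef.
have [d1 d2] := @is_diff_comp _ _ _ _ _ _ _ _ x sq dr'.
apply: DiffDef => //; rewrite d2; apply/funext => h /=.
have dl := (diff_bounded_linear dr).1.
have -> : (2 * sip x h : R^o) = (sip x h : R) *: (2 : R^o).
  by rewrite [RHS]mulrC.
rewrite (linear_funZ _ dl) /dradial.
by rewrite [LHS]mulrC.
Qed.

Lemma perturb_is_diff (E : normedModType R) (S : E -> B) (I : E -> L) (e : E) :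
  differentiable S e -> differentiable I e ->
  is_diff e (fun e => S e + radial (S e) *: incl22 (I e))
    (fun h => 'd S e h + (radial (S e) *: incl22 ('d I e h) +
       (dradial (S e) * sip (S e) ('d S e h)) *: incl22 (I e))).
Proof.
move=> dS dI.
have rd := @is_diff_comp _ _ _ _ _ _ _ _ e (differentiable_is_diff dS) (radial_is_diff (S e)).
have bb : is_diff e (fun y => radial (S y) *: incl22 (I y))
    (fun h => radial (S e) *: incl22 ('d I e h) +
      (dradial (S e) * sip (S e) ('d S e h)) *: incl22 (I e)).
  apply: (is_diff_ext (bounded_bilinear_diff_comp bounded_bilinear_scale_incl22
    (is_diff_differentiable rd) dI)) => h.
  by rewrite (is_diffE _ rd).
exact: (is_diff_add (differentiable_is_diff dS) bb).
Qed.

Lemma Ck_perturb (E : normedModType R) k (U : set E) (S : E -> B) (I : E -> L) :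
  open U -> Ck k U S -> Ck k U I ->
  Ck k U (fun e => S e + radial (S e) *: incl22 (I e)).
Proof.
move=> oU cS cI; apply: (CkD oU cS).
apply: (Ck_bilinear bounded_bilinear_scale_incl22 oU _ cI).
exact: (Ck_comp oU openT (fun _ _ => Logic.I) cS (Ck_radial k)).
Qed.

Lemma opnorm_continuous_on_perturb (T : topologicalType) (E : normedModType R)
    (W : set T) (S : T -> B) (I : T -> L) (DS : T -> E -> B) (DI : T -> E -> L) :
  {within W, continuous S} -> {within W, continuous I} ->
  (forall z, W z -> bounded_linear (DS z)) -> opnorm_continuous_on W DS ->
  (forall z, W z -> bounded_linear (DI z)) -> opnorm_continuous_on W DI ->
  opnorm_continuous_on W (fun z h => DS z h + (radial (S z) *: incl22 (DI z h) +
       (dradial (S z) * sip (S z) (DS z h)) *: incl22 (I z))).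
Proof.
move=> cS cI bS oS bI oI.
have cR : {within W, continuous (fun z => radial (S z))}.
  exact: (within_continuous_maps (B := setT) (fun _ _ => Logic.I) cS
    (continuous_subspaceT radial_continuous)).
have o2 := opnorm_continuous_on_bilinear bounded_bilinear_scale_incl22 cR bI oI.
have cdS : {within W, continuous ((fun z => (dradial (S z) : R) *: (S z : B)) : T -> B)}.
  exact: (within_continuous_maps (B := setT) (fun _ _ => Logic.I) cS
    (continuous_subspaceT (continuous_scale_id dradial_continuous))).
have bsip := @bounded_bilinear_sip R 1 n.
have o1 := opnorm_continuous_on_bilinear bsip cdS bS oS.
have b1 z : W z -> bounded_linear (fun h => sip ((dradial (S z) : R) *: (S z : B)) (DS z h) : R^o).
  move=> Wz; apply: (bounded_linear_comp (bS z Wz)).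
  apply: (@bound_bounded_linear _ _ _ _ `|(dradial (S z) : R) *: (S z : B)|).
    by have [_ h _] := bsip; exact: h.
  by move=> x; exact: sip_bound.
have bsw : bounded_bilinear (fun (v : L) (t : R^o) => (t : R) *: incl22 v : B).
  have [h1 h2 [C C0 h3]] := bounded_bilinear_scale_incl22; split=> //.
  by exists C => // v t; rewrite mulrAC.
have o3 : opnorm_continuous_on W
    (fun z h => (dradial (S z) * sip (S z) (DS z h)) *: incl22 (I z)).
  apply: (opnorm_continuous_on_eq _ (opnorm_continuous_on_bilinear bsw cI b1 o1)).
  by move=> z h _; rewrite sipZ.
exact: (opnorm_continuous_onD oS (opnorm_continuous_onD o2 o3)).
Qed.

End Perturbation.

Section PerturbSmooth.
Context {R : realType} {n : nat} (rho : R -> R) {P K : @stratified R} (p q : nat).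
Hypotheses (Hrho : is_cutoff rho) (hP : is_stratified P p) (hK : is_stratified K q).
Local Notation B := (Bhalf R n).
Local Notation L := (L22 R n).
Local Notation PK := (prod_strat P K).

Lemma is_diff_fst_comp (E E' F : normedModType R) (f : E -> F) (e : E * E') :
  differentiable f e.1 ->
  is_diff e (fun e : E * E' => f e.1) (fun h => 'd f (e.1) h.1).
Proof.
move=> fe; have h1 := bounded_linear_is_diff e (@bounded_linear_fst R E E').
exact: (@is_diff_comp _ _ _ _ _ _ _ _ e h1 (differentiable_is_diff fe)).
Qed.

Lemma is_diff_snd_comp (E E' F : normedModType R) (f : E' -> F) (e : E * E') :
  differentiable f e.2 ->
  is_diff e (fun e : E * E' => f e.2) (fun h => 'd f (e.2) h.2).
Proof.
move=> fe; have h1 := bounded_linear_is_diff e (@bounded_linear_snd R E E').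
exact: (@is_diff_comp _ _ _ _ _ _ _ _ e h1 (differentiable_is_diff fe)).
Qed.

Lemma perturb_prod_is_diff (E E' : normedModType R) (S : E -> B) (I : E' -> L)
    (e : E * E') : differentiable S e.1 -> differentiable I e.2 ->
  is_diff e (fun e : E * E' => S e.1 + radial rho (S e.1) *: incl22 (I e.2))
    (fun h => 'd S (e.1) h.1 + (radial rho (S e.1) *: incl22 ('d I (e.2) h.2) +
       (dradial rho (S e.1) * sip (S e.1) ('d S (e.1) h.1)) *: incl22 (I e.2))).
Proof.
move=> dS dI; have d1 := @is_diff_fst_comp _ E' _ S e dS.
have d2 := @is_diff_snd_comp E _ _ I e dI.
have := perturb_is_diff Hrho (is_diff_differentiable d1) (is_diff_differentiable d2).
by move=> d; apply: (is_diff_ext d) => h; rewrite (is_diffE _ d1) (is_diffE _ d2).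
Qed.

Lemma chart_slice_continuous (Q : @stratified R) (X : normedModType R) i (V : set Q)
    (U : set 'rV[R]_i) (f : Q * 'rV[R]_i -> Q) (s : Q -> X) (a : @chart R Q) :
  continuous s -> {within V `*` U, continuous f} -> {within @cdom R Q a, continuous (@cpar R Q a)} ->
  {within [set z : cmod a * 'rV[R]_i | [/\ cdom z.1, V (cpar z.1) & U z.2]],
     continuous (fun z => s (f (cpar z.1, z.2)))}.
Proof.
move=> cs cf ca.
have c1 : {within [set z : cmod a * 'rV[R]_i | [/\ cdom z.1, V (cpar z.1) & U z.2]],
    continuous (fun z : cmod a * 'rV[R]_i => (@cpar R Q a z.1, z.2))}.
  apply: within_continuous_pair.
    apply: (within_continuous_maps (f := fst) _ _ ca) => [z []//|].
    by apply: continuous_subspaceT => z; exact: cvg_fst.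
  by apply: continuous_subspaceT => z; exact: cvg_snd.
have c2 := within_continuous_maps (B := V `*` U) _ c1 cf.
apply: (within_continuous_maps (B := setT) (g := s) (fun _ _ => Logic.I) (c2 _)).
  by move=> z [].
exact: continuous_subspaceT.
Qed.

Lemma lc_smooth_perturb (s : P -> B) (iota : K -> L) : lc_smooth s -> lc_smooth iota ->
  @lc_smooth R PK B (fun z => perturb rho s (z.1, iota z.2)).
Proof.
move=> [cs ss ls] [ci si li].
have [_ _ _ _ aP] := hP; have [_ _ _ _ aK] := hK.
split.
- have cG : continuous (fun w : B * L => w.1 + radial rho w.1 *: incl22 w.2 : B).
    move=> w; have := Ck_perturb Hrho openT (@Ck_linear R 0%N _ _ setT _ (@bounded_linear_fst R B L))
      (@Ck_linear R 0%N _ _ setT _ (@bounded_linear_snd R B L)).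
    by move=> /(_ w Logic.I).
  have c1 : continuous (fun z : PK => (s z.1, iota z.2)).
    apply: continuous_pair => z.
      by apply: (@continuous_comp _ _ _ fst s); [exact: cvg_fst|exact: cs].
    by apply: (@continuous_comp _ _ _ snd iota); [exact: cvg_snd|exact: ci].
  move=> z; exact: (@continuous_comp _ _ _ (fun z : PK => (s z.1, iota z.2))
    (fun w : B * L => w.1 + radial rho w.1 *: incl22 w.2 : B) z (c1 z) (cG _)).
- move=> m _ [i [j [a [b [_ ai bj ->]]]]] k.
  have [_ oa _ _ _] : is_chart (@ostrat R P i) a by have [h _ _] := aP i; exact: h.
  have [_ ob _ _ _] : is_chart (@ostrat R K j) b by have [h _ _] := aK j; exact: h.
  have oab := open_setX oa ob.
  apply: (Ck_perturb Hrho oab).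
    apply: (Ck_comp oab oa _ _ (ss _ _ ai k)); first by move=> z [].
    exact/Ck_linear/bounded_linear_fst.
  apply: (Ck_comp oab ob _ _ (si _ _ bj k)); first by move=> z [].
  exact/Ck_linear/bounded_linear_snd.
move=> m x /(ostrat_prodP hP hK) [i [j [<- xi xj]]].
have [V1 [U1 [f1 [h1 V1x D1]]]] := ls i _ xi.
have [V2 [U2 [f2 [h2 V2x D2]]]] := li j _ xj.
exists (V1 `*` V2), (lc_dom U1 U2), (lc_prod f1 f2); split.
- exact: (lc_chart_prod hP hK).
- by split.
move=> _ [i0 [j0 [a [b [e0 ai bj ->]]]]] W sV.
have ha : is_chart (@ostrat R P i0) a by have [h _ _] := aP i0; exact: h.
have hb : is_chart (@ostrat R K j0) b by have [h _ _] := aK j0; exact: h.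
have [[ei ej]|ne] := pselect (i0 = i /\ j0 = j); last first.
  suff W0 z : ~ W z by split=> [z /W0|z /W0].
  move=> [[d1 d2] [v1 v2] _]; apply: ne.
  have [[G1 _ E1] _ _ _ _] := h1; have [[G2 _ E2] _ _ _ _] := h2.
  split.
    apply: (ostrat_uniq hP (cimg_ostrat ha (_ : cimg a (cpar z.1.1)))); first by exists z.1.1.
    by move: v1; rewrite E1 => -[].
  apply: (ostrat_uniq hK (cimg_ostrat hb (_ : cimg b (cpar z.1.2)))); first by exists z.1.2.
  by move: v2; rewrite E2 => -[].
subst i0 j0.
have {D1} [d1 o1] := D1 a ai; have {D2} [d2 o2] := D2 b bj.
set W1 := [set z | _] in d1 o1; set W2 := [set z | _] in d2 o2.
have WW1 (z : (cmod a * cmod b) * 'rV[R]_(i + j)) : W z -> W1 (splitz z).1 by move=> [[? ?] [? ?] [? ?]].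
have WW2 (z : (cmod a * cmod b) * 'rV[R]_(i + j)) : W z -> W2 (splitz z).2 by move=> [[? ?] [? ?] [? ?]].
pose S1 (z : 'rV[R]_(i + j)) := fun e : cmod a => s (f1 (cpar e, lsubmx z)).
pose I1 (z : 'rV[R]_(i + j)) := fun e : cmod b => iota (f2 (cpar e, rsubmx z)).
have dW (z : (cmod a * cmod b) * 'rV[R]_(i + j)) : W z -> is_diff (z.1) (sV z : cmod a * cmod b -> B)
    (fun h => 'd (S1 z.2) (z.1.1) h.1 + (radial rho (S1 z.2 z.1.1) *: incl22 ('d (I1 z.2) (z.1.2) h.2) +
       (dradial rho (S1 z.2 z.1.1) * sip (S1 z.2 z.1.1) ('d (S1 z.2) (z.1.1) h.1)) *:
         incl22 (I1 z.2 z.1.2))).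
  move=> Wz; apply: (@perturb_prod_is_diff _ _ (S1 z.2) (I1 z.2) z.1).
    exact: (d1 _ (WW1 _ Wz)).
  exact: (d2 _ (WW2 _ Wz)).
split=> [z Wz|]; first exact: (is_diff_differentiable (dW z Wz)).
have cs1 : {within W, continuous (fst \o @splitz R (cmod a) (cmod b) i j)}.
  apply: continuous_subspaceT => z.
  by apply: continuous_comp; [exact: splitz_continuous|exact: cvg_fst].
have cs2 : {within W, continuous (snd \o @splitz R (cmod a) (cmod b) i j)}.
  apply: continuous_subspaceT => z.
  by apply: continuous_comp; [exact: splitz_continuous|exact: cvg_snd].
have [_ _ _ _ [ca _]] := ha; have [_ _ _ _ [cb _]] := hb.
have [_ _ _ _ [g1 [_ _ [cf1 _] _ _]]] := h1; have [_ _ _ _ [g2 [_ _ [cf2 _] _ _]]] := h2.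
have cS := within_continuous_maps WW1 cs1 (chart_slice_continuous cs cf1 ca).
have cI := within_continuous_maps WW2 cs2 (chart_slice_continuous ci cf2 cb).
have oS := opnorm_continuous_on_comp (@bounded_linear_fst R (cmod a) (cmod b)) WW1 cs1 o1.
have oI := opnorm_continuous_on_comp (@bounded_linear_snd R (cmod a) (cmod b)) WW2 cs2 o2.
have bS (z : (cmod a * cmod b) * 'rV[R]_(i + j)) : W z -> bounded_linear (fun h : cmod a * cmod b => 'd (S1 z.2) (z.1.1) h.1).
  move=> Wz; apply: (bounded_linear_comp (@bounded_linear_fst R (cmod a) (cmod b))).
  exact: (diff_bounded_linear (d1 _ (WW1 _ Wz))).
have bI (z : (cmod a * cmod b) * 'rV[R]_(i + j)) : W z -> bounded_linear (fun h : cmod a * cmod b => 'd (I1 z.2) (z.1.2) h.2).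
  move=> Wz; apply: (bounded_linear_comp (@bounded_linear_snd R (cmod a) (cmod b))).
  exact: (diff_bounded_linear (d2 _ (WW2 _ Wz))).
have := opnorm_continuous_on_perturb Hrho cS cI bS oS bI oI.
by apply: opnorm_continuous_on_eq => z h Wz; rewrite (is_diffE _ (dW z Wz)).
Qed.

End PerturbSmooth.

(** * Linearization of the perturbed map *)

Section PerturbFredholm.
Context {R : realType} {n : nat} (rho : R -> R).
Hypothesis Hrho : is_cutoff rho.
Local Notation B := (Bhalf R n).
Local Notation L := (L22 R n).

Lemma compact_op_incl22 : compact_op (@incl22 R n).
Proof.
have [[iL _] _] := @bounded_linear_incl22 R n; split=> // A /bounded_setP[M AM].
have cM := @sincl_compact R 1 4 n isT M.
apply: (@precompact_norm R (Bhalf R n) _ _ cM) => _ [x Ax <-].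
by exists x; [exact: AM|exact: val_inj].
Qed.

Lemma bounded_linear_scale (E : normedModType R) (c : R) :
  bounded_linear (fun x : E => c *: x).
Proof.
apply: (@bound_bounded_linear _ _ _ _ `|c|) => [t x y|x]; last by rewrite normrZ.
by rewrite scalerDr !scalerA mulrC.
Qed.

Lemma bounded_linear_dradial (E : normedModType R) (x : B) (T : E -> B) :
  bounded_linear T ->
  bounded_linear (fun h => dradial rho x * sip x (T h) : R^o).
Proof.
move=> bT; have b1 : bounded_linear (fun y : B => sip x y : R^o).
  apply: (@bound_bounded_linear _ _ _ _ `|x|).
    by have [_ h _] := @bounded_bilinear_sip R 1 n; exact: h.
  by move=> y; exact: sip_bound.
have b2 := bounded_linear_scale R^o (dradial rho x).
exact: (bounded_linear_comp bT (bounded_linear_comp b1 b2)).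
Qed.

Lemma dense_incl22 : dense (range (@incl22 R n)).
Proof.
move=> O [x Ox] oO; have xO : nbhs x O by exact: open_nbhs_nbhs.
have [N _ /(_ N (leqnn N)) ON] := @trunc_cvg R 1 n x O xO.
exists (trunc 1 N x); split=> //; exists (trunc 4 N x) => //; exact: val_inj.
Qed.

Lemma perturb_cst_is_diff (E : normedModType R) (S : E -> B) (v : L) (e : E) :
  differentiable S e ->
  is_diff e (fun e => S e + radial rho (S e) *: incl22 v)
    (fun h => 'd S e h + (dradial rho (S e) * sip (S e) ('d S e h)) *: incl22 v).
Proof.
move=> dS; have [[iL _] _] := @bounded_linear_incl22 R n.
have := perturb_is_diff Hrho dS (differentiable_cst v e).
move=> h; apply: (is_diff_ext h) => k.
by rewrite diff_cst (linear_fun0 iL) scaler0 add0r.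
Qed.

Lemma perturb_snd_is_diff (x : B) (v : L) :
  is_diff v (fun v => x + radial rho x *: incl22 v : B)
    (fun h => radial rho x *: incl22 h).
Proof.
have b := bounded_linear_comp (@bounded_linear_incl22 R n).1
  (bounded_linear_scale B (radial rho x)).
have := is_diff_add (differentiable_is_diff (differentiable_cst x v))
  (bounded_linear_is_diff v b).
by move=> h; apply: (is_diff_ext h) => k; rewrite diff_cst add0r.
Qed.

Lemma fredholm_perturb (E : normedModType R) (x : B) (T : E -> B) (v : B) :
  bounded_linear T -> fredholm Tminus (Piminus \o T) ->
  fredholm Tminus (fun h => Piminus (T h + (dradial rho x * sip x (T h)) *: v)).
Proof.
move=> bT fT; have [PL _] := @bounded_linear_Piminus R n.
have -> : (fun h => Piminus (T h + (dradial rho x * sip x (T h)) *: v)) =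
    (fun h => (Piminus \o T) h + (dradial rho x * sip x (T h) : R) *: Piminus v).
  by apply/funext => h; rewrite (linear_funD PL) (linear_funZ _ PL).
exact: (@fredholm_rank1 R E B _ _ _ _ (@Tminus_linear R n) fT
  (bounded_linear_dradial x bT) (@Tminus_Piminus R n v)).
Qed.

Lemma compact_perturb (E : normedModType R) (x : B) (T : E -> B) (v : B) :
  bounded_linear T -> compact_op (Piplus \o T) ->
  compact_op (fun h => Piplus (T h + (dradial rho x * sip x (T h)) *: v)).
Proof.
move=> bT cT; have [PL _] := @bounded_linear_Piplus R n.
have -> : (fun h => Piplus (T h + (dradial rho x * sip x (T h)) *: v)) =
    (fun h => (Piplus \o T) h + (dradial rho x * sip x (T h) : R) *: Piplus v).
  by apply/funext => h; rewrite (linear_funD PL) (linear_funZ _ PL).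
exact: (compact_opD cT (compact_op_rank1 _ (bounded_linear_dradial x bT))).
Qed.

Lemma fredholm_perturb_prod (E E' : normedModType R) (b : seq E') (x : B) (T : E -> B)
    (D : E' -> L) (c : R) (v : B) : (forall y : E', in_span b y) ->
  bounded_linear T -> bounded_linear D -> fredholm Tminus (Piminus \o T) ->
  fredholm Tminus (fun h : E * E' => Piminus (T h.1 + (c *: incl22 (D h.2) +
    (dradial rho x * sip x (T h.1)) *: v))).
Proof.
move=> bE bT bD fT; have [PL _] := @bounded_linear_Piminus R n.
have bS : bounded_linear (fun y => Piminus (c *: incl22 (D y) : B)).
  exact: (bounded_linear_comp bD (bounded_linear_comp (@bounded_linear_incl22 R n).1
    (bounded_linear_comp (bounded_linear_scale B c) (@bounded_linear_Piminus R n)))).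
have := fredholm_add_finite (@Tminus_linear R n) bE (fredholm_perturb x v bT fT) bS
  (fun y => @Tminus_Piminus R n _).
by congr fredholm; apply/funext => h; rewrite -(linear_funD PL) -addrA [X in _ + X]addrC.
Qed.

Lemma compact_perturb_prod (E E' : normedModType R) (x : B) (T : E -> B)
    (D : E' -> L) (c : R) (v : B) :
  bounded_linear T -> bounded_linear D -> compact_op (Piplus \o T) ->
  compact_op (fun h : E * E' => Piplus (T h.1 + (c *: incl22 (D h.2) +
    (dradial rho x * sip x (T h.1)) *: v))).
Proof.
move=> bT bD cT; have [PL _] := @bounded_linear_Piplus R n.
have c1 := compact_op_precomp (@bounded_linear_fst R E E') (compact_perturb x v bT cT).
have c2 := compact_op_postcomp (compact_op_precomp
  (bounded_linear_comp (@bounded_linear_snd R E E') bD) compact_op_incl22)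
  (bounded_linear_comp (bounded_linear_scale B c) (@bounded_linear_Piplus R n)).
have := compact_opD c1 c2.
by congr compact_op; apply/funext => h; rewrite -(linear_funD PL) -addrA [X in _ + X]addrC.
Qed.

End PerturbFredholm.

Lemma compact_chart_finite_dim (R : realType) (K : @stratified R) q j (b : @chart R K)
    (e : cmod b) : is_stratified K q -> compact [set: K] -> @satlas R K j b ->
  @cdom R K b e -> exists s : seq (cmod b), forall x, in_span s x.
Proof.
move=> hK cK bj be; have [[_ hs] _ clK _ aK] := hK; have [ca _ _] := aK j.
have [hb ob [G oG Ec] bk [cp cc]] := ca _ bj.
pose x := @cpar R K b e.
have [Gx [xj xj']] : G x /\ @ostrat R K j x.
  have : cimg b x by exists e.
  by rewrite Ec.
pose U := G `&` ~` @sclosed R K j.+1.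
have Ux : nbhs x U.
  by apply: open_nbhs_nbhs; split=> //; apply: openI => //; exact: closed_openC.
have [A Ax AU] := compact_regular hs cK (filterT : nbhs x setT) Ux.
pose C1 := closure A `&` @sclosed R K j.
have C1b : C1 `<=` cimg b by move=> y [/AU[Gy yj'] yj]; rewrite Ec.
have cC1 : compact C1.
  apply: (subclosed_compact _ cK) => //.
  by apply: closedI => //; exact: closed_closure.
have cC : compact (@ccoord R K b @` C1).
  by apply: continuous_compact cC1; apply: continuous_subspaceW cc.
apply: (locally_compact_finite_dim hb cC (x0 := e)).
have ce : @cpar R K b z @[z --> e] --> x.
  have /subspace_continuousP/(_ e be) := cp.
  by rewrite within_interior// /interior; exact: open_nbhs_nbhs.
have de : nbhs e (@cdom R K b) by exact: open_nbhs_nbhs.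
apply: filterS2 de (ce _ Ax) => z zd Az; exists (@cpar R K b z); last exact: bk.
split; first exact: subset_closure.
have : cimg b (@cpar R K b z) by exists z.
by rewrite Ec => -[_ []].
Qed.

Lemma ultra_cvg (T : Type) (X : topologicalType) (G : set_system T) (g : T -> X) (x : X) :
  ProperFilter G ->
  (forall U : set_system T, UltraFilter U -> G `<=` U -> g t @[t --> U] --> x) ->
  g t @[t --> G] --> x.
Proof.
move=> PG h A Ax; apply: contrapT => nGA.
pose G' := filter_from G (fun D => D `&` ~` (g @^-1` A)).
have PG' : ProperFilter G'.
  apply: filter_from_proper; first apply: filter_from_filter.
  - by exists setT; exact: filterT.
  - move=> D1 D2 G1 G2; exists (D1 `&` D2); first exact: filterI.
    by move=> t [[? ?] ?].
  move=> D GD; apply: contrapT => D0; apply: nGA.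
  change (G (g @^-1` A)); apply: filterS GD => t Dt.
  by apply: contrapT => nAt; apply: D0; exists t.
have [U [UU G'U]] := ultraFilterLemma PG'.
have GU : G `<=` U by move=> D GD; apply: G'U; exists D => // t [].
have UA : U (g @^-1` A) by exact: (h U UU GU A Ax).
have UnA : U (~` (g @^-1` A)).
  by apply: G'U; exists setT => [|t [_ ?]//]; exact: filterT.
by have [t [? ?]] := filter_ex (filterI UA UnA).
Qed.

Lemma homo_ltn_ge (phi : nat -> nat) : {homo phi : i j / (i < j)%N} -> forall i, (i <= phi i)%N.
Proof. by move=> h; elim=> // i IH; apply: (leq_ltn_trans IH); exact: h. Qed.

Lemma homo_ltn_cvg (phi : nat -> nat) : {homo phi : i j / (i < j)%N} ->
  phi k @[k --> \oo] --> \oo.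
Proof.
move=> h A [N _ NA]; exists N => // k /= Nk; apply: NA => /=.
exact: leq_trans Nk (homo_ltn_ge h k).
Qed.

Lemma homo_ltn_cvg_comp (X : topologicalType) (phi : nat -> nat) (g : nat -> X) (x : X) :
  {homo phi : i j / (i < j)%N} -> g k @[k --> \oo] --> x -> g (phi k) @[k --> \oo] --> x.
Proof. by move=> h gx A Ax; exact: (homo_ltn_cvg h (gx A Ax)). Qed.

Lemma weak_cvgP (R : realType) (E : normedModType R) (T : Type) (G : set_system T)
    (h : T -> E) (y : E) : Filter G ->
  ((h : T -> weak E) t @[t --> G] --> (y : weak E)) <->
  forall l : E -> R^o, bounded_linear l -> l (h t) @[t --> G] --> l y.
Proof. by move=> FG; exact: (cvg_weakP y (fmap_filter h FG)). Qed.

Lemma weak_hausdorff (R : realType) (E : normedModType R) :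
  (forall x y : E, (forall l : E -> R^o, bounded_linear l -> l x = l y) -> x = y) ->
  hausdorff_space (weak E).
Proof.
move=> sep p q pq; apply: sep => l bl; apply: (@Rhausdorff R) => A C Ap Cq.
have hl (z : E) D : nbhs (l z) D -> nbhs (z : weak E) (l @^-1` D).
  have /(cvg_weakP _ (nbhs_filter (z : weak E)))/(_ l bl) : nbhs (z : weak E) --> (z : weak E).
    by [].
  exact.
have [x [Ax Cx]] := pq _ _ (hl _ _ Ap) (hl _ _ Cq).
by exists (l x).
Qed.

(* The map [f (p, k) = s p + r (s p) *: v k] inherits the functional conditions of a
   chain from [s] as soon as [L] varies continuously and boundedly in the direction
   of the perturbation. *)
Section PerturbedFamily.
Context {R : realType} {E : normedModType R} {P K : topologicalType}.
Variables (s : P -> E) (v : K -> E) (r : E -> R) (L : E -> R) (M C : R).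
Hypotheses (rM : forall x, 0 <= r x <= M) (vc : continuous v) (cK : compact [set: K])
  (vI : injective v).
Hypothesis (HL : forall (T : Type) (G : set_system T) (a w : T -> E) (z v0 : E) (r0 : R),
  ProperFilter G ->
  (forall l : E -> R^o, bounded_linear l -> l (a t) @[t --> G] --> l z) ->
  r (a t) @[t --> G] --> r0 -> w t @[t --> G] --> v0 ->
  L (a t + r (a t) *: w t) - L (a t) @[t --> G] --> L (z + r0 *: v0) - L z).
Hypothesis (HC : forall p k, `|L (s p + r (s p) *: v k) - L (s p)| <= C).
Hypothesis (sep : forall x y : E,
  (forall l : E -> R^o, bounded_linear l -> l x = l y) -> x = y).

Definition pfam (z : P * K) : E := s z.1 + r (s z.1) *: v z.2.

Lemma pfam_ultra (T : Type) (U : set_system T) (p : T -> P) (k : T -> K) : UltraFilter U ->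
  exists (r0 : R) (k0 : K), [/\ 0 <= r0 <= M, r (s (p t)) @[t --> U] --> r0 & k t @[t --> U] --> k0].
Proof.
move=> UU.
have h : U ((fun t => r (s (p t))) @^-1` `[0, M]).
  by apply: nearW => t; rewrite /= in_itv /= rM.
have [r0 /= r0M rr0] := ultra_compact_cvg UU (@segment_compact R 0 M) h.
have [k0 _ kk0] := ultra_compact_cvg (f := k) UU cK filterT.
by exists r0, k0; split=> //; move: r0M; rewrite in_itv.
Qed.

Lemma v_cvg (T : Type) (G : set_system T) (k : T -> K) (k0 : K) :
  k t @[t --> G] --> k0 -> v (k t) @[t --> G] --> v k0.
Proof. by move=> kk A /vc; exact: kk. Qed.

Lemma pfam_limits (T : Type) (G : set_system T) (p : T -> P) (k : T -> K)
    (y v0 : E) (r0 : R) :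
  ProperFilter G ->
  (forall l : E -> R^o, bounded_linear l -> l (pfam (p t, k t)) @[t --> G] --> l y) ->
  r (s (p t)) @[t --> G] --> r0 -> v (k t) @[t --> G] --> v0 ->
  (forall l : E -> R^o, bounded_linear l -> l (s (p t)) @[t --> G] --> l (y - r0 *: v0)) /\
  L (pfam (p t, k t)) - L (s (p t)) @[t --> G] --> L y - L (y - r0 *: v0).
Proof.
move=> PG fy rr0 vv0.
have rv : r (s (p t)) *: v (k t) @[t --> G] --> r0 *: v0 by exact: cvgZ.
have sz l : bounded_linear l -> l (s (p t)) @[t --> G] --> (l (y - r0 *: v0) : R^o).
  move=> bl; rewrite (linear_funB bl.1).
  have -> : (fun t => l (s (p t))) =
      (fun t => l (pfam (p t, k t)) - l (r (s (p t)) *: v (k t))).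
    by apply/funext => t; rewrite -(linear_funB bl.1) addrK.
  apply: cvgB; first exact: fy.
  exact: (@cvg_comp _ _ _ _ l _ _ _ rv (bl.2 _)).
split=> //; have := HL PG sz rr0 vv0.
by rewrite subrK.
Qed.

Lemma pfam_lower_bound : (exists m, forall p, m <= L (s p)) ->
  exists m, forall z, m <= L (pfam z).
Proof.
move=> [m sm]; exists (m - C) => z; have := HC z.1 z.2; have := sm z.1.
rewrite -/(pfam z) ler_norml => h /andP[h' _]; lra.
Qed.

Lemma pfam_lsc :
  (forall (y : E) (t : R), t < L y ->
     exists2 W, nbhs (y : weak E) W & forall p, W (s p) -> t < L (s p)) ->
  forall (y : E) (t : R), t < L y ->
     exists2 W, nbhs (y : weak E) W & forall z, W (pfam z) -> t < L (pfam z).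
Proof.
move=> hs y t ty; apply: contrapT => no.
pose G := filter_from [set W | nbhs (y : weak E) W]
  (fun W => [set z | W (pfam z) /\ L (pfam z) <= t]).
have PG : ProperFilter G.
  apply: filter_from_proper; first apply: filter_from_filter.
  - by exists setT; exact: filterT.
  - move=> W1 W2 W1y W2y; exists (W1 `&` W2); first exact: filterI.
    by move=> z [[? ?] ?].
  move=> W Wy; apply: contrapT => W0; apply: no; exists W => // z Wz.
  by rewrite ltNge; apply/negP => Lz; apply: W0; exists z.
have [U [UU GU]] := ultraFilterLemma PG.
have UF : Filter U by apply: filter_filter.
have fy : forall l : E -> R^o, bounded_linear l -> l (pfam (z.1, z.2)) @[z --> U] --> l y.
  apply/(weak_cvgP (fun z => pfam (z.1, z.2)) y UF) => W Wy.
  by apply: GU; exists W => // -[p k] [].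
have [r0 [k0 [_ rr0 kk0]]] := pfam_ultra fst snd UU.
have vv0 : v z.2 @[z --> U] --> v k0.
  exact: (v_cvg kk0).
have [sz Ld] := pfam_limits _ fy rr0 vv0.
set z0 := y - r0 *: v k0 in sz Ld.
have d0 : 0 < (L y - t) / 2 by rewrite divr_gt0// subr_gt0.
have [W Wz0 hW] := hs z0 (L z0 - (L y - t) / 2) (ltac:(rewrite ltrBlDr ltrDl//)).
have sW : U [set z | W (s z.1)].
  have /(weak_cvgP (fun z => s z.1) z0 UF) := sz.
  by move=> /(_ W Wz0).
have UL : U [set z | L (pfam z) <= t].
  by apply: GU; exists setT; [exact: filterT|move=> z []].
have /cvgrPdist_lt /(_ _ d0) Ld' := Ld.
have [[p k] [[/= /hW h1 h2] h3]] := filter_ex (filterI (filterI sW UL) Ld').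
move: h3; rewrite /= ltr_norml => /andP[h3 h4]; lra.
Qed.

Lemma pfam_sequence :
  (forall (x : nat -> P) (y : E),
     (fun k => s (x k) : weak E) @ \oo --> (y : weak E) ->
     (fun k => L (s (x k))) @ \oo --> L y ->
     exists (phi : nat -> nat) (q : P),
       {homo phi : i j / (i < j)%N} /\ (fun k => x (phi k)) @ \oo --> q) ->
  forall (x : nat -> P * K) (y : E),
     (fun k => pfam (x k) : weak E) @ \oo --> (y : weak E) ->
     (fun k => L (pfam (x k))) @ \oo --> L y ->
     exists (phi : nat -> nat) (q : P * K),
       {homo phi : i j / (i < j)%N} /\ (fun k => x (phi k)) @ \oo --> q.
Proof.
move=> hs x y xy Lxy.
have {}xy : forall l : E -> R^o, bounded_linear l -> l (pfam (x k)) @[k --> \oo] --> l y.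
  by apply/(weak_cvgP (fun k => pfam (x k)) y _).
have [U [UU oU]] := ultraFilterLemma (eventually_filter : ProperFilter \oo).
have [r0 [k0 [_ rr0 kk0]]] := pfam_ultra (fun k => (x k).1) (fun k => (x k).2) UU.
have vv0 : v (x k).2 @[k --> U] --> v k0.
  exact: (v_cvg kk0).
have sel (Nm : nat * nat) : exists j, [/\ (Nm.1 < j)%N,
    `|r0 - r (s (x j).1)| < Nm.2.+1%:R^-1 & `|v k0 - v (x j).2| < Nm.2.+1%:R^-1].
  have e0 : 0 < (Nm.2.+1%:R : R)^-1 by rewrite invr_gt0.
  have /cvgrPdist_lt /(_ _ e0) h1 := rr0; have /cvgrPdist_lt /(_ _ e0) h2 := vv0.
  have h3 : U [set j | (Nm.1 < j)%N] by apply: oU; exists Nm.1.+1.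
  by have [j [[? ?] ?]] := filter_ex (filterI (filterI h3 h1) h2); exists j.
have [g gP] := choice sel.
pose phi := fix phi m := if m is m'.+1 then g (phi m', m) else g (0%N, 0%N).
have phiS m : (phi m < phi m.+1)%N by have [] := gP (phi m, m.+1).
have phi_homo : {homo phi : i j / (i < j)%N} by apply: homo_ltn => //; exact: ltn_trans.
have phi_r m : `|r0 - r (s (x (phi m)).1)| < m.+1%:R^-1.
  by case: m => [|m]; [have [] := gP (0%N, 0%N)|have [] := gP (phi m, m.+1)].
have phi_v m : `|v k0 - v (x (phi m)).2| < m.+1%:R^-1.
  by case: m => [|m]; [have [] := gP (0%N, 0%N)|have [] := gP (phi m, m.+1)].
have phi_x m : ((x (phi m)).1, (x (phi m)).2) = x (phi m) by rewrite -surjective_pairing.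
have rr : r (s (x (phi m)).1) @[m --> \oo] --> r0.
  apply/cvgrPdist_lt => e e0.
  by apply: filterS (near_infty_natSinv_lt (PosNum e0)) => m; exact: lt_trans.
have vv : v (x (phi m)).2 @[m --> \oo] --> v k0.
  apply/cvgrPdist_lt => e e0.
  by apply: filterS (near_infty_natSinv_lt (PosNum e0)) => m; exact: lt_trans.
have fy (l : E -> R^o) : bounded_linear l ->
    l (pfam ((x (phi m)).1, (x (phi m)).2)) @[m --> \oo] --> l y.
  move=> bl; under eq_fun do rewrite phi_x.
  exact: (homo_ltn_cvg_comp phi_homo (xy l bl)).
have [sz Ld] := pfam_limits eventually_filter fy rr vv.
have Lf : L (pfam ((x (phi m)).1, (x (phi m)).2)) @[m --> \oo] --> L y.
  under eq_fun do rewrite phi_x.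
  exact: (homo_ltn_cvg_comp phi_homo Lxy).
have Ls : L (s (x (phi m)).1) @[m --> \oo] --> L (y - r0 *: v k0).
  have yE (a b : R) : a - (a - b) = b by rewrite opprB addrCA subrr addr0.
  have := cvgB Lf Ld; rewrite yE opprB addrCA subrr addr0 => h; exact: h.
have [psi [q [psi_homo pq]]] := hs (fun m => (x (phi m)).1) (y - r0 *: v k0)
  ((weak_cvgP (fun m => s (x (phi m)).1) _ _).2 sz) Ls.
have kk : (x (phi m)).2 @[m --> \oo] --> k0.
  apply: ultra_cvg => V VV oV.
  have [k1 _ hk1] := ultra_compact_cvg (f := fun m => (x (phi m)).2) VV cK filterT.
  suff -> : k0 = k1 by [].
  apply: vI; have vk1 : v (x (phi m)).2 @[m --> V] --> v k1.
    exact: (v_cvg hk1).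
  apply: (@cvg_unique _ (@norm_hausdorff R E) _ _ _ _ _ vk1).
  by move=> A /vv /oV.
exists (phi \o psi), (q, k0); split.
  by move=> i j ij; apply: phi_homo; exact: psi_homo.
have kpsi := homo_ltn_cvg_comp psi_homo kk.
have -> : (fun m => x ((phi \o psi) m)) =
    (fun m => ((x (phi (psi m))).1, (x (phi (psi m))).2)).
  by apply/funext => m; rewrite -surjective_pairing.
exact: (cvg_pair pq kpsi).
Qed.

Lemma pfam_precompact :
  (forall A : set (weak E), A `<=` range s ->
     (exists N : R, forall y, A y -> `|L y| <= N) -> precompact A) ->
  forall A : set (weak E), A `<=` range pfam ->
     (exists N : R, forall y, A y -> `|L y| <= N) -> precompact A.
Proof.
move=> hs A Af [N AN].
pose A' : set (weak E) := [set x | exists p k, x = s p /\ A (pfam (p, k))].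
have [C' A'C' [cC' _]] : precompact A'.
  apply: hs; first by move=> _ [p [k [-> _]]]; exists p.
  exists (N + C) => _ [p [k [-> /AN h]]]; have := HC p k; rewrite -/(pfam (p, k)) => h'.
  apply: le_trans (lerD h h'); rewrite -[X in `|X| <= _](subKr (L (pfam (p, k)))).
  exact: ler_normB.
pose D : set (weak E) := [set c | exists w : (E * R) * K,
  [/\ C' w.1.1, 0 <= w.1.2 <= M & c = w.1.1 + w.1.2 *: v w.2]].
have AD : A `<=` D.
  move=> c Ac; have [[p k] _ e] := Af c Ac; exists ((s p, r (s p)), k); split=> //=.
  by apply: A'C'; exists p, k; rewrite e.
suff cD : compact D.
  exists D => //; split=> //; apply: compact_closed => //; exact: weak_hausdorff.
rewrite compact_ultra => U UU UD.
have [c0 [w0 _]] := filter_ex UD.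
have sel (c : weak E) : exists w : (E * R) * K, D c ->
    [/\ C' w.1.1, 0 <= w.1.2 <= M & c = w.1.1 + w.1.2 *: v w.2].
  have [[w Dw]|nD] := pselect (D c); first by exists w.
  by exists w0.
have [g gP] := choice sel.
have U1 : U ((fun c => (g c).1.1 : weak E) @^-1` C').
  by apply: filterS UD => c /gP[].
have U2 : U ((fun c => (g c).1.2) @^-1` `[0, M]).
  by apply: filterS UD => c /gP[_ h _]; rewrite /= in_itv.
have [x0 C'x0 gx0] := ultra_compact_cvg UU cC' U1.
have [r0 /= r0M rr0] := ultra_compact_cvg UU (@segment_compact R 0 M) U2.
have [k0 _ kk0] := ultra_compact_cvg (f := fun c => (g c).2) UU cK filterT.
exists (x0 + r0 *: v k0); split.
  by exists ((x0, r0), k0); split=> //; move: r0M; rewrite in_itv.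
have vv0 : v (g c).2 @[c --> U] --> v k0.
  exact: (v_cvg kk0).
have rv : (g c).1.2 *: v (g c).2 @[c --> U] --> r0 *: v k0 by exact: cvgZ.
have UF : Filter U by apply: filter_filter.
apply/(cvg_weakP _ UF) => l bl.
have /(weak_cvgP (fun c => (g c).1.1) x0 UF)/(_ l bl) lx := gx0.
have lrv : l ((g c).1.2 *: v (g c).2) @[c --> U] --> l (r0 *: v k0).
  exact: (@cvg_comp _ _ _ _ l _ _ _ rv (bl.2 _)).
rewrite (linear_funD bl.1); apply: cvg_trans (cvgD lx lrv).
apply: near_eq_cvg; apply: filterS UD => c /gP[_ _ e].
by rewrite [in RHS]e (linear_funD bl.1).
Qed.

End PerturbedFamily.

Lemma is_diff_fredholm (R : realType) (E F G : normedModType R) (V : set G)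
    (f D : E -> F) (Q : F -> G) e : is_diff e f D ->
  fredholm V (fun h => Q (D h)) -> fredholm V (Q \o 'd f e).
Proof. by move=> [_ <-]. Qed.

Lemma is_diff_compact_op (R : realType) (E F G : normedModType R)
    (f D : E -> F) (Q : F -> G) e : is_diff e f D ->
  compact_op (fun h => Q (D h)) -> compact_op (Q \o 'd f e).
Proof. by move=> [_ <-]. Qed.

Section PerturbationBounds.
Context {R : realType} {n : nat} (rho : R -> R).
Hypothesis Hrho : is_cutoff rho.
Local Notation B := (Bhalf R n).
Local Notation L := (L22 R n).

Lemma radial_gt0 (x : B) : 0 < (radial rho x : R).
Proof. by rewrite /radial; exact: cutoff_gt0. Qed.

Lemma radial_bound : exists M : R, forall x : B, 0 <= (radial rho x : R) <= M.
Proof.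
have [M M0 h] := cutoff_bound Hrho; exists M => x.
have r0 := cutoff_gt0 Hrho (`|x| ^+ 2).
rewrite /radial (ltW r0) /=; apply: le_trans (h _ (normr_ge0 x)).
by rewrite ler_peMr ?(ltW r0)// lerDl.
Qed.

Lemma incl22_inj : injective (@incl22 R n).
Proof.
move=> x y xy; apply: val_inj.
exact: (congr1 (@fcoef R 1 n) xy).
Qed.

Lemma dual_separates (x y : B) :
  (forall l : B -> R^o, bounded_linear l -> l x = l y) -> x = y.
Proof.
move=> h; have bl : bounded_linear (fun z : B => sip z (x - y) : R^o).
  apply: (@bound_bounded_linear _ _ _ _ `|x - y|).
    by have [h1 _ _] := @bounded_bilinear_sip R 1 n; exact: h1.
  by move=> z; rewrite mulrC; exact: sip_bound.
have e : sip (x - y) (x - y) = 0 by rewrite (linear_funB bl.1) (h _ bl) subrr.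
apply/eqP; rewrite -subr_eq0 -normr_eq0 -sqrf_eq0; apply/eqP.
by rewrite -sip_norm.
Qed.

Lemma dense_scale_incl22 (c : R) : c != 0 -> dense (range (fun w : L => c *: incl22 w : B)).
Proof.
move=> c0 O [x Ox] oO.
have oO' : open [set y : B | O (c *: y)].
  by have /continuousP := (bounded_linear_scale B c).2; exact.
have [|y [Oy [w _ wy]]] := dense_incl22 _ oO'.
  by exists (c^-1 *: x); rewrite /= scalerA divff// scale1r.
by exists (c *: y); split=> //; exists w => //; rewrite wy.
Qed.

Lemma dense_superset (A C : set B) : A `<=` C -> dense A -> dense C.
Proof. by move=> AC dA O O0 oO; have [x [Ox /AC Cx]] := dA O O0 oO; exists x. Qed.

End PerturbationBounds.

Theorem theorem2 (R : realType) (n : nat) (eps : R) (H : Cn R n -> R)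
    (rho : R -> R) (P : @stratified R) (sigma : P -> Bhalf R n)
    (eps_gt0 : 0 < eps) (HH : is_hamiltonian eps H) (Hrho : is_cutoff rho)
    (Hsigma : is_loop_chain H sigma) :
  let F := perturb rho sigma in
  [/\ forall x : P, F (x, 0) = sigma x,
      forall (i : nat) (a : chart P) (e : cmod a) (v : L22 R n),
        @satlas R P i a -> @cdom R P a e -> unit_ball22 v ->
        let Fa := fun z : cmod a * L22 R n => F (cpar z.1, z.2) in
        differentiable Fa (e, v) /\ dense (range ('d Fa (e, v))),
      forall (i : nat) (a : chart P) (e : cmod a) (v : L22 R n),
        @satlas R P i a -> @cdom R P a e -> unit_ball22 v ->
        let Fx := fun e' : cmod a => F (cpar e', v) in
        let Fv := fun v' : L22 R n => F (cpar e, v') in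
        [/\ differentiable Fx e /\ differentiable Fv v,
            fredholm Tminus (Piminus \o 'd Fx e),
            compact_op (Piplus \o 'd Fx e) &
            compact_op ('d Fv v)] &
      forall (K : @stratified R) (iota : K -> L22 R n),
        is_lc_manifold K -> compact [set: K] ->
        lc_smooth iota -> injective iota -> (forall y, unit_ball22 (iota y)) ->
        @is_loop_chain R n H (prod_strat P K) (fun z => F (z.1, iota z.2))].
Proof.
move=> F; have [[lcP lsP] [lb lsc] seqP precP fredP] := Hsigma.
have [_ smP _] := lsP; have [[p hP] _] := lcP.
have [[iL iC] ib] := @bounded_linear_incl22 R n.
have dS i (a : @chart R P) (e : cmod a) : @satlas R P i a -> @cdom R P a e ->
    differentiable (fun e' : cmod a => sigma (cpar e')) e.
  by move=> ai ae; have [h _] := smP i a ai 1%N; exact: h.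
have idL (v : L22 R n) : is_diff v (fun w : L22 R n => w) (fun w => w).
  by apply: bounded_linear_is_diff; split=> // y; exact: cvg_id.
split.
- by move=> x; rewrite /F /perturb /= (linear_fun0 iL) scaler0 addr0.
- move=> i a e v ai ae _ Fa; have d := dS i a e ai ae.
  have dF := @perturb_prod_is_diff R n rho Hrho _ _ (fun e' : cmod a => sigma (cpar e'))
    (fun w : L22 R n => w) (e, v) d (is_diff_differentiable (idL v)).
  have dFa : differentiable Fa (e, v) by exact: (is_diff_differentiable dF).
  split=> //; have [dL _] := diff_bounded_linear d.
  have c0 : (radial rho (sigma (cpar e)) : R) != 0 by rewrite gt_eqF// radial_gt0.
  apply: (dense_superset _ (dense_scale_incl22 c0)) => _ [w _ <-].
  exists (0, w) => //; rewrite (is_diffE _ dF) /= (linear_fun0 dL).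
  by rewrite (is_diffE _ (idL v)) sipC sip0l mulr0 scale0r addr0 add0r.
- move=> i a e v ai ae _ Fx Fv; have d := dS i a e ai ae.
  have dFx := (@perturb_cst_is_diff R n rho Hrho _ _ v e d : is_diff e Fx _).
  have dFv := (@perturb_snd_is_diff R n rho (sigma (cpar e)) v : is_diff v Fv _).
  have bd := diff_bounded_linear d; have [fS cS] := fredP i a ai e ae.
  split.
  + by split; [exact: (is_diff_differentiable dFx)|exact: (is_diff_differentiable dFv)].
  + exact: (is_diff_fredholm dFx (fredholm_perturb rho (sigma (cpar e)) (incl22 v) bd fS)).
  + exact: (is_diff_compact_op dFx (compact_perturb rho (sigma (cpar e)) (incl22 v) bd cS)).
  + exact: (is_diff_compact_op (Q := id) dFv (compact_op_postcomp (@compact_op_incl22 R n)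
      (bounded_linear_scale (Bhalf R n) (radial rho (sigma (cpar e)))))).
move=> K iota lcK cK lsK iI iu; have [[q hK] _] := lcK; have [ci smK _] := lsK.
have [M rM] := @radial_bound R n rho Hrho; have [C C0 HC] := action_perturb_bound HH Hrho.
have vc : continuous (fun k : K => incl22 (iota k) : Bhalf R n).
  by move=> k; apply: (@continuous_comp _ _ _ iota (@incl22 R n)); [exact: ci|exact: iC].
have vI : injective (fun k : K => incl22 (iota k) : Bhalf R n).
  by move=> k k' /incl22_inj /iI.
have HC' (x : P) (k : K) : `|action H (sigma x + (radial rho (sigma x) : R) *: incl22 (iota k)) -
    action H (sigma x)| <= C.
  by apply: HC; apply: le_trans (ib _) _; apply: ltW; exact: iu.
have HL (T : Type) (G : set_system T) (a w : T -> Bhalf R n) (z v0 : Bhalf R n) (r0 : R) :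
    ProperFilter G ->
    (forall l : Bhalf R n -> R^o, bounded_linear l -> l (a t) @[t --> G] --> l z) ->
    (radial rho (a t) : R) @[t --> G] --> r0 -> w t @[t --> G] --> v0 ->
    action H (a t + (radial rho (a t) : R) *: w t) - action H (a t) @[t --> G] -->
    action H (z + r0 *: v0) - action H z.
  by move=> PG h1 h2 h3; exact: (perturb_action_cvg HH Hrho PG h1 h2 h3).
split.
- split; first exact: is_lc_manifold_prod.
  exact: (lc_smooth_perturb Hrho hP hK lsP lsK).
- split; first exact: (pfam_lower_bound HC' lb).
  exact: (pfam_lsc rM vc cK HL lsc).
- exact: (pfam_sequence rM vc cK vI HL seqP).
- exact: (pfam_precompact rM vc cK HC' (@dual_separates R n) precP).
move=> m _ [i [j [a [b [_ ai bj ->]]]]] e [ea eb].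
have d := dS i a e.1 ai ea; have bd := diff_bounded_linear d.
have dI : differentiable (fun e' : cmod b => iota (cpar e')) e.2.
  by have [h _] := smK j b bj 1%N; exact: h.
have bI := diff_bounded_linear dI.
have dF := @perturb_prod_is_diff R n rho Hrho _ _ (fun e' : cmod a => sigma (cpar e'))
  (fun e' : cmod b => iota (cpar e')) e d dI.
have [s sE] := compact_chart_finite_dim hK cK bj eb.
have [fS cS] := fredP i a ai e.1 ea.
split.
- exact: (is_diff_fredholm dF (fredholm_perturb_prod rho (sigma (cpar e.1))
    (radial rho (sigma (cpar e.1))) (incl22 (iota (cpar e.2))) sE bd bI fS)).
- exact: (is_diff_compact_op dF (compact_perturb_prod rho (sigma (cpar e.1))
    (radial rho (sigma (cpar e.1))) (incl22 (iota (cpar e.2))) bd bI cS)).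
Qed.
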